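(* Let $i\in\mathbb{Z}$. Then, for any $j\in\{0,1,\ldots,p-2\}$, $$\gamma_{\mathfrak{S}_p}(\Omega^i(D_j))=\frac{\sin\left(\frac{(j+1)\pi}{p}\right)}{\sin\left(\frac{\pi}{p}\right)}.$$ Furthermore: (i) $\gamma_{\mathfrak{S}_p}$ is additive and multiplicative on modules, i.e. $\gamma_{\mathfrak{S}_p}(M\oplus N)=\gamma_{\mathfrak{S}_p}(M)+\gamma_{\mathfrak{S}_p}(N)$ and $\gamma_{\mathfrak{S}_p}(M\otimes N)=\gamma_{\mathfrak{S}_p}(M)\gamma_{\mathfrak{S}_p}(N)$ for all $F\mathfrak{S}_p$-modules $M,N$, and so the displayed formula determines $\gamma_{\mathfrak{S}_p}$ on any $F\mathfrak{S}_p$-module; (ii) $\gamma_{\mathfrak{S}_p}(M\otimes M^* )=\gamma_{\mathfrak{S}_p}(M)^2$ for any $F\mathfrak{S}_p$-module $M$.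
   Context: $F$ is an algebraically closed field of prime characteristic $p$, and $\mathfrak{S}_p$ is the symmetric group on $p$ letters. Modules are finite-dimensional left modules; $\otimes$ is the tensor product over $F$ with diagonal group action and $M^*$ is the dual module. $S^\lambda$ denotes the (James) Specht module over $F$ labelled by a partition $\lambda$ of $p$; if $\lambda$ is $p$-regular (no part is repeated $p$ or more times), $D^\lambda=S^\lambda/\mathrm{Rad}(S^\lambda)$ is the corresponding simple module. For $0\le j\le p-2$ put $D_j=D^{(p-j,1^j)}$; these are the simple modules in the principal block of $F\mathfrak{S}_p$. Heller operators: $\Omega(M)$ is the kernel of a projective cover of $M$ and $\Omega^{-1}(M)$ is the cokernel of an injective hull $M\hookrightarrow \mathrm{I}(M)$; these are iterated to define $\Omega^i(M)$ for all $i\in\mathbb{Z}\setminus\{0\}$; $\Omega^0(M)$ (the core of $M$) is the largest direct summand of $M$ having no nonzero projective direct summand. For a finite group $G$ and an $FG$-module $M$, put $\mathsf{c}_n^G(M)=\dim_F\Omega^0(M^{\otimes n})$ for $n\ge 1$; the Benson--Symonds invariant of $M$ is $\gamma_G(M)=\limsup_{n\to\infty}\sqrt[n]{\mathsf{c}_n^G(M)}$. *)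

(* Defs.v *)
From HB Require Import structures.
From mathcomp Require Import all_boot all_order all_algebra all_fingroup.
From mathcomp Require Import all_character.
From mathcomp Require Import boolp classical_sets reals topology normedtype.
From mathcomp Require Import sequences exp trigo.

Set Implicit Arguments.
Unset Strict Implicit.
Unset Printing Implicit Defensive.

Import GRing.Theory Num.Theory.
Local Open Scope ring_scope.

(* A finite-dimensional FG-module is a [representation F G], with G acting on
   row vectors by v |-> v *m M g.  MathComp composes permutations from left to
   right ((s * t) x = t (s x)), so these right modules over 'S_n are the left
   modules over the symmetric group whose product is composition of functions
   written on the left. *)

Section Modules.

Variables (F : fieldType) (gT : finGroupType) (G : {group gT}).
Local Notation module := (representation F G).

Definition is_hom (M N : module) (f : 'M[F]_(rdegree M, rdegree N)) : Prop :=
  {in G, forall g, M g *m f = f *m N g}.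

(* As f acts by v |-> v *m f, it is injective when [row_free f], surjective
   when [row_full f], its image is the row space of f and its kernel that of
   [kermx f]. *)

Definition projective (P : module) : Prop :=
  forall (A B : module) (e : 'M[F]_(rdegree A, rdegree B))
    (f : 'M[F]_(rdegree P, rdegree B)),
    is_hom e -> row_full e -> is_hom f ->
    exists2 h : 'M[F]_(rdegree P, rdegree A), is_hom h & h *m e = f.

Definition injective_module (Q : module) : Prop :=
  forall (A B : module) (e : 'M[F]_(rdegree A, rdegree B))
    (f : 'M[F]_(rdegree A, rdegree Q)),
    is_hom e -> row_free e -> is_hom f ->
    exists2 h : 'M[F]_(rdegree B, rdegree Q), is_hom h & e *m h = f.

Definition projective_cover (P M : module)
    (f : 'M[F]_(rdegree P, rdegree M)) : Prop :=
  [/\ projective P, is_hom f, row_full f &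
      forall U : 'M[F]_(rdegree P),
        mxmodule P U -> row_full (U *m f) -> row_full U].

Definition injective_hull (M Q : module)
    (f : 'M[F]_(rdegree M, rdegree Q)) : Prop :=
  [/\ injective_module Q, is_hom f, row_free f &
      forall U : 'M[F]_(rdegree Q),
        mxmodule Q U -> (U :&: f)%MS = 0 -> U = 0].

Definition is_kernel (N P M : module)
    (f : 'M[F]_(rdegree P, rdegree M)) : Prop :=
  exists k : 'M[F]_(rdegree N, rdegree P),
    [/\ is_hom k, row_free k & (k :=: kermx f)%MS].

Definition is_cokernel (N M Q : module)
    (f : 'M[F]_(rdegree M, rdegree Q)) : Prop :=
  exists q : 'M[F]_(rdegree Q, rdegree N),
    [/\ is_hom q, row_full q & (kermx q :=: f)%MS].

Definition is_summand (N M : module) : Prop :=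
  exists N' : module, mx_rsim M (dadd_grepr N N').

Definition projective_free (M : module) : Prop :=
  forall P : module, projective P -> is_summand P M -> rdegree P = 0%N.

Definition is_core (M N : module) : Prop :=
  [/\ is_summand N M, projective_free N &
      forall N' : module, is_summand N' M -> projective_free N' ->
        (rdegree N' <= rdegree N)%N].

Definition is_Omega (M N : module) : Prop :=
  exists (P : module) (f : 'M[F]_(rdegree P, rdegree M)),
    projective_cover f /\ is_kernel N f.

Definition is_OmegaV (M N : module) : Prop :=
  exists (Q : module) (f : 'M[F]_(rdegree M, rdegree Q)),
    injective_hull f /\ is_cokernel N f.

Definition is_radical (M : module) (J : 'M[F]_(rdegree M)) : Prop :=
  forall v : 'rV[F]_(rdegree M),
    (v <= J)%MS <->
    (forall U : 'M[F]_(rdegree M),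
       mxmodule M U -> max_submod M U 1%:M -> (v <= U)%MS).

Definition is_head (M N : module) : Prop :=
  exists (J : 'M[F]_(rdegree M)) (q : 'M[F]_(rdegree M, rdegree N)),
    [/\ is_radical J, is_hom q, row_full q & (kermx q :=: J)%MS].

(* Core, Heller translates and head exist and are unique up to isomorphism, so
   the default value is never used and the choice is immaterial. *)
Definition some_module (C : module -> Prop) : module :=
  if pselect (exists N, C N) is left exC then projT1 (cid exC) else grepr0.

Definition core (M : module) : module := some_module (is_core M).
Definition Omega (M : module) : module := some_module (is_Omega M).
Definition OmegaV (M : module) : module := some_module (is_OmegaV M).
Definition head_module (M : module) : module := some_module (is_head M).

Definition heller (i : int) (M : module) : module :=
  match i with
  | Posz 0 => core M
  | Posz n => iter n Omega M
  | Negz n => iter n.+1 OmegaV M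
  end.

Definition tensor (M N : module) : module := Representation (prod_repr M N).

Lemma trivial_mx_repr : mx_repr G (fun _ : gT => 1%:M : 'M[F]_1).
Proof. by split=> // g h _ _; rewrite mulmx1. Qed.

Definition trivial_module : module :=
  Representation (MxRepresentation trivial_mx_repr).

Definition tensor_power (M : module) (n : nat) : module :=
  iterop n tensor M trivial_module.

Lemma dual_mx_repr (M : module) : mx_repr G (fun g => (M g^-1%g)^T).
Proof.
split=> [|g h Gg Gh]; first by rewrite invg1 repr_mx1 trmx1.
by rewrite invMg repr_mxM ?groupV // trmx_mul.
Qed.

Definition dual_module (M : module) : module :=
  Representation (MxRepresentation (dual_mx_repr M)).

Definition core_dim (M : module) (n : nat) : nat :=
  rdegree (core (tensor_power M n)).

(* The sequence starts at the first tensor power. *)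
Definition bs_gamma (R : realType) (M : module) : R :=
  limn_sup (fun n : nat => (core_dim M n.+1)%:R `^ (n.+1%:R^-1)).

End Modules.

Section PermutationModule.

Variables (F : fieldType) (gT : finGroupType) (G : {group gT}) (T : finType).
Variable to : {action gT &-> T}.

Definition action_mx (g : gT) : 'M[F]_#|T| :=
  \matrix_(i, j) (enum_val j == to (enum_val i) g)%:R.

Lemma delta_action_mx (x : T) (g : gT) :
  delta_mx 0 (enum_rank x) *m action_mx g
    = delta_mx 0 (enum_rank (to x g)) :> 'rV[F]_#|T|.
Proof.
apply/rowP=> j; rewrite -rowE !mxE enum_rankK eqxx /=.
by rewrite -(can_eq enum_rankK) enum_valK.
Qed.

Lemma action_mx_repr : mx_repr G action_mx.
Proof.
split=> [|g h _ _].
  by apply/matrixP=> i j; rewrite !mxE act1 (inj_eq enum_val_inj) eq_sym.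
apply/row_matrixP=> i; rewrite row_mul !rowE -[i]enum_valK.
by rewrite !delta_action_mx actM.
Qed.

Definition permutation_module : representation F G :=
  Representation (MxRepresentation action_mx_repr).

End PermutationModule.

Section Specht.

Variables (F : fieldType) (n : nat) (la : seq nat).
Local Notation Sn := [set: 'S_n]%G.

(* Here la is a partition of n.  A la-tableau is encoded by the function giving
   the (row, column) position of each entry; as there are n entries, being
   injective into the Young diagram makes it a bijection onto it. *)
Definition is_tableau (t : {ffun 'I_n -> 'I_n * 'I_n}) : bool :=
  injectiveb t && [forall x, ((t x).2 < nth 0 la (t x).1)%N].

Definition tableau := {t : {ffun 'I_n -> 'I_n * 'I_n} | is_tableau t}.

(* Two tableaux are row equivalent when every entry lies in the same row of
   both, so a tabloid is encoded by the row of each entry. *)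
Definition rows (t : {ffun 'I_n -> 'I_n * 'I_n}) : {ffun 'I_n -> 'I_n} :=
  [ffun x => (t x).1].

Definition is_tabloid (f : {ffun 'I_n -> 'I_n}) : bool :=
  [exists t, is_tableau t && (f == rows t)].

Definition tabloid := {f : {ffun 'I_n -> 'I_n} | is_tabloid f}.

(* The entry x of a tableau or tabloid is replaced by s x. *)
Definition relabel (T : Type) (f : {ffun 'I_n -> T}) (s : 'S_n) :
  {ffun 'I_n -> T} := [ffun x => f (s^-1%g x)].

Lemma relabel_tableau (t : {ffun 'I_n -> 'I_n * 'I_n}) s :
  is_tableau t -> is_tableau (relabel t s).
Proof.
case/andP=> /injectiveP t_inj /forallP t_in; apply/andP; split.
  by apply/injectiveP=> x y; rewrite !ffunE => /t_inj/perm_inj.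
by apply/forallP=> x; rewrite !ffunE; apply: t_in.
Qed.

Lemma rows_relabel (t : {ffun 'I_n -> 'I_n * 'I_n}) s :
  rows (relabel t s) = relabel (rows t) s.
Proof. by apply/ffunP=> x; rewrite !ffunE. Qed.

Lemma relabel_tabloid (f : {ffun 'I_n -> 'I_n}) s :
  is_tabloid f -> is_tabloid (relabel f s).
Proof.
case/existsP=> t /andP[tab_t /eqP->]; apply/existsP; exists (relabel t s).
by rewrite relabel_tableau //= rows_relabel.
Qed.

Lemma rows_tabloid (t : {ffun 'I_n -> 'I_n * 'I_n}) :
  is_tableau t -> is_tabloid (rows t).
Proof. by move=> tab_t; apply/existsP; exists t; rewrite tab_t eqxx. Qed.

Definition tableau_act (t : tableau) (s : 'S_n) : tableau :=
  Sub (relabel (val t) s) (relabel_tableau s (valP t)).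

Definition tabloid_act (f : tabloid) (s : 'S_n) : tabloid :=
  Sub (relabel (val f) s) (relabel_tabloid s (valP f)).

Definition tabloid_of (t : tableau) : tabloid :=
  Sub (rows (val t)) (rows_tabloid (valP t)).

Lemma relabel1 T (f : {ffun 'I_n -> T}) : relabel f 1 = f.
Proof. by apply/ffunP=> x; rewrite ffunE invg1 perm1. Qed.

Lemma relabelM T (f : {ffun 'I_n -> T}) s r :
  relabel f (s * r) = relabel (relabel f s) r.
Proof. by apply/ffunP=> x; rewrite !ffunE invMg permM. Qed.

Lemma tabloid_act1 : tabloid_act^~ 1%g =1 id.
Proof. by move=> f; apply: val_inj; apply: relabel1. Qed.

Lemma tabloid_actM f : act_morph tabloid_act f.
Proof. by move=> s r; apply: val_inj; apply: relabelM. Qed.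

Definition tabloid_action : {action 'S_n &-> tabloid} :=
  TotalAction tabloid_act1 tabloid_actM.

Definition tabloid_module : representation F Sn :=
  permutation_module F Sn tabloid_action.

Definition column_stabiliser (t : tableau) : {set 'S_n} :=
  [set s : 'S_n | [forall x, (val t (s x)).2 == (val t x).2]].

Definition polytabloid (t : tableau) : 'rV[F]_#|{: tabloid}| :=
  \sum_(s in column_stabiliser t)
    (-1) ^+ s *: delta_mx 0 (enum_rank (tabloid_of (tableau_act t s))).

Definition specht_mx : 'M[F]_#|{: tabloid}| :=
  (\sum_(t : tableau) <<polytabloid t>>)%MS.

Lemma column_stabiliser_act (t : tableau) (g s : 'S_n) :
  ((s ^ g)%g \in column_stabiliser (tableau_act t g))
    = (s \in column_stabiliser t).
Proof.
rewrite !inE; apply/forallP/forallP=> fixc x.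
  by have:= fixc (g x); rewrite /= !ffunE permJ !permK.
have:= fixc (g^-1%g x); rewrite /= !ffunE.
by rewrite -{3}(permKV g x) permJ permK.
Qed.

Lemma polytabloid_act (t : tableau) (g : 'S_n) :
  polytabloid t *m action_mx F tabloid_action g
    = polytabloid (tableau_act t g).
Proof.
rewrite /polytabloid mulmx_suml [RHS](reindex_inj (conjg_inj g)) /=.
apply: eq_big => [s | s _]; first by rewrite column_stabiliser_act.
rewrite -scalemxAl delta_action_mx odd_permJ; congr (_ *: delta_mx 0 _).
congr enum_rank; apply: val_inj; rewrite /= !rows_relabel -!relabelM.
by rewrite -conjgC.
Qed.

Lemma specht_module : mxmodule tabloid_module specht_mx.
Proof.
apply/mxmoduleP=> g _; rewrite sumsmxMr; apply/sumsmx_subP=> t _.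
rewrite (eqmxMr _ (genmxE _)) [X in _ *m X]/= polytabloid_act.
by rewrite (sumsmx_sup (tableau_act t g)) ?genmxE.
Qed.

Definition specht : representation F Sn :=
  Representation (submod_repr specht_module).

Definition james_D : representation F Sn := head_module specht.

End Specht.

Definition hook_D (F : fieldType) (p j : nat) :
    representation F [set: 'S_p]%G :=
  james_D F p ((p - j)%N :: nseq j 1%N).

(* Main.v *)
(* Let c generate a Sylow p-subgroup C of S_p, and let phi M be the sum of the
   numbers sin (k pi / p) / sin (pi / p) over the Jordan blocks of c on M, k being
   the size of the block.  This is additive, and multiplicative because tensoring
   with the block of size two satisfies the recursion of the sine; it vanishes on
   the projective modules, which are those on which C acts freely, and k -> p - k
   shows that it is invariant under the Heller operators.

   Transfer from C to S_p shows that a nonprojective module with only scalar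
   endomorphisms has a single nonfree block.  The normaliser of C is C<h>, where h
   raises c to the power a, a primitive root mod p.  The size k of the nonfree block
   and the eigenvalue lam of h on its generator determine a module with one nonfree
   block and no projective summand, and Omega turns (k, lam) into (p - k, a^k lam).
   Hence every module is a sum of a projective module and of modules Omega^i D_j,
   provided that the block of D_j has size j + 1 or p - (j + 1).

   This follows from dim D_j = (-1)^j (j + 1) mod p.  By James's argument D_j is the
   quotient of the Specht module of a hook by the radical of its form, so dim D_j is
   the rank of a Gram matrix; up to a scalar this matrix is idempotent, and its
   rank mod p is its trace.

   Finally the dimension of the core of the n-th tensor power of M lies between
   constant multiples of phi M ^ n, as 1 <= phi (Omega^i D_j) and there are finitely
   many of these modules; so the invariant of M is phi M. *)

Require Import Defs.
From mathcomp Require Import all_boot all_order all_algebra all_fingroup.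
From mathcomp Require Import all_solvable all_character.
From mathcomp Require Import boolp classical_sets reals topology normedtype.
From mathcomp Require Import sequences exp trigo.
From mathcomp Require Import fintype finset ring lra zify.

Set Implicit Arguments.
Unset Strict Implicit.
Unset Printing Implicit Defensive.

Import Order.TTheory GRing.Theory Num.Theory.
Local Open Scope ring_scope.

(** * Nilpotent matrices *)

(** The weights are forced. A multiplicative dimension function on Jordan blocks that kills the free
    block satisfies d(k+1) = d(2) d(k) - d(k-1) and d(p) = 0, and positivity on the blocks of size
    1, ..., p-1 then selects d(2) = 2 cos(pi/p). Ranks of powers of c - 1 pass through exact
    sequences and tensor products more easily than Jordan forms, so ranks carry the argument and
    multiplicities appear as their second differences. No uniqueness of decompositions is invoked.
    Maps between blocks of the same type are built over C<h> and transferred to S_p. The transfer is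
    controlled only on vectors fixed by c, and there only modulo the norm of C; this still detects
    the nonfree block. There are (p-1)^2 types (k, lam) but only p-1 modules D_j. They suffice
    because two Heller translates multiply lam by a^k a^(p-k) = a, so that all eigenvalues occur. At
    least one translate is always taken, since Omega of any module has no projective summand. *)

Section Nilpotent.

Variables (F : fieldType) (p : nat) (p_gt0 : (0 < p)%N).

Definition rk m (N : 'M[F]_m) i : nat := \rank (N ^+ i).

(** Freeness over F[X]/(X^p), with X acting as N, when [N ^+ p = 0]: every socle vector lies at the
    bottom of a block of size p. *)
Definition cfree m (N : 'M[F]_m) : bool := (kermx N <= N ^+ p.-1)%MS.

(* For [N ^+ p = 0] this counts the Jordan blocks of size less than [p]. *)
Definition blk m (N : 'M[F]_m) : nat := (\rank (kermx N) - rk N p.-1)%N.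

(** The second condition says that the socle vector of the block of x lies no deeper than that
    block, so that the block is not part of a longer one and splits off. *)
Definition generates m (N : 'M[F]_m) k (x : 'rV[F]_m) : bool :=
  (x *m N ^+ k == 0) && ~~ (x *m N ^+ k.-1 <= N ^+ k)%MS.

Lemma expmx_le m (N : 'M[F]_m) i j : (i <= j)%N -> (N ^+ j <= N ^+ i)%MS.
Proof. by move=> /subnKC <-; rewrite addnC exprD; apply: submxMl. Qed.

Lemma rk0 m (N : 'M[F]_m) : rk N 0 = m.
Proof. by rewrite /rk expr0 mxrank1. Qed.

Section OneMatrix.

Variables (m : nat) (N : 'M[F]_m).
Hypothesis Np : N ^+ p = 0.

Lemma rkp : rk N p = 0%N. Proof. by rewrite /rk Np mxrank0. Qed.

Lemma expmx_ker i : (i <= p)%N -> (N ^+ (p - i) <= kermx (N ^+ i))%MS.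
Proof. by move=> le_ip; apply/sub_kermxP; rewrite mulmxE -exprD subnK. Qed.

Lemma rk_step i : (rk N i.+1 + \rank (N ^+ i :&: kermx N) = rk N i)%N.
Proof. by rewrite /rk exprSr -mulmxE mxrank_mul_ker. Qed.

Lemma rk_pred_ker : (rk N p.-1 <= \rank (kermx N))%N.
Proof.
have := expmx_ker p_gt0; rewrite subn1 expr1; exact: mxrankS.
Qed.

Lemma blkE : (rk N 1 + rk N p.-1 + blk N = m)%N.
Proof.
have := rk_pred_ker; have := rank_leq_row N; rewrite /blk mxrank_ker.
by rewrite [rk N 1]/rk expr1; lia.
Qed.

Lemma cfree_blk : cfree N = (blk N == 0%N).
Proof.
have le := expmx_ker p_gt0; rewrite subn1 expr1 in le.
rewrite /cfree /blk /rk subn_eq0.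
by apply/idP/idP => [/mxrankS // | h]; rewrite -(geq_leqif (mxrank_leqif_sup le)).
Qed.

(** The kernel lies in the image of every power below the p-th, so each multiplication by N loses
    the same rank, that of N^(p-1). *)
Lemma cfree_rk i : cfree N -> (i <= p)%N -> rk N i = ((p - i) * rk N p.-1)%N.
Proof.
move=> Nfree le_ip; have [j def_i le_jp] : exists2 j, i = (p - j)%N & (j <= p)%N.
  by exists (p - i)%N; [rewrite subKn | apply: leq_subr].
rewrite {i le_ip}def_i subKn //.
elim: j le_jp => [|j IHj] le_jp; first by rewrite subn0 rkp.
have {IHj} IHj := IHj (ltnW le_jp); rewrite -(rk_step (p - j.+1)).
have -> : (p - j.+1).+1 = (p - j)%N by lia.
rewrite IHj (mulSn j) addnC; congr (_ + _)%N.
have/eqmx_rank-> : (N ^+ (p - j.+1) :&: kermx N == kermx N)%MS.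
  rewrite capmxSr sub_capmx submx_refl andbT (submx_trans Nfree) //.
  by rewrite expmx_le //; lia.
by apply/eqP; rewrite eqn_leq rk_pred_ker andbT mxrankS.
Qed.

Lemma cfree_ker i : cfree N -> (i <= p)%N -> (kermx (N ^+ i) <= N ^+ (p - i))%MS.
Proof.
move=> Nfree le_ip.
rewrite -(geq_leqif (mxrank_leqif_sup (expmx_ker le_ip))) mxrank_ker.
have := cfree_rk Nfree le_ip; have := cfree_rk Nfree (leq_subr i p).
have := cfree_rk Nfree (leq0n p); rewrite rk0 subKn // /rk subn0.
set e := \rank (N ^+ p.-1) => def_m -> ->; rewrite [X in (X - _)%N]def_m; nia.
Qed.

Lemma generates_ker k x : (0 < k)%N -> generates N k x ->
  (x *m N ^+ k.-1 <= kermx N)%MS.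
Proof.
by move=> k_gt0 /andP[/eqP xk _]; apply/sub_kermxP; rewrite -mulmxA mulmxE -exprSr prednK.
Qed.

Lemma generates_blk k x : (0 < k < p)%N -> generates N k x -> (0 < blk N)%N.
Proof.
case/andP=> k_gt0 lt_kp gx; rewrite lt0n -cfree_blk; apply/negP=> Nfree.
have/andP[_ /negP[]] := gx.
apply: submx_trans (generates_ker k_gt0 gx) _.
by apply: submx_trans Nfree _; apply: expmx_le; lia.
Qed.

Lemma not_cfree_generates : ~~ cfree N ->
  exists k x, (0 < k < p)%N /\ generates N k x.
Proof.
case/row_subPn=> i; set y := row i _ => ny.
have yN : y *m N = 0 by apply/sub_kermxP; apply: row_sub.
(* At the largest depth j at which y is still an image, a preimage of y generates a block of size j
   + 1. *)
pose Q j := (y <= N ^+ j)%MS && (j <= p)%N.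
have exQ : exists j, Q j by exists 0%N; rewrite /Q expr0 submx1.
have ubQ j : Q j -> (j <= p)%N by case/andP.
case: (ex_maxnP exQ ubQ) => j /andP[/submxP[w def_y] le_jp] maxj.
have lt_jp : (j < p.-1)%N.
  rewrite ltnNge; apply/negP=> le; case/negP: ny.
  by rewrite def_y mulmx_sub // expmx_le.
exists j.+1, w; split; first lia.
rewrite /generates /= -def_y exprSr -mulmxE mulmxA -def_y yN eqxx /=.
apply/negP=> yj; have := maxj j.+1; rewrite /Q exprSr -mulmxE yj /=; lia.
Qed.

Lemma blk1_rk k x i : (0 < k < p)%N -> generates N k x -> blk N = 1%N ->
  (i <= p)%N -> rk N i = ((p - i) * rk N p.-1 + (k - i))%N.
Proof.
case/andP=> k_gt0 lt_kp gx blk1 le_ip.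
have [j def_i le_jp] : exists2 j, i = (p - j)%N & (j <= p)%N.
  by exists (p - i)%N; [rewrite subKn | apply: leq_subr].
rewrite {i le_ip}def_i subKn //.
have le0 := expmx_ker p_gt0; rewrite subn1 expr1 in le0.
have rker : \rank (kermx N) = (rk N p.-1).+1.
  by have := rk_pred_ker; move: blk1; rewrite /blk; lia.
elim: j le_jp => [|j IHj] le_jp; first by rewrite subn0 rkp; lia.
have {IHj} IHj := IHj (ltnW le_jp); rewrite -(rk_step (p - j.+1)).
have -> : (p - j.+1).+1 = (p - j)%N by lia.
rewrite IHj (mulSn j).
suff -> : \rank (N ^+ (p - j.+1) :&: kermx N) = (rk N p.-1 + (p - j.+1 < k))%N.
  by case: ltnP; lia.
have [lt_jk|le_kj] := ltnP.
  rewrite addn1 -rker; apply: eqmx_rank.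
  rewrite capmxSr sub_capmx submx_refl andbT /=.
  (* The socle vector of the nonfree block lies outside the image of N^(p-1), so the two together
     fill the kernel by rank. *)
  have kerE : (kermx N <= x *m N ^+ k.-1 + N ^+ p.-1)%MS.
    have le1 : (x *m N ^+ k.-1 + N ^+ p.-1 <= kermx N)%MS.
      by rewrite addsmx_sub le0 andbT (generates_ker k_gt0 gx).
    rewrite -(geq_leqif (mxrank_leqif_sup le1)) rker.
    have : (N ^+ p.-1 < x *m N ^+ k.-1 + N ^+ p.-1)%MS.
      rewrite /ltmx addsmxSr /=; apply: contraL gx => /(submx_trans (addsmxSl _ _)) le.
      rewrite /generates negb_and negbK orbC (submx_trans le) // expmx_le //; lia.
    by rewrite ltmxErank => /andP[].
  apply: submx_trans kerE _; rewrite addsmx_sub mulmx_sub ?expmx_le //; lia.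
rewrite addn0; apply/eqP; rewrite eqn_leq; apply/andP; split; last first.
  by apply: mxrankS; rewrite sub_capmx le0 expmx_le //; lia.
rewrite -ltnS -rker.
have : (N ^+ (p - j.+1) :&: kermx N < kermx N)%MS.
  rewrite /ltmx capmxSr /= sub_capmx negb_and; apply/orP; left.
  apply: contraL (gx) => le; rewrite /generates negb_and negbK orbC.
  by rewrite (submx_trans (generates_ker k_gt0 gx)) ?(submx_trans le) ?expmx_le.
by rewrite ltmxErank => /andP[].
Qed.

End OneMatrix.

(** The rank lost between [N ^+ i] and [N2 ^+ i] is that of the intersection of the submodule with
    the image of [N ^+ i]. By freeness this image is the kernel of [N ^+ (p - i)], and the
    intersection becomes the kernel of [N1 ^+ (p - i)]. *)
Lemma exact_rk m1 m m2 (N1 : 'M[F]_m1) (N : 'M[F]_m) (N2 : 'M[F]_m2) f g i :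
    N ^+ p = 0 -> cfree N -> (i <= p)%N ->
    N1 *m f = f *m N -> N *m g = g *m N2 ->
    row_free f -> row_full g -> (f :=: kermx g)%MS ->
  (rk N2 i + m1 = rk N i + rk N1 (p - i))%N.
Proof.
move=> Np Nfree le_ip fN gN f_free g_full fg.
have expf j : N1 ^+ j *m f = f *m N ^+ j.
  elim: j => [|j IHj]; first by rewrite !expr0 mul1mx mulmx1.
  by rewrite !exprSr -!mulmxE -mulmxA fN mulmxA IHj mulmxA.
have expg j : N ^+ j *m g = g *m N2 ^+ j.
  elim: j => [|j IHj]; first by rewrite !expr0 mul1mx mulmx1.
  by rewrite !exprS -!mulmxE -mulmxA IHj mulmxA gN mulmxA.
have E2 : (rk N2 i + \rank (N ^+ i :&: kermx g) = rk N i)%N.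
  by rewrite /rk -(mxrank_mul_ker (N ^+ i) g) expg eqmxMfull.
have E1 : (rk N1 (p - i) + \rank (f :&: kermx (N ^+ (p - i))) = m1)%N.
  transitivity (\rank f); last exact/eqP.
  by rewrite /rk -(mxrank_mul_ker f (N ^+ (p - i))) -expf mxrankMfree.
have K : (kermx (N ^+ (p - i)) :=: N ^+ i)%MS.
  apply/eqmxP; have := cfree_ker Np Nfree (leq_subr i p).
  by have := expmx_ker Np (leq_subr i p); rewrite subKn // => -> ->.
move: E1; rewrite (cap_eqmx fg K) capmxC; lia.
Qed.

End Nilpotent.

Section CharacteristicP.

Variables (F : fieldType) (p : nat) (charFp : p \in [pchar F]).

Let p_prime : prime p := pcharf_prime charFp.

Lemma subX1_poly : ('X - 1) ^+ p = 'X^p - 1 :> {poly F}.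
Proof.
have chP : p \in [pchar {poly F}] by rewrite pchar_poly.
by rewrite -!(pFrobenius_autE chP) pFrobenius_autB_comm ?pFrobenius_aut1 //; apply: commr1.
Qed.

Lemma subX1_pred_poly : ('X - 1) ^+ p.-1 = \sum_(i < p) 'X^i :> {poly F}.
Proof.
have nz : 'X - 1 != 0 :> {poly F} by rewrite polyXsubC_eq0.
apply: (mulfI nz); rewrite -exprS prednK ?prime_gt0 // subX1_poly subrX1.
by [].
Qed.

Lemma subr1X_mx m (A : 'M[F]_m) : (A - 1) ^+ p = A ^+ p - 1.
Proof.
case: m A => [|m] A; first by rewrite [LHS]flatmx0 [RHS]flatmx0.
have := congr1 (horner_mx A) subX1_poly.
by rewrite rmorphXn !rmorphB rmorph1 rmorphXn /= horner_mx_X.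
Qed.

(** For A the action of c this makes (c - 1)^(p-1) the norm of C. *)
Lemma subr1X_pred_mx m (A : 'M[F]_m) : (A - 1) ^+ p.-1 = \sum_(i < p) A ^+ i.
Proof.
case: m A => [|m] A; first by rewrite [LHS]flatmx0 [RHS]flatmx0.
have := congr1 (horner_mx A) subX1_pred_poly.
rewrite rmorphXn rmorphB /= horner_mx_X rmorph1 rmorph_sum /= => ->.
by apply: eq_bigr => i _; rewrite rmorphXn /= horner_mx_X.
Qed.

End CharacteristicP.

(** * Quantum dimensions of Jordan blocks *)

Section QuantumDimension.

Variables (R : realType) (p : nat) (p_gt1 : (1 < p)%N).

Local Notation theta := (pi / p%:R : R).

(** The quantum integer [k] at q = exp(i pi / p). *)
Definition qdim (k : nat) : R := sin (k%:R * theta) / sin theta.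
(** Up to sign, the eigenvalue of the second difference operator on [qdim]. *)
Definition qdefect : R := 2 - 2 * cos theta.

(* By summation by parts this is the sum of the [qdim k] over the Jordan blocks
   of size [k], when [f i] is the rank of the [i]-th power. *)
Definition qsum (f : nat -> R) : R :=
  f 0%N - qdefect * \sum_(1 <= k < p) qdim k * f k.

Lemma theta_gt0 : 0 < theta.
Proof. by rewrite divr_gt0 ?pi_gt0 // ltr0n; lia. Qed.

Lemma ptheta : p%:R * theta = pi :> R.
Proof. by rewrite mulrC divfK // pnatr_eq0; lia. Qed.

Lemma ktheta_le k : (k <= p)%N -> k%:R * theta <= pi.
Proof.
by move=> le_kp; rewrite -[leRHS]ptheta ler_pM2r ?theta_gt0 // ler_nat.
Qed.

Lemma sin_theta_gt0 : 0 < sin theta.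
Proof.
apply: sin_gt0_pi; rewrite theta_gt0 ltr_pdivrMr ?ltr0n; last by lia.
by rewrite ltr_pMr ?pi_gt0 // ltr1n.
Qed.

Lemma qdim0 : qdim 0 = 0.
Proof. by rewrite /qdim mul0r sin0 mul0r. Qed.

Lemma qdim1 : qdim 1 = 1.
Proof. by rewrite /qdim mul1r divff // gt_eqF // sin_theta_gt0. Qed.

Lemma qdimp : qdim p = 0.
Proof. by rewrite /qdim ptheta sinpi mul0r. Qed.

Lemma qdimB k : (k <= p)%N -> qdim (p - k) = qdim k.
Proof.
move=> le_kp; rewrite /qdim.
have -> : (p - k)%:R * theta = pi - k%:R * theta by rewrite natrB // mulrBl ptheta.
by rewrite sinB sinpi cospi mul0r sub0r mulN1r opprK.
Qed.

Lemma qdimSS k : qdim k.+2 + qdim k = 2 * cos theta * qdim k.+1.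
Proof.
rewrite /qdim -mulrDl [RHS]mulrA; congr (_ * _).
have -> : k.+2%:R * theta = k.+1%:R * theta + theta by rewrite -(natr1 k.+1); ring.
have -> : k%:R * theta = k.+1%:R * theta - theta by rewrite -(natr1 k); ring.
by rewrite sinD sinB; ring.
Qed.

Lemma qdim_ge1 k : (0 < k < p)%N -> 1 <= qdim k.
Proof.
(* The difference of the two sines is 2 cos A sin B for the half-angles A and B below; k < p keeps A
   at most pi / 2. *)
case/andP=> k_gt0 lt_kp; rewrite /qdim ler_pdivlMr ?sin_theta_gt0 // mul1r.
pose A := k.+1%:R * theta / 2; pose B := k.-1%:R * theta / 2.
have -> : k%:R * theta = A + B.
  rewrite /A /B -mulrDl -mulrDl -natrD addSn -addnS prednK // addnn -muln2 natrM.
  by rewrite mulrAC mulfK ?pnatr_eq0.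
have -> : theta = A - B.
  rewrite /A /B -mulrBl -mulrBl -natrB; last by lia.
  have -> : (k.+1 - k.-1 = 2)%N by lia.
  by rewrite mulrAC divff ?mul1r // pnatr_eq0.
have pi0 := pi_gt0 R.
have le1 : k.+1%:R * theta <= pi by apply: ktheta_le.
have le2 : k.-1%:R * theta <= pi by apply: ktheta_le; lia.
have ge1 : 0 <= k.+1%:R * theta by rewrite mulr_ge0 ?ler0n // ltW ?theta_gt0.
have ge2 : 0 <= k.-1%:R * theta by rewrite mulr_ge0 ?ler0n // ltW ?theta_gt0.
have cosA : 0 <= cos A by apply: cos_ge0_pihalf; rewrite /A; apply/andP; split; lra.
have sinB' : 0 <= sin B by apply: sin_ge0_pi; rewrite /B; apply/andP; split; lra.
rewrite sinB sinD; nra.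
Qed.

(** Summation by parts; the boundary terms vanish by [f p = 0] and [qdimp]. For a rank function the
    second difference at k counts the blocks of size k. *)
Lemma qsum_diff2 f : f p = 0 ->
  qsum f = \sum_(1 <= k < p) qdim k * (f k.-1 - 2 * f k + f k.+1).
Proof.
move=> fp; suff E n : \sum_(1 <= k < n.+1) qdim k * (f k.-1 - 2 * f k + f k.+1) =
    f 0%N + qdim n * f n.+1 - qdim n.+1 * f n
      - qdefect * \sum_(1 <= k < n.+1) qdim k * f k.
  have -> : p = p.-1.+1 by lia.
  by rewrite E /qsum prednK ?fp ?qdimp; [ring | lia].
elim: n => [|n IHn]; first by rewrite !big_nil qdim0 qdim1; ring.
rewrite big_nat_recr //= IHn [in RHS]big_nat_recr //= /qdefect.
have := qdimSS n; set S := bigop _ _ _; move=> E.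
have -> : qdim n.+2 = 2 * cos theta * qdim n.+1 - qdim n by rewrite -E addrK.
by ring.
Qed.

(** This is the rank function of a free module of rank a. *)
Lemma qsum_linear a : qsum (fun i => a * (p - i)%:R) = 0.
Proof.
rewrite qsum_diff2 ?subnn ?mulr0 // big_nat_cond big1 // => k.
rewrite andbT => /andP[k0 kp].
have -> : (p - k.-1 = (p - k.+1).+2)%N by lia.
have -> : (p - k = (p - k.+1).+1)%N by lia.
rewrite -!natr1; ring.
Qed.

Lemma qsumD f g : qsum (fun i => f i + g i) = qsum f + qsum g.
Proof.
rewrite /qsum (eq_bigr (fun k => qdim k * f k + qdim k * g k)).
  by rewrite big_split /=; ring.
by move=> k _; rewrite mulrDr.
Qed.

Lemma eq_qsum f g : (forall i, (i < p)%N -> f i = g i) -> qsum f = qsum g.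
Proof.
move=> fg; rewrite /qsum fg; last by lia.
congr (_ - _ * _); rewrite !big_nat; apply: eq_bigr => k /andP[_ kp].
by rewrite fg.
Qed.

Lemma qsum_block k : (0 < k <= p)%N -> qsum (fun i => (k - i)%:R) = qdim k.
Proof.
case/andP=> k_gt0 le_kp.
have [->|lt_kp] := eqVneq k p.
  by rewrite qdimp -(qsum_linear 1); apply: eq_qsum => i _; rewrite mul1r.
have {}lt_kp : (k < p)%N by lia.
have /eqP kp0 : (k - p == 0)%N by lia.
rewrite qsum_diff2 ?kp0 // (bigD1_seq k) ?iota_uniq ?mem_index_iota ?k_gt0 //=.
have -> : (k - k.-1 = 1)%N by lia.
rewrite subnn; have -> : (k - k.+1 = 0)%N by lia.
rewrite big_seq_cond big1 => [|i]; first by ring.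
rewrite mem_index_iota => /andP[/andP[i0 ip] neq_ik].
have [lt_ik|le_ki] := ltnP i k.
  have -> : (k - i.-1 = (k - i.+1).+2)%N by lia.
  have -> : (k - i = (k - i.+1).+1)%N by lia.
  rewrite -!natr1; ring.
have -> : (k - i.-1 = 0)%N by lia.
have -> : (k - i = 0)%N by lia.
have -> : (k - i.+1 = 0)%N by lia.
ring.
Qed.

(** The hypothesis has the shape of [exact_rk]: the second difference of g at k is that of f at p -
    k, and [qdim] has the same symmetry. *)
Lemma qsum_exact f g a b : f p = 0 -> g p = 0 ->
    (forall i, (i <= p)%N -> g i + b = a * (p - i)%:R + f (p - i)%N) ->
  qsum f = qsum g.
Proof.
move=> fp gp E; rewrite !qsum_diff2 // big_nat_rev /= !big_nat.
apply: eq_bigr => k /andP[k_gt0 lt_kp].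
have -> : (1 + p - k.+1 = p - k)%N by lia.
rewrite qdimB ?(ltnW lt_kp) //; congr (_ * _).
have := E k.-1; have := E k; have := E k.+1.
have -> : (p - k.+1 = (p - k).-1)%N by lia.
have -> : (p - k.-1 = (p - k).+1)%N by lia.
have [j ->] : exists j, (p - k = j.+1)%N by exists (p - k).-1; lia.
move=> /(_ lt_kp) E1 /(_ (ltnW lt_kp)) E2 E3; have {}E3 := E3 ltac:(lia).
move: E1 E2 E3; rewrite /= -!natr1 => E1 E2 E3.
have {E1}-> : f j = g k.+1 + b - a * j%:R by rewrite E1; ring.
have {E2}-> : f j.+1 = g k + b - a * (j%:R + 1) by rewrite E2; ring.
have {E3}-> : f j.+2 = g k.-1 + b - a * (j%:R + 1 + 1) by rewrite E3; ring.
ring.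
Qed.

(** To be applied to the rank functions f of N and g of [double N]. *)
Lemma qsum_neighbours f g : f p = 0 -> g 0%N = 2 * f 0%N ->
    (forall k, (0 < k < p)%N -> g k = f k.-1 + f k.+1) ->
  qsum g = 2 * cos theta * qsum f.
Proof.
move=> fp g0 gk; have := qsum_diff2 fp.
have Eg : \sum_(1 <= k < p) qdim k * g k =
    \sum_(1 <= k < p) qdim k * (f k.-1 + f k.+1).
  by apply: eq_big_nat => k kP; rewrite gk.
rewrite (eq_bigr (fun k => qdim k * (f k.-1 + f k.+1) - 2 * (qdim k * f k))).
  rewrite big_split /= sumrN -mulr_sumr /qsum g0 Eg.
  set S := \sum_(_ <= _ < _) _ * f _; set T := \sum_(_ <= _ < _) _ => E.
  have -> : T = f 0%N - qdefect * S + 2 * S by rewrite E addrNK.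
  rewrite /qdefect; ring.
by move=> k _; ring.
Qed.

End QuantumDimension.

(** * Jordan blocks and additive similarity invariants *)

Section Jordan.

Variable F : fieldType.

Definition simmx m1 m2 (A : 'M[F]_m1) (B : 'M[F]_m2) : Prop :=
  exists S : 'M_(m1, m2), [/\ row_free S, row_full S & A *m S = S *m B].

Lemma simmx_inv m1 m2 (A : 'M[F]_m1) (B : 'M[F]_m2) S T :
  S *m T = 1%:M -> T *m S = 1%:M -> A *m S = S *m B -> simmx A B.
Proof.
by move=> ST TS AS; exists S; split=> //; [apply/row_freeP | apply/row_fullP]; exists T.
Qed.

Lemma simmx_sub1 m1 m2 (A : 'M[F]_m1) (B : 'M[F]_m2) :
  simmx A B -> simmx (A - 1) (B - 1).
Proof.
by case=> S [fS uS AS]; exists S; split=> //; rewrite mulmxBl mulmxBr AS mul1mx mulmx1.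
Qed.

Lemma simmx_expr m1 m2 (A : 'M[F]_m1) (B : 'M[F]_m2) S i :
  A *m S = S *m B -> A ^+ i *m S = S *m B ^+ i.
Proof.
move=> AS; elim: i => [|i IHi]; first by rewrite !expr0 mul1mx mulmx1.
by rewrite !exprS -!mulmxE -mulmxA IHi !mulmxA AS.
Qed.

Lemma simmx_rk m1 m2 (A : 'M[F]_m1) (B : 'M[F]_m2) i :
  simmx A B -> rk A i = rk B i.
Proof.
case=> S [fS uS /simmx_expr-/(_ i) AS].
by rewrite /rk -(mxrankMfree _ fS) AS eqmxMfull.
Qed.

Lemma expmx_diag m1 m2 (A : 'M[F]_m1) (B : 'M[F]_m2) i :
  (block_mx A 0 0 B) ^+ i = block_mx (A ^+ i) 0 0 (B ^+ i).
Proof.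
elim: i => [|i IHi]; first by rewrite !expr0 -scalar_mx_block.
by rewrite !exprS IHi -!mulmxE mulmx_block !(mulmx0, mul0mx, addr0, add0r).
Qed.

Lemma rk_diag m1 m2 (A : 'M[F]_m1) (B : 'M[F]_m2) i :
  rk (block_mx A 0 0 B) i = (rk A i + rk B i)%N.
Proof. by rewrite /rk expmx_diag rank_diag_block_mx. Qed.

(** The kernel of q is an N-stable complement to the image of i. *)
Lemma split_simmx k m (J : 'M[F]_k) (N : 'M[F]_m) (i : 'M_(k, m)) (q : 'M_(m, k)) :
    J *m i = i *m N -> N *m q = q *m J -> i *m q \in unitmx ->
  exists r (N' : 'M[F]_r), (m = k + r)%N /\ simmx (block_mx J 0 0 N') N.
Proof.
move=> Ji Nq iq; pose K := row_base (kermx q).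
have Kq : K *m q = 0 by apply/sub_kermxP; rewrite eq_row_base.
have rq : \rank q = k.
  apply/eqP; rewrite eqn_leq rank_leq_col; move: iq; rewrite -row_full_unit => /eqP iq.
  by rewrite -{1}iq mxrankS ?submxMl.
have def_m : (m = k + \rank (kermx q))%N.
  by rewrite mxrank_ker rq subnKC // -rq rank_leq_row.
have/submxP[N' KN] : (K *m N <= K)%MS.
  have sK : (K *m N <= kermx q)%MS.
    by apply/sub_kermxP; rewrite -mulmxA Nq mulmxA Kq mul0mx.
  by apply: submx_trans sK _; rewrite eq_row_base.
have Sfree : row_free (col_mx i K).
  apply/inj_row_free => v; rewrite -[v]hsubmxK mul_row_col => E.
  have v1 : lsubmx v = 0.
    have := congr1 (mulmx^~ q) E.
    rewrite mul0mx mulmxDl -(mulmxA _ K q).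
    rewrite Kq mulmx0 addr0 -mulmxA => E'.
    by rewrite -(mulmxK iq (lsubmx v)) E' mul0mx.
  move: E; rewrite v1 mul0mx add0r => E.
  have -> : rsubmx v = 0 by apply: (row_free_inj (row_base_free (kermx q))); rewrite mul0mx.
  by rewrite row_mx0.
exists (\rank (kermx q)), N'; split=> //; exists (col_mx i K); split=> //.
  by rewrite /row_full (eqP Sfree) -def_m.
by rewrite mul_block_col mul_col_mx !mul0mx addr0 add0r Ji KN.
Qed.

Definition jblock k : 'M[F]_k := \matrix_(i, j) (j == i.+1 :> nat)%:R.

Lemma jblockX k i : jblock k ^+ i = \matrix_(a, b) (b == a + i :> nat)%N%:R.
Proof.
elim: i => [|i IHi]; first by apply/matrixP=> a b; rewrite expr0 !mxE addn0 eq_sym.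
rewrite exprS -mulmxE IHi; apply/matrixP=> a b; rewrite !mxE.
under eq_bigr do rewrite !mxE -natrM mulnb.
have [lt_ak|le_ka] := ltnP a.+1 k.
  rewrite (bigD1 (Ordinal lt_ak)) //= eqxx big1 ?addr0 ?addSnnS // => l ne_l.
  by rewrite -(inj_eq val_inj) /= in ne_l; rewrite (negPf ne_l).
rewrite big1 => [|l _].
  by have /negPf-> : b != (a + i.+1)%N :> nat by have := ltn_ord b; lia.
by have /negPf-> : l != a.+1 :> nat by have := ltn_ord l; lia.
Qed.

Lemma rk_jblock k i : rk (jblock k) i = (k - i)%N.
Proof.
pose U : 'M[F]_(k, k - i) := \matrix_(a, b) (a == b :> nat)%:R.
pose V : 'M[F]_(k - i, k) := \matrix_(a, b) (b == a + i :> nat)%N%:R.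
have UU : U^T *m U = 1%:M.
  apply/matrixP=> a b; rewrite !mxE.
  have lt_ak : (a < k)%N by have := ltn_ord a; lia.
  rewrite (bigD1 (Ordinal lt_ak)) //= !mxE eqxx mul1r big1 ?addr0 // => l ne_l.
  rewrite -(inj_eq val_inj) /= in ne_l; rewrite !mxE (negPf ne_l) mul0r //.
have VV : V *m V^T = 1%:M.
  apply/matrixP=> a b; rewrite !mxE.
  have lt_ak : (a + i < k)%N by have := ltn_ord a; lia.
  rewrite (bigD1 (Ordinal lt_ak)) //= !mxE eqxx mul1r big1 ?addr0.
    by rewrite eqn_add2r.
  move=> l ne_l; rewrite -(inj_eq val_inj) /= in ne_l.
  by rewrite !mxE (negPf ne_l) mul0r.
have UV : jblock k ^+ i = U *m V.
  rewrite jblockX; apply/matrixP=> a b; rewrite !mxE.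
  have [lt_ak|le_ka] := ltnP a (k - i)%N.
    rewrite (bigD1 (Ordinal lt_ak)) //= !mxE eqxx mul1r big1 ?addr0 // => l ne_l.
    by rewrite -(inj_eq val_inj) /= eq_sym in ne_l; rewrite !mxE (negPf ne_l) mul0r.
  rewrite big1 => [|l _].
    by have /negPf-> : b != (a + i)%N :> nat by have := ltn_ord b; lia.
  rewrite !mxE; have /negPf-> : a != l :> nat by have := ltn_ord l; lia.
  by rewrite mul0r.
have fV : row_free V by apply/row_freeP; exists V^T.
have uU : row_full U by apply/row_fullP; exists U^T.
by rewrite /rk UV mxrankMfree //; apply/eqP.
Qed.

Lemma jordan_split p m (N : 'M[F]_m) : (0 < m)%N -> N ^+ p = 0 ->
  exists k r (N' : 'M[F]_r),
    [/\ (0 < k <= p)%N, (m = k + r)%N & simmx (block_mx (jblock k) 0 0 N') N].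
Proof.
move=> m_gt0 Np; have exN : exists k, N ^+ k == 0 by exists p; apply/eqP.
case: (ex_minnP exN) => k /eqP Nk mink.
have le_kp : (k <= p)%N by apply: mink; apply/eqP.
case: k => [|k] in Nk mink le_kp *.
  have := congr1 (@mxrank F m m) Nk; rewrite expr0 mxrank1 mxrank0; lia.
have : N ^+ k != 0 by apply/negP=> /mink; lia.
case/rowV0Pn => y /submxP[x def_y]; case/matrix0Pn => i0 [j0]; rewrite ord1 => ny.
(* A linear form with value 1 on the socle vector y = x N^k, where k + 1 is the nilpotency index. *)
pose l : 'cV[F]_m := (y 0 j0)^-1 *: delta_mx j0 0.
have xl : x *m N ^+ k *m l = 1%:M.
  rewrite -def_y -scalemxAr -colE; apply/matrixP=> a b; rewrite !mxE !ord1 mulVf //.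
have Nk0 j : (k < j)%N -> N ^+ j = 0.
  by move=> lt; rewrite -(subnK lt) exprD Nk mulr0.
(* I embeds the block generated by x, and Q maps back to it. The entry (a, b) of their product is x
   N^(a+k-b) l, so the product is unitriangular. *)
pose I : 'M_(k.+1, m) := \matrix_(a < k.+1) (x *m N ^+ a).
pose Q : 'M_(m, k.+1) := \matrix_(a < m, b < k.+1) (N ^+ (k - b) *m l) a 0.
have colQ b : col b Q = N ^+ (k - b) *m l.
  by apply/matrixP=> a c; rewrite ord1 mxE [LHS]mxE.
have rowI a : row a I = x *m N ^+ a by rewrite rowK.
have JI : jblock k.+1 *m I = I *m N.
  apply/row_matrixP=> a; rewrite !row_mul rowI -mulmxA mulmxE -exprSr.
  have [lt_ak|le_ka] := ltnP a.+1 k.+1.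
    suff -> : row a (jblock k.+1) = delta_mx 0 (Ordinal lt_ak) by rewrite -rowE rowI.
    by apply/rowP=> b; rewrite !mxE eqxx -(inj_eq val_inj).
  rewrite Nk0 ?mulmx0; last by lia.
  rewrite (_ : row a _ = 0) ?mul0mx //; apply/rowP=> b; rewrite !mxE.
  by have /negPf-> : b != a.+1 :> nat by have := ltn_ord b; lia.
have NQ : N *m Q = Q *m jblock k.+1.
  apply/trmx_inj/row_matrixP=> b; rewrite -!tr_col; congr (_^T).
  rewrite !colE -!mulmxA -!colE colQ mulmxA mulmxE -exprS.
  case: b => [[|b] ltb] /=.
    rewrite Nk0 ?mul0mx; last by lia.
    rewrite (_ : col _ _ = 0) ?mulmx0 //; apply/colP=> a; rewrite !mxE //.
  have ltb' : (b < k.+1)%N by lia.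
  have -> : col (Ordinal ltb) (jblock k.+1) = delta_mx (Ordinal ltb') 0.
    by apply/colP=> a; rewrite !mxE eqxx andbT -(inj_eq val_inj) /= eqSS eq_sym.
  by rewrite -colE colQ /=; congr (_ ^+ _ *m _); lia.
have IQ : I *m Q \in unitmx.
  have E a b : (I *m Q) a b = (x *m N ^+ (a + (k - b)) *m l) 0 0.
    have -> : (I *m Q) a b = (row a I *m col b Q) 0 0.
      by rewrite !mxE; apply: eq_bigr => c _; rewrite !mxE.
    by rewrite rowI colQ !mulmxA -(mulmxA x) mulmxE exprD.
  rewrite unitmxE -det_tr det_trig.
    rewrite big1 ?unitr1 // => a _; rewrite mxE E.
    have -> : (a + (k - a) = k)%N by have := ltn_ord a; lia.
    by rewrite xl mxE.
  apply/is_trig_mxP=> a b lt_ab; rewrite mxE E Nk0 ?mulmx0 ?mul0mx ?mxE //.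
  by have := ltn_ord a; lia.
have [r [N' [def_m S]]] := split_simmx JI NQ IQ.
by exists k.+1, r, N'.
Qed.

End Jordan.

Section AdditiveFunctions.

Variables (F : fieldType) (R : realType) (p : nat) (p_gt1 : (1 < p)%N).
Variable psi : forall m, 'M[F]_m -> R.
Hypothesis psi_sim : forall m1 m2 (A : 'M[F]_m1) (B : 'M[F]_m2),
  simmx A B -> psi A = psi B.
Hypothesis psi_diag : forall m1 m2 (A : 'M[F]_m1) (B : 'M[F]_m2),
  psi (block_mx A 0 0 B) = psi A + psi B.

Definition jmult m (N : 'M[F]_m) k : R :=
  (rk N k.-1)%:R - 2 * (rk N k)%:R + (rk N k.+1)%:R.

Lemma jmult_jblock k l : (0 < l)%N -> jmult (jblock F k) l = (k == l)%:R.
Proof.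
move=> l_gt0; rewrite /jmult !rk_jblock.
case: (ltngtP k l) => [lt|lt|->].
- have [-> [-> ->]] : (k - l.-1 = 0 /\ k - l = 0 /\ k - l.+1 = 0)%N by lia.
  by rewrite /= !mulr0n; ring.
- have [-> ->] : (k - l.-1 = (k - l.+1).+2 /\ k - l = (k - l.+1).+1)%N by lia.
  by rewrite -!natr1 /= !mulr0n; ring.
have [-> [-> ->]] : (l - l.-1 = 1 /\ l - l = 0 /\ l - l.+1 = 0)%N by lia.
by rewrite /= !mulr0n; ring.
Qed.

(** Blocks are split off one at a time. Hence an additive similarity invariant depends on ranks
    only, and no explicit decomposition of [double (jblock k)] is needed. *)
Lemma psi_jmult m (N : 'M[F]_m) : N ^+ p = 0 ->
  psi N = \sum_(1 <= k < p.+1) jmult N k * psi (jblock F k).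
Proof.
elim/ltn_ind: m N => m IHm N Np; case: (posnP m) => [m0|m_gt0].
  have -> : \sum_(1 <= k < p.+1) jmult N k * psi (jblock F k) = 0.
    rewrite big1 // => k _; rewrite /jmult /rk.
    have E (A : 'M[F]_m) : \rank A = 0%N by have := rank_leq_row A; lia.
    by rewrite !E; ring.
  (* In size 0 additivity reads psi N = 2 psi N. *)
  have := psi_diag N N; rewrite (psi_sim (_ : simmx (block_mx N 0 0 N) N)); first lra.
  exists 0; rewrite /row_free /row_full mxrank0 mulmx0 mul0mx; split=> //.
    by rewrite eq_sym addn_eq0 m0.
  by rewrite eq_sym m0.
have [k [r [N' [kp def_m S]]]] := jordan_split m_gt0 Np.
have N'p : N' ^+ p = 0.
  apply/eqP; rewrite -mxrank_eq0; have := simmx_rk p S.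
  by rewrite rk_diag rk_jblock /rk Np mxrank0; lia.
rewrite -(psi_sim S) psi_diag (IHm r) //; last by lia.
under [RHS]eq_big_nat => l lP.
  have -> : jmult N l = (k == l)%:R + jmult N' l.
    rewrite -jmult_jblock; last by lia.
    by rewrite /jmult -!(simmx_rk _ S) !rk_diag !natrD; ring.
  rewrite mulrDl; over.
rewrite big_split /=; congr (_ + _).
rewrite (bigD1_seq k) ?iota_uniq ?mem_index_iota //= eqxx mul1r big1 ?addr0 //.
by move=> l; rewrite eq_sym => /negPf->; rewrite mul0r.
Qed.

Lemma psi_eq_rk m1 m2 (N1 : 'M[F]_m1) (N2 : 'M[F]_m2) :
  N1 ^+ p = 0 -> N2 ^+ p = 0 -> rk N1 =1 rk N2 -> psi N1 = psi N2.
Proof.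
move=> N1p N2p E; rewrite !psi_jmult //; apply: eq_bigr => k _.
by rewrite /jmult !E.
Qed.

End AdditiveFunctions.

(** * Tensor products of unipotent matrices *)

Section Multiplicativity.

Variables (F : fieldType) (R : realType) (p : nat) (charFp : p \in [pchar F]).

Let p_prime : prime p := pcharf_prime charFp.
Let p_gt1 : (1 < p)%N := prime_gt1 p_prime.

Definition jdim m (N : 'M[F]_m) : R := qsum p (fun i => (rk N i)%:R).

Lemma jdim_sim m1 m2 (A : 'M[F]_m1) (B : 'M[F]_m2) : simmx A B -> jdim A = jdim B.
Proof. by move=> S; apply: eq_qsum => // i _; rewrite (simmx_rk _ S). Qed.

Lemma jdim_diag m1 m2 (A : 'M[F]_m1) (B : 'M[F]_m2) :
  jdim (block_mx A 0 0 B) = jdim A + jdim B.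
Proof.
by rewrite /jdim -qsumD; apply: eq_qsum => // i _; rewrite rk_diag natrD.
Qed.

Lemma jdim_jmult m (N : 'M[F]_m) : N ^+ p = 0 ->
  jdim N = \sum_(1 <= k < p.+1) qdim R p k * jmult R N k.
Proof.
move=> Np; rewrite /jdim qsum_diff2 ?(rkp Np) //.
by rewrite big_nat_recr 1?ltnW //= qdimp // mul0r addr0.
Qed.

(* If [1 + N] is the action of a generator on a module, [1 + double N] is its
   action on the tensor product with the indecomposable module of dimension two. *)
Definition double m (N : 'M[F]_m) : 'M[F]_(m + m) := block_mx N (1 + N) 0 N.

Lemma doubleX m (N : 'M[F]_m) i :
  double N ^+ i.+1 = block_mx (N ^+ i.+1) (i.+1%:R *: ((1 + N) *m N ^+ i)) 0 (N ^+ i.+1).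
Proof.
elim: i => [|i IHi]; first by rewrite !expr1 expr0 mulmx1 scale1r.
rewrite [LHS]exprSr IHi -mulmxE mulmx_block !(mulmx0, mul0mx, addr0, add0r).
rewrite -scalemxAl !mulmxE -!exprSr; congr block_mx.
rewrite -mulrA -exprSr -(natr1 i.+1) scalerDl scale1r addrC.
by congr (_ + _); apply/esym/commrX/commr_sym/commrD;
  [exact: commr1 | exact: commr_refl].
Qed.

Lemma doublep m (N : 'M[F]_m) : N ^+ p = 0 -> double N ^+ p = 0.
Proof.
move=> Np; rewrite -(prednK (ltnW p_gt1)) doubleX prednK ?(ltnW p_gt1) // Np.
by rewrite (pcharf0 charFp) scale0r block_mx0.
Qed.

(** As 1 + N and i are invertible, the off-diagonal block of the power divides its diagonal blocks
    and can be used as pivot. In terms of blocks, size k tensored with size two gives sizes k - 1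
    and k + 1 for k < p. *)
Lemma rk_double m (N : 'M[F]_m) i : N ^+ p = 0 -> (0 < i < p)%N ->
  rk (double N) i = (rk N i.-1 + rk N i.+1)%N.
Proof.
move=> Np; case: i => // i /= lt_ip; rewrite {1}/rk doubleX.
have nz : i.+1%:R != 0 :> F.
  by rewrite -(dvdn_pcharf charFp) gtnNdvd.
pose A := 1 + N; pose A' := A ^+ p.-1.
have cNA : GRing.comm N A by apply/commrD; [exact: commr1 | exact: commr_refl].
have cNA' : GRing.comm N A' by apply: commrX.
have Ap : A ^+ p = 1.
  have := subr1X_mx charFp A; rewrite [A - 1]addrC addKr Np.
  by move/esym/eqP; rewrite subr_eq0 => /eqP.
have AA' : A * A' = 1 by rewrite -exprS prednK ?(ltnW p_gt1).
have A'A : A' * A = 1 by rewrite -exprSr prednK ?(ltnW p_gt1).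
have comm3 j : N ^+ j * A' = A' * N ^+ j by apply: commr_sym (commrX j (commr_sym cNA')).
(* With P = N^(i+1) one has BV = VB = P, and elimination by L and S leaves the diagonal blocks B and
   -VP, of ranks [rk N i] and [rk N i.+2]. *)
pose B := i.+1%:R *: (A *m N ^+ i); pose V := i.+1%:R^-1 *: (A' *m N).
have BV : B *m V = N ^+ i.+1.
  rewrite /B /V -scalemxAl -scalemxAr scalerA mulfV // scale1r !mulmxE.
  by rewrite -mulrA (mulrA (N ^+ i)) comm3 !mulrA AA' mul1r exprSr.
have VB : V *m B = N ^+ i.+1.
  rewrite /B /V -scalemxAl -scalemxAr scalerA mulVf // scale1r !mulmxE.
  by rewrite -mulrA (mulrA N) cNA !mulrA A'A mul1r exprS.
pose L := block_mx 1%:M 0 (- V) 1%:M.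
pose S := block_mx 0 1%:M 1%:M (- V).
have Lfree : row_full L.
  apply/row_fullP; exists (block_mx 1%:M 0 V 1%:M).
  by rewrite mulmx_block !(mulmx0, mul0mx, addr0, add0r, mulmx1, mul1mx) subrr scalar_mx_block.
have Sfree : row_free S.
  apply/row_freeP; exists (block_mx V 1%:M 1%:M 0).
  by rewrite mulmx_block !(mulmx0, mul0mx, addr0, add0r, mulmx1, mul1mx) subrr scalar_mx_block.
rewrite -(mxrankMfree _ Sfree) -(eqmxMfull _ Lfree).
rewrite !mulmx_block !(mulmx0, mul0mx, addr0, add0r, mulmx1, mul1mx) -/A -/B.
rewrite mulmxN BV subrr mulNmx VB addNr mulmx0 add0r rank_diag_block_mx.
have unit_rank (X Y : 'M[F]_m) Z : X * Y = 1 -> \rank (Y *m Z) = \rank Z.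
  by move=> XY; apply: eqmx_rank; apply/eqmxP/eqmxMfull/row_fullP; exists X.
congr (_ + _)%N; first by rewrite mxrank_scale_nz // (unit_rank _ A').
rewrite mulmxN mxrank_opp -scalemxAr mxrank_scale_nz ?invr_neq0 //.
by rewrite !mulmxE mulrA comm3 -mulrA -exprSr (unit_rank _ A).
Qed.

Lemma jdim_double m (N : 'M[F]_m) : N ^+ p = 0 ->
  jdim (double N) = 2 * cos (pi / p%:R) * jdim N.
Proof.
move=> Np; apply: qsum_neighbours => //.
- by rewrite (rkp Np).
- by rewrite !rk0 natrD; ring.
by move=> k kP; rewrite rk_double ?natrD.
Qed.

Lemma trow_addl m1 (A A' : 'rV[F]_m1) m2 n2 (B : 'M[F]_(m2, n2)) :
  trow (A + A') B = trow A B + trow A' B.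
Proof. by rewrite -!trowbE linearD. Qed.

Lemma tprod_addl m1 n1 (A A' : 'M[F]_(m1, n1)) m2 n2 (B : 'M[F]_(m2, n2)) :
  tprod (A + A') B = tprod A B + tprod A' B.
Proof.
elim: m1 A A' => [|m1 IH] A A' /=; first by rewrite addr0.
by rewrite add_col_mx -IH -trow_addl -!linearD.
Qed.

Lemma tprod0l m1 n1 m2 n2 (B : 'M[F]_(m2, n2)) : tprod (0 : 'M[F]_(m1, n1)) B = 0.
Proof. by apply: (addrI (tprod 0 B)); rewrite -tprod_addl !addr0. Qed.

Lemma mx1_block m1 m2 : (1 : 'M[F]_(m1 + m2)) = block_mx 1 0 0 1.
Proof. exact: scalar_mx_block. Qed.

Lemma tprod_block m1 m2 (A11 : 'M[F]_m1) A12 A21 (A22 : 'M[F]_m2) m (B : 'M[F]_m) :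
  simmx (block_mx (tprod A11 B) (tprod A12 B) (tprod A21 B) (tprod A22 B))
        (tprod (block_mx A11 A12 A21 A22) B).
Proof.
pose T m n (A : 'M[F]_(m, n)) := tprod A (1%:M : 'M[F]_m).
pose i1 : 'M[F]_(m1, m1 + m2) := row_mx 1%:M 0.
pose i2 : 'M[F]_(m2, m1 + m2) := row_mx 0 1%:M.
pose q1 : 'M[F]_(m1 + m2, m1) := col_mx 1%:M 0.
pose q2 : 'M[F]_(m1 + m2, m2) := col_mx 0 1%:M.
have tpM a b c (X : 'M[F]_(a, b)) (Y : 'M_(b, c)) :
    tprod X (1%:M : 'M_m) *m tprod Y 1%:M = tprod (X *m Y) (1%:M : 'M_m).
  by rewrite -tprodE mulmx1.
apply: (@simmx_inv _ _ _ _ _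
  (col_mx (tprod i1 1%:M) (tprod i2 1%:M)) (row_mx (tprod q1 1%:M) (tprod q2 1%:M))).
- rewrite mul_col_row !tpM !mul_row_col !(mulmx0, mul0mx, mulmx1, addr0, add0r).
  by rewrite !tprod0l !tprod1 -scalar_mx_block.
- rewrite mul_row_col !tpM -tprod_addl.
  have -> : q1 *m i1 + q2 *m i2 = 1%:M.
    rewrite !mul_col_row !(mulmx0, mul0mx, mulmx1) add_block_mx !(addr0, add0r).
    by rewrite -scalar_mx_block.
  exact: tprod1.
rewrite mul_block_col mul_col_mx -!tprodE !mulmx1 !mul1mx -!tprod_addl.
rewrite !mul_mx_row !mul_row_block !(mulmx0, mul0mx, mulmx1, mul1mx, addr0, add0r).
by rewrite !add_row_mx !(addr0, add0r).
Qed.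

Lemma tprod_11 m (B : 'M[F]_m) : simmx (tprod (1%:M : 'M[F]_1) B) B.
Proof.
have -> : tprod (1%:M : 'M[F]_1) B = castmx (esym (mul1n m), esym (mul1n m)) B.
  apply/matrixP=> i j; rewrite castmxE /= !mxE.
  case: splitP => [i' def_i | []//]; rewrite !mxE; case: splitP => [j' def_j | []//].
  by rewrite !mxE eqxx mul1r; congr (B _ _); apply: val_inj.
case: _ / (esym (mul1n m)); rewrite castmx_id.
by apply: (@simmx_inv _ _ _ _ _ 1%:M 1%:M); rewrite ?mulmx1 ?mul1mx.
Qed.

Definition tens m1 m2 (N1 : 'M[F]_m1) (N2 : 'M[F]_m2) : 'M[F]_(m1 * m2) :=
  tprod (1 + N1) (1 + N2) - 1.

Lemma tens_nilp m1 m2 (N1 : 'M[F]_m1) (N2 : 'M[F]_m2) :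
  N1 ^+ p = 0 -> N2 ^+ p = 0 -> tens N1 N2 ^+ p = 0.
Proof.
have unip m (N : 'M[F]_m) : N ^+ p = 0 -> (1 + N) ^+ p = 1.
  move=> Np; have := subr1X_mx charFp (1 + N); rewrite addrC addKr Np.
  by move/esym/eqP; rewrite subr_eq0 => /eqP.
move=> /unip N1p /unip N2p; rewrite /tens (subr1X_mx charFp).
have tX i : tprod (1 + N1) (1 + N2) ^+ i = tprod ((1 + N1) ^+ i) ((1 + N2) ^+ i).
  elim: i => [|i IHi]; first by rewrite !expr0 [RHS]tprod1.
  by rewrite !exprS IHi -!mulmxE -tprodE.
by rewrite tX N1p N2p [tprod _ _]tprod1 subrr.
Qed.

Section FixRight.

Variables (m2 : nat) (N2 : 'M[F]_m2).
Hypothesis N2p : N2 ^+ p = 0.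

(** With the right factor fixed this is an additive similarity invariant of N, so its values on
    Jordan blocks determine it. *)
Let psi m (N : 'M[F]_m) : R := jdim (tens N N2).

Lemma tens_sim m1 m (A : 'M[F]_m1) (B : 'M[F]_m) : simmx A B -> psi A = psi B.
Proof.
case=> S [/row_freeP[T ST] /row_fullP[T' TS] AS]; apply: jdim_sim; apply: simmx_sub1.
have TT' : T = T' by rewrite -[T]mul1mx -TS -mulmxA ST mulmx1.
subst T'.
apply: (@simmx_inv _ _ _ _ _ (tprod S 1%:M) (tprod T 1%:M)).
- by rewrite -tprodE ST mulmx1 tprod1.
- by rewrite -tprodE TS mulmx1 tprod1.
by rewrite -!tprodE mulmx1 mul1mx mulmxDl mulmxDr AS mul1mx mulmx1.
Qed.

Lemma tens_diag m1 m (A : 'M[F]_m1) (B : 'M[F]_m) :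
  psi (block_mx A 0 0 B) = psi A + psi B.
Proof.
rewrite -jdim_diag; apply/esym/jdim_sim.
have -> : block_mx (tens A N2) 0 0 (tens B N2)
  = block_mx (tprod (1 + A) (1 + N2)) (tprod 0 (1 + N2))
      (tprod 0 (1 + N2)) (tprod (1 + B) (1 + N2)) - 1.
  by rewrite !tprod0l [X in _ - X]mx1_block opp_block_mx add_block_mx !subr0.
rewrite /tens [X in tprod (X + block_mx _ _ _ _)]mx1_block add_block_mx !add0r.
exact/simmx_sub1/tprod_block.
Qed.

Lemma tens_double m (A : 'M[F]_m) : A ^+ p = 0 ->
  psi (double A) = 2 * cos (pi / p%:R) * psi A.
Proof.
move=> Ap; rewrite -jdim_double ?tens_nilp //; apply/esym/jdim_sim.
have -> : double (tens A N2)
  = block_mx (tprod (1 + A) (1 + N2)) (tprod (1 + A) (1 + N2))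
      (tprod 0 (1 + N2)) (tprod (1 + A) (1 + N2)) - 1.
  rewrite !tprod0l [X in _ - X]mx1_block opp_block_mx add_block_mx !subr0.
  by rewrite /double /tens [1 + (_ - 1)]addrC subrK.
rewrite /tens /double [X in tprod (X + block_mx _ _ _ _)]mx1_block add_block_mx !add0r.
exact/simmx_sub1/tprod_block.
Qed.

(** The double of a block of size k + 1 has the ranks of blocks of sizes k + 2 and k together, so by
    [tens_double] these values satisfy the recursion [qdimSS]. *)
Lemma tens_jblock k : (0 < k <= p)%N -> psi (jblock F k) = qdim R p k * psi (jblock F 1).
Proof.
have jbp k' : (k' <= p)%N -> jblock F k' ^+ p = 0.
  by move=> le; apply/eqP; rewrite -mxrank_eq0 -/(rk _ _) rk_jblock; lia.
elim/ltn_ind: k => -[|[|k]] // IHk kP; first by rewrite qdim1 ?mul1r.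
have E : psi (double (jblock F k.+1)) = psi (jblock F k.+2) + psi (jblock F k).
  rewrite -tens_diag; apply: (psi_eq_rk p_gt1 tens_sim tens_diag).
  - by apply: doublep; apply: jbp; lia.
  - by rewrite expmx_diag !jbp ?block_mx0 //; lia.
  move=> i; rewrite rk_diag; have [ip|pi] := ltnP i p; last first.
    have rk0' m (A : 'M[F]_m) : A ^+ p = 0 -> rk A i = 0%N.
      by move=> Ap; rewrite /rk -(subnK pi) exprD Ap mulr0 mxrank0.
    by rewrite !rk0' //; [apply: jbp | apply: jbp | apply/doublep/jbp]; lia.
  case: i ip => [|i] ip; first by rewrite !rk0; lia.
  by rewrite rk_double ?jbp ?rk_jblock //; lia.
have jb1 : jblock F k.+1 ^+ p = 0 by apply: jbp; lia.
rewrite tens_double // in E.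
have -> : psi (jblock F k.+2) = 2 * cos (pi / p%:R) * psi (jblock F k.+1) - psi (jblock F k).
  by rewrite E addrK.
rewrite (IHk k.+1); [|lia..].
have -> : psi (jblock F k) = qdim R p k * psi (jblock F 1).
  case: k {E jb1} IHk kP => [|k] IHk kP; last by apply: IHk; lia.
  rewrite qdim0 mul0r.
  have := tens_diag (jblock F 0) (jblock F 0); rewrite (@tens_sim _ _ _ (jblock F 0)); first lra.
  by exists 0; rewrite /row_free /row_full mxrank0 mulmx0 mul0mx.
have := qdimSS R p k => Eq; have -> : qdim R p k.+2 = 2 * cos (pi / p%:R) * qdim R p k.+1 - qdim R p k.
  by rewrite -Eq addrK.
ring.
Qed.

Lemma jdim_tens m (N : 'M[F]_m) : N ^+ p = 0 -> psi N = jdim N * jdim N2.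
Proof.
move=> Np; rewrite (psi_jmult p_gt1 tens_sim tens_diag Np) jdim_jmult // mulr_suml.
apply: eq_big_nat => k kP; rewrite tens_jblock //.
have -> : psi (jblock F 1) = jdim N2.
  have -> : jblock F 1 = 0 by apply/matrixP=> i j; rewrite !mxE !ord1.
  rewrite /psi /tens addr0; apply: jdim_sim.
  rewrite -[X in simmx _ X](addrK 1 N2) [N2 + 1]addrC.
  exact/simmx_sub1/tprod_11.
ring.
Qed.

End FixRight.

End Multiplicativity.

(** * Projective modules and Heller translates *)

Section ModuleTheory.

Variables (F : fieldType) (gT : finGroupType) (G : {group gT}).
Local Notation module := (representation F G).
Implicit Types M N P Q X Y : module.

Lemma hom1 M : is_hom (M := M) (N := M) 1%:M.
Proof. by move=> g _; rewrite mulmx1 mul1mx. Qed.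

Lemma homM M N P (f : 'M_(rdegree M, rdegree N)) (h : 'M_(rdegree N, rdegree P)) :
  is_hom f -> is_hom h -> is_hom (f *m h).
Proof. by move=> Hf Hh g Gg; rewrite mulmxA Hf // -!mulmxA Hh. Qed.

Lemma homD M N (f h : 'M_(rdegree M, rdegree N)) :
  is_hom f -> is_hom h -> is_hom (f + h).
Proof. by move=> Hf Hh g Gg; rewrite mulmxDl mulmxDr Hf ?Hh. Qed.

Lemma homB M N (f h : 'M_(rdegree M, rdegree N)) :
  is_hom f -> is_hom h -> is_hom (f - h).
Proof. by move=> Hf Hh g Gg; rewrite mulmxBl mulmxBr Hf ?Hh. Qed.

Lemma homX M (f : 'M_(rdegree M)) n :
  is_hom (M := M) (N := M) f -> is_hom (M := M) (N := M) (f ^+ n).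
Proof.
move=> Hf; elim: n => [|n IHn]; first exact: hom1.
by rewrite exprS -mulmxE; apply: homM.
Qed.

Lemma homV M N (f : 'M_(rdegree M, rdegree N)) (h : 'M_(rdegree N, rdegree M)) :
  f *m h = 1%:M -> h *m f = 1%:M -> is_hom f -> is_hom h.
Proof.
move=> fh hf Hf g Gg.
by rewrite -[N g]mul1mx -hf -(mulmxA h) -Hf // -!mulmxA fh mulmx1.
Qed.

Lemma hom_invmx M (f : 'M_(rdegree M)) : f \in unitmx ->
  is_hom (M := M) (N := M) f -> is_hom (M := M) (N := M) (invmx f).
Proof. by move=> uf; apply: homV; rewrite ?mulmxV ?mulVmx. Qed.

Lemma hom_ker_module M N (f : 'M_(rdegree M, rdegree N)) :
  is_hom f -> mxmodule M (kermx f).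
Proof.
move=> Hf; apply/mxmoduleP=> g Gg; apply/sub_kermxP.
by rewrite -mulmxA Hf // mulmxA mulmx_ker mul0mx.
Qed.

Lemma hom_im_module M N r (U : 'M_(r, rdegree M)) (f : 'M_(rdegree M, rdegree N)) :
  is_hom f -> mxmodule M U -> mxmodule N (U *m f).
Proof.
move=> Hf /mxmoduleP modU; apply/mxmoduleP=> g Gg.
by rewrite -mulmxA -Hf // mulmxA submxMr // modU.
Qed.

Lemma submodule_exists M r (U : 'M_(r, rdegree M)) : mxmodule M U ->
  exists (N : module) (k : 'M_(rdegree N, rdegree M)),
    [/\ is_hom k, row_free k & (k :=: U)%MS].
Proof.
move=> modU; have modU' : mxmodule M <<U>>%MS by rewrite (eqmx_module _ (genmxE U)).
exists (Representation (submod_repr modU')), (val_submod 1%:M); split.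
- by move=> g Gg; rewrite -(val_submodJ modU') // mul1mx -val_submodE.
- by rewrite /row_free val_submod1.
by apply: eqmx_trans (val_submod1 _) (genmxE _).
Qed.

Lemma quotient_exists M r (U : 'M_(r, rdegree M)) : mxmodule M U ->
  exists (N : module) (q : 'M_(rdegree M, rdegree N)),
    [/\ is_hom q, row_full q & (kermx q :=: U)%MS].
Proof.
move=> modU; have modU' : mxmodule M <<U>>%MS by rewrite (eqmx_module _ (genmxE U)).
exists (Representation (factmod_repr modU')), (in_factmod <<U>>%MS 1%:M); split.
- by move=> g Gg; rewrite -in_factmodE -[M g]mul1mx in_factmodJ.
- by apply/row_fullP; exists (val_factmod 1%:M); rewrite -in_factmodE val_factmodK.
apply/eqmxP; apply/andP; split.
  apply: submx_trans (_ : _ <= <<U>>)%MS _; last by rewrite genmxE.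
  by rewrite -in_factmod_eq0 in_factmodE mulmx_ker.
by apply/sub_kermxP/eqP; rewrite -in_factmodE in_factmod_eq0 genmxE.
Qed.

Lemma rsim_homs M N : mx_rsim M N ->
  exists (f : 'M_(rdegree M, rdegree N)) (h : 'M_(rdegree N, rdegree M)),
    [/\ is_hom f, is_hom h, f *m h = 1%:M & h *m f = 1%:M].
Proof.
case=> f def_n f_free Hf; have /row_freeP[h fh] := f_free.
have hf : h *m f = 1%:M.
  have /row_fullP[h' h'f] : row_full f by move: f_free; rewrite /row_free /row_full {2}def_n.
  suff -> : h = h' by [].
  by rewrite -[h]mul1mx -h'f -mulmxA fh mulmx1.
by exists f, h; split=> //; apply: homV fh hf Hf.
Qed.

Lemma homs_rsim M N (f : 'M_(rdegree M, rdegree N)) (h : 'M_(rdegree N, rdegree M)) :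
  is_hom f -> f *m h = 1%:M -> h *m f = 1%:M -> mx_rsim M N.
Proof.
move=> Hf fh hf; have f_free : row_free f by apply/row_freeP; exists h.
exists f => //; have /eqP <- := f_free; apply/eqP; apply/row_fullP; by exists h.
Qed.

Lemma dadd_homs X Y (i1 := row_mx 1%:M 0) (i2 := row_mx 0 1%:M)
    (q1 := col_mx 1%:M 0) (q2 := col_mx 0 1%:M) :
  [/\ is_hom (M := X) (N := dadd_grepr X Y) i1,
      is_hom (M := Y) (N := dadd_grepr X Y) i2,
      is_hom (M := dadd_grepr X Y) (N := X) q1 &
      is_hom (M := dadd_grepr X Y) (N := Y) q2].
Proof.
by split=> g Gg /=; rewrite ?mul_mx_row ?mul_row_block ?mul_block_col ?mul_col_mx
  !(mulmx0, mul0mx, mulmx1, mul1mx, addr0, add0r).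
Qed.

Lemma rsim_dadd_homs M X Y : mx_rsim M (dadd_grepr X Y) ->
  exists (i1 : 'M_(rdegree X, rdegree M)) (q1 : 'M_(rdegree M, rdegree X))
         (i2 : 'M_(rdegree Y, rdegree M)) (q2 : 'M_(rdegree M, rdegree Y)),
    [/\ [/\ is_hom i1, is_hom q1, is_hom i2 & is_hom q2],
        [/\ i1 *m q1 = 1%:M, i2 *m q2 = 1%:M, i1 *m q2 = 0 & i2 *m q1 = 0] &
        q1 *m i1 + q2 *m i2 = 1%:M].
Proof.
case/rsim_homs=> f [h [Hf Hh fh hf]].
have [Hi1 Hi2 Hq1 Hq2] := dadd_homs X Y.
exists (row_mx 1%:M 0 *m h), (f *m col_mx 1%:M 0), (row_mx 0 1%:M *m h), (f *m col_mx 0 1%:M).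
split.
- by split; [exact: homM Hi1 Hh | exact: homM Hf Hq1 | exact: homM Hi2 Hh | exact: homM Hf Hq2].
- split; rewrite mulmxA -(mulmxA _ h f) hf mulmx1 mul_row_col;
    by rewrite !(mulmx0, mul0mx, mulmx1, mul1mx, addr0, add0r).
have E : col_mx 1%:M 0 *m row_mx 1%:M 0 + col_mx 0 1%:M *m row_mx 0 1%:M
    = 1%:M :> 'M[F]_(rdegree X + rdegree Y).
  rewrite !mul_col_row !(mulmx0, mul0mx, mulmx1, mul1mx) add_block_mx.
  by rewrite !(addr0, add0r) -scalar_mx_block.
by rewrite !mulmxA -!(mulmxA f) -mulmxDr -mulmxDl E mul1mx.
Qed.

(** Below, summands arise from maps whose composite is merely invertible; [dsummand_split] turns
    them into decompositions. *)
Definition dsummand X M : Prop :=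
  exists (i : 'M_(rdegree X, rdegree M)) (q : 'M_(rdegree M, rdegree X)),
    [/\ is_hom i, is_hom q & i *m q \in unitmx].

Lemma summand_dsummand X M : is_summand X M -> dsummand X M.
Proof.
case=> Y /rsim_dadd_homs[i [q [_ [_ [[Hi Hq _ _] [iq _ _ _] _]]]]].
by exists i, q; rewrite iq unitmx1.
Qed.

Lemma split_summand X M (i : 'M_(rdegree X, rdegree M)) (q : 'M_(rdegree M, rdegree X)) :
    is_hom i -> is_hom q -> i *m q \in unitmx ->
  exists Y (k : 'M_(rdegree Y, rdegree M)),
    [/\ is_hom k, row_free k, (k :=: kermx q)%MS & mx_rsim M (dadd_grepr X Y)].
Proof.
move=> Hi Hq iq; have [Y [k [Hk k_free kE]]] := submodule_exists (hom_ker_module Hq).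
exists Y, k; split=> //; apply: mx_rsim_sym.
have kq : k *m q = 0 by apply/sub_kermxP; rewrite kE.
have Sfree : row_free (col_mx i k).
  apply/inj_row_free => v; rewrite -[v]hsubmxK mul_row_col => E.
  have v1 : lsubmx v = 0.
    have := congr1 (mulmx^~ q) E.
    rewrite mul0mx mulmxDl -(mulmxA _ k q) kq mulmx0 addr0 -mulmxA => E'.
    by rewrite -(mulmxK iq (lsubmx v)) E' mul0mx.
  move: E; rewrite v1 mul0mx add0r => E.
  have -> : rsubmx v = 0 by apply: (row_free_inj k_free); rewrite mul0mx.
  by rewrite row_mx0.
have rq : \rank q = rdegree X.
  apply/eqP; rewrite eqn_leq rank_leq_col; move: iq; rewrite -row_full_unit => /eqP iq.
  by rewrite -{1}iq mxrankS ?submxMl.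
exists (col_mx i k) => //.
  have /eqP := k_free; rewrite kE mxrank_ker rq /= => <-.
  by rewrite subnKC // -rq rank_leq_row.
by move=> g Gg /=; rewrite mul_block_col mul_col_mx !mul0mx addr0 add0r Hi ?Hk.
Qed.

Lemma dsummand_split X M : dsummand X M -> is_summand X M.
Proof.
case=> i [q [Hi Hq iq]].
by have [Y [_ [_ _ _ S]]] := split_summand Hi Hq iq; exists Y.
Qed.

(** Fitting's lemma in factored form. A power of e of least rank is factored through its image Y; as
    its square has the same rank, [i *m q] is invertible. The exponent is positive, so that e itself
    is a factor. *)
Lemma fitting M (e : 'M_(rdegree M)) : is_hom (M := M) (N := M) e ->
  exists n Y (i : 'M_(rdegree Y, rdegree M)) (q : 'M_(rdegree M, rdegree Y)),
    [/\ is_hom i, is_hom q, q *m i = e ^+ n.+1, i *m q \in unitmx & row_free i].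
Proof.
move=> He; pose Q r := `[< exists n, \rank (e ^+ n.+1) = r >].
have exQ : exists r, Q r by exists (\rank (e ^+ 1)); apply/asboolP; exists 0%N.
case: (ex_minnP exQ) => r /asboolP[n rn] minr; exists n.
have Hen := homX n.+1 He.
have [Y [i [Hi i_free iE]]] := submodule_exists (hom_im_module Hen (mxmodule1 M)).
have : (e ^+ n.+1 <= i)%MS by rewrite iE mul1mx.
case/submxP=> q def_q; exists Y, i, q.
have Hq : is_hom q.
  move=> g Gg; apply: (row_free_inj i_free).
  by rewrite -!mulmxA -def_q Hi // mulmxA -def_q Hen.
split=> //; rewrite -row_full_unit /row_full eqn_leq rank_leq_col /=.
have ri : rdegree Y = r.
  by have /eqP <- := i_free; rewrite iE mul1mx.
rewrite [X in (X <= _)%N]ri; apply: leq_trans (minr (\rank (e ^+ n.+1 *m e ^+ n.+1)) _) _.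
  by apply/asboolP; exists (n.+1 + n)%N; rewrite -addnS exprD.
rewrite def_q -!mulmxA (mulmxA i); apply: leq_trans (mxrankM_maxr _ _) _.
exact: mxrankM_maxl.
Qed.

End ModuleTheory.

(** * Higman's criterion, projective covers, Heller translates and cores *)

Section RelativeTrace.

Variables (F : fieldType) (gT : finGroupType) (G : {group gT}).
Local Notation module := (representation F G).
Implicit Types M N P Q X Y : module.

Definition gtr M N (th : 'M_(rdegree M, rdegree N)) : 'M_(rdegree M, rdegree N) :=
  \sum_(g in G) M g^-1%g *m th *m N g.

Lemma gtr_hom M N (th : 'M_(rdegree M, rdegree N)) : is_hom (gtr th).
Proof.
move=> h Gh; rewrite mulmx_sumr mulmx_suml.
rewrite (reindex_inj (mulIg h)) /=; apply: eq_big => [g|g Gg]; first by rewrite groupMr.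
rewrite groupMr // in Gg.
rewrite invMg (repr_mxM M) ?groupV // (repr_mxM N) // !mulmxA.
by rewrite -(repr_mxM M) ?groupV // mulgV repr_mx1 mul1mx.
Qed.

Lemma gtr_mull M N P (f : 'M_(rdegree P, rdegree M)) (th : 'M_(rdegree M, rdegree N)) :
  is_hom f -> f *m gtr th = gtr (M := P) (N := N) (f *m th).
Proof.
move=> Hf; rewrite /gtr mulmx_sumr; apply: eq_bigr => g Gg.
by rewrite !mulmxA Hf ?groupV.
Qed.

Lemma gtr_mulr M N P (f : 'M_(rdegree N, rdegree P)) (th : 'M_(rdegree M, rdegree N)) :
  is_hom f -> gtr th *m f = gtr (M := M) (N := P) (th *m f).
Proof.
move=> Hf; rewrite /gtr mulmx_suml; apply: eq_bigr => g Gg.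
by rewrite -!mulmxA Hf.
Qed.

(** Higman's criterion. Its symmetry in source and target makes projective and injective modules
    coincide. *)
Definition trace_split M : Prop := exists th, gtr (M := M) (N := M) th = 1%:M.

Lemma trace_split_factor X M (a : 'M_(rdegree X, rdegree M)) (b : 'M_(rdegree M, rdegree X)) :
  is_hom a -> is_hom b -> a *m b = 1%:M -> trace_split M -> trace_split X.
Proof.
move=> Ha Hb ab [th th1]; exists (a *m th *m b).
by rewrite -(gtr_mulr (M := X) (N := M) (P := X)) // -(gtr_mull (M := M) (N := M)) // th1 mulmx1.
Qed.

Lemma trace_split_projective M : trace_split M -> projective M.
Proof.
case=> th th1 A B e f He /row_fullP[e' e'e] Hf.
exists (gtr (M := M) (N := A) (th *m f *m e')); first exact: gtr_hom.
by rewrite (gtr_mulr (M := M) (P := B)) // -!mulmxA e'e mulmx1 -(gtr_mulr (M := M) (N := M)) // th1 mul1mx.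
Qed.

Lemma trace_split_injective M : trace_split M -> injective_module M.
Proof.
case=> th th1 A B e f He /row_freeP[e' ee'] Hf.
exists (gtr (M := B) (N := M) (e' *m f *m th)); first exact: gtr_hom.
by rewrite (gtr_mull (N := M)) // !mulmxA ee' mul1mx -(gtr_mull (M := M) (N := M)) // th1 mulmx1.
Qed.

Section FreeModule.

Variable M : module.

Local Notation R := (regular_mx F G).
Local Notation m := (rdegree M).

(** The group algebra tensored with M: a vector is a matrix with one row of M per group element; g
    translates the indices of the rows and acts on each row by [M g]. *)
Definition free_mx (g : gT) : 'M[F]_(gcard G * m) :=
  lin_mx (mulmxr (M g) \o mulmx (R g^-1%g)).

Lemma free_mxE g (X : 'M[F]_(gcard G, m)) :
  mxvec X *m free_mx g = mxvec (R g^-1%g *m X *m M g).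
Proof. by rewrite mul_vec_lin. Qed.

Lemma mxvec_inj_mx n (A B : 'M[F]_(gcard G * m, n)) :
  (forall X : 'M[F]_(gcard G, m), mxvec X *m A = mxvec X *m B) -> A = B.
Proof.
by move=> AB; apply/row_matrixP=> i; rewrite !rowE -[delta_mx 0 i]vec_mxK AB.
Qed.

Lemma free_mx_repr : mx_repr G free_mx.
Proof.
have RG := regular_mx_repr F G.
split=> [|g h Gg Gh]; apply: mxvec_inj_mx => X.
  by rewrite free_mxE invg1 (proj1 RG) repr_mx1 mul1mx !mulmx1.
rewrite mulmxA !free_mxE invMg (proj2 RG) ?groupV // repr_mxM //.
by rewrite !mulmxA.
Qed.

Definition free_module : module := Representation (MxRepresentation free_mx_repr).

Lemma row_regular g : g \in G -> row (gring_index G 1) (R g) = delta_mx 0 (gring_index G g).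
Proof. by move=> Gg; rewrite rowK gring_indexK // mul1g. Qed.

Lemma free_trace_split : trace_split free_module.
Proof.
pose i1 := gring_index G 1.
(* The projection to the coordinate of 1: its conjugates are the projections to all coordinates and
   add up to the identity. *)
exists (lin_mx (mulmx (delta_mx i1 i1))); apply: mxvec_inj_mx => X.
rewrite mulmx_sumr mulmx1 -[in RHS](mul1mx X).
have -> : 1%:M = \sum_(g in G) delta_mx (gring_index G g) (gring_index G g) :> 'M[F]_(gcard G).
  apply/row_matrixP=> i; rewrite row1 [RHS]linear_sum /=.
  rewrite (bigD1 (enum_val i)) ?enum_valP //= gring_valK.
  rewrite rowE mul_delta_mx big1 ?addr0 // => g /andP[Gg neq].
  rewrite rowE mul_delta_mx_0 //; apply: contra neq => /eqP->.
  by rewrite gring_indexK.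
rewrite mulmx_suml [RHS]linear_sum /=; apply: eq_bigr => g Gg.
rewrite !mulmxA free_mxE mul_vec_lin free_mxE /= invgK; congr mxvec.
rewrite -!mulmxA -repr_mxM ?groupV // mulVg repr_mx1 mulmx1 !mulmxA; congr (_ *m _).
rewrite -(mulmxA _ _ (R g)); apply/row_matrixP=> i; rewrite !row_mul.
have Gi : enum_val i \in G by apply: enum_valP.
have -> : row i (R g^-1%g) = delta_mx 0 (gring_index G (enum_val i * g^-1)) by rewrite rowK.
have [def_i | ne_i] := eqVneq i (gring_index G g).
  rewrite def_i gring_indexK // mulgV mulmxA mul_delta_mx -rowE row_regular //.
  by rewrite rowE mul_delta_mx.
rewrite mulmxA mul_delta_mx_0 ?mul0mx.
  by rewrite rowE mul_delta_mx_0.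
apply: contra ne_i => /eqP/(congr1 enum_val).
rewrite !gring_indexK ?groupM ?groupV // => /(canRL (mulgKV _)).
by rewrite mul1g => <-; rewrite gring_valK.
Qed.

Lemma free_cover : exists e : 'M_(rdegree free_module, m), is_hom e /\ row_full e.
Proof.
pose u : 'rV[F]_(gcard G) := const_mx 1.
have uR g : g \in G -> u *m R g = u.
  move=> Gg; apply/rowP=> j; rewrite !mxE.
  under eq_bigr do rewrite !mxE mul1r eqxx /=.
  rewrite (bigD1 (gring_index G (enum_val j * g^-1))) //= gring_indexK ?groupM ?groupV ?enum_valP //.
  rewrite mulgKV gring_valK eqxx big1 ?addr0 // => i ne_i.
  case: eqP => // ji; case/eqP: ne_i; rewrite ji gring_indexK ?groupM ?enum_valP //.
  by rewrite mulgK gring_valK.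
exists (lin1_mx (mulmx u \o vec_mx)).
have eE (X : 'M[F]_(gcard G, m)) : mxvec X *m lin1_mx (mulmx u \o vec_mx) = u *m X :> 'rV[F]_m.
  by rewrite mul_rV_lin1 /= mxvecK.
split.
  move=> g Gg; apply: mxvec_inj_mx => X.
  by rewrite !mulmxA free_mxE !eE !mulmxA uR ?groupV.
pose f : 'rV[F]_m -> _ := mxvec \o mulmx (delta_mx (gring_index G 1) 0).
have fE v : v *m lin1_mx f = mxvec (delta_mx (gring_index G 1) 0 *m v).
  by rewrite mul_rV_lin1.
apply/row_fullP; exists (lin1_mx f).
apply/row_matrixP=> i; rewrite row_mul !rowE fE eE mulmxA.
suff -> : u *m delta_mx (gring_index G 1) 0 = 1%:M :> 'M[F]_1 by rewrite mul1mx mulmx1.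
by apply/matrixP=> a b; rewrite -colE !mxE !ord1.
Qed.

Lemma free_hull : exists e : 'M_(m, rdegree free_module), is_hom e /\ row_free e.
Proof.
pose u : 'cV[F]_(gcard G) := const_mx 1.
have Ru g : g \in G -> R g *m u = u.
  move=> Gg; apply/row_matrixP=> i; rewrite row_mul rowK -rowE.
  by apply/rowP=> j; rewrite !mxE.
pose f : 'rV[F]_m -> _ := mxvec \o mulmx u.
have fE v : v *m lin1_mx f = mxvec (u *m v) by rewrite mul_rV_lin1.
exists (lin1_mx f); split.
  move=> g Gg; apply/row_matrixP=> i; rewrite !row_mul !rowE !fE free_mxE.
  by rewrite !mulmxA Ru ?groupV.
apply/inj_row_free => v; rewrite fE => /(congr1 vec_mx); rewrite mxvecK linear0 => E.
apply/rowP=> j; have := congr1 (fun A : 'M_(_, _) => A (gring_index G 1) j) E.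
by rewrite !mxE big_ord1 !mxE mul1r.
Qed.

End FreeModule.

Lemma projective_trace_split M : projective M -> trace_split M.
Proof.
move=> Mproj; have [e [He e_full]] := free_cover M.
have [h Hh he] := Mproj _ _ _ _ He e_full (hom1 M).
exact: trace_split_factor Hh He he (free_trace_split M).
Qed.

Lemma injective_trace_split M : injective_module M -> trace_split M.
Proof.
move=> Minj; have [e [He e_free]] := free_hull M.
have [h Hh eh] := Minj _ _ _ _ He e_free (hom1 M).
exact: trace_split_factor He Hh eh (free_trace_split M).
Qed.

Lemma dsummand_projective X M : dsummand X M -> projective M -> projective X.
Proof.
case=> i [q [Hi Hq iq]] /projective_trace_split Msplit; apply: trace_split_projective.
apply: (trace_split_factor (M := M) (a := i) (b := q *m invmx (i *m q))) => //.
  by apply: homM => //; apply: hom_invmx => //; apply: homM.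
by rewrite mulmxA mulmxV.
Qed.

(** A projective P of least dimension mapping onto M is a cover. If a submodule still maps onto M,
    lifting f through it gives an endomorphism e with e f = f; the stable image of e is a projective
    mapping onto M, so e is bijective by minimality. *)
Lemma projective_cover_exists M : exists P (f : 'M_(rdegree P, rdegree M)), projective_cover f.
Proof.
pose C r := `[< exists P (f : 'M_(rdegree P, rdegree M)),
  [/\ projective P, is_hom f, row_full f & rdegree P = r] >].
have exC : exists r, C r.
  have [e [He e_full]] := free_cover M; exists (rdegree (free_module M)).
  apply/asboolP; exists (free_module M), e; split=> //.
  exact/trace_split_projective/free_trace_split.
case: (ex_minnP exC) => r /asboolP[P [f [Pproj Hf f_full def_r]]] minr.
exists P, f; split=> // U modU Uf.
have [Y [k [Hk k_free kU]]] := submodule_exists modU.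
have kf : row_full (k *m f) by rewrite /row_full (eqmxMr f kU).
have [h Hh hkf] := Pproj _ _ _ _ (homM Hk Hf) kf Hf.
pose e := h *m k; have He : is_hom (M := P) (N := P) e by apply: homM.
have ef n : e ^+ n *m f = f.
  by elim: n => [|n IHn]; rewrite ?mul1mx // exprSr -mulmxE -mulmxA /e -(mulmxA h) hkf.
have [n [Z [i [q [Hi Hq qi iq i_free]]]]] := fitting He.
have Zproj : projective Z by apply: dsummand_projective Pproj; exists i, q.
have leZ : (rdegree P <= rdegree Z)%N.
  rewrite def_r; apply: minr; apply/asboolP; exists Z, (i *m f); split=> //.
    exact: homM.
  by rewrite -sub1mx; apply: submx_trans (_ : f <= _)%MS;
    rewrite ?sub1mx // -{1}(ef n.+1) -qi -mulmxA submxMl.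
have e_full : row_full (e ^+ n.+1).
  rewrite /row_full eqn_leq rank_leq_col -qi mxrankMfree //.
  apply: leq_trans leZ (leq_trans _ (mxrankM_maxr i q)).
  by move: iq; rewrite -row_full_unit => /eqP->.
rewrite -sub1mx -kU; apply: submx_trans (_ : e ^+ n.+1 <= _)%MS; first by rewrite sub1mx.
by rewrite exprSr -mulmxE mulmxA submxMl.
Qed.

Lemma injective_hull_exists M : exists Q (f : 'M_(rdegree M, rdegree Q)), injective_hull f.
Proof.
pose C r := `[< exists Q (f : 'M_(rdegree M, rdegree Q)),
  [/\ injective_module Q, is_hom f, row_free f & rdegree Q = r] >].
have exC : exists r, C r.
  have [e [He e_free]] := free_hull M; exists (rdegree (free_module M)).
  apply/asboolP; exists (free_module M), e; split=> //.
  exact/trace_split_injective/free_trace_split.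
case: (ex_minnP exC) => r /asboolP[Q [f [Qinj Hf f_free def_r]]] minr.
exists Q, f; split=> // U modU Uf.
have [N [k [Hk k_full kU]]] := quotient_exists modU.
have fk : row_free (f *m k).
  apply/inj_row_free => v; rewrite mulmxA => /sub_kermxP; rewrite kU => vU.
  apply: (row_free_inj f_free); rewrite mul0mx; apply/eqP; rewrite -submx0 -Uf.
  by rewrite sub_capmx vU submxMl.
have [h Hh fkh] := Qinj _ _ _ _ (homM Hf Hk) fk Hf.
pose e := k *m h; have He : is_hom (M := Q) (N := Q) e by apply: homM.
have fe n : f *m e ^+ n = f.
  by elim: n => [|n IHn]; rewrite ?mulmx1 // exprS -mulmxE mulmxA /e mulmxA fkh.
have [n [Z [i [q [Hi Hq qi iq i_free]]]]] := fitting He.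
have Zinj : injective_module Z.
  apply/trace_split_injective/projective_trace_split.
  apply: (@dsummand_projective _ Q); first by exists i, q.
  exact/trace_split_projective/injective_trace_split.
have leZ : (rdegree Q <= rdegree Z)%N.
  rewrite def_r; apply: minr; apply/asboolP; exists Z, (f *m q); split=> //.
    exact: homM.
  apply/inj_row_free => v vfq; apply: (row_free_inj f_free).
  by rewrite mul0mx -(fe n.+1) -qi !mulmxA -(mulmxA v) vfq mul0mx.
have e_free : row_free (e ^+ n.+1).
  rewrite /row_free eqn_leq rank_leq_col -qi mxrankMfree //.
  apply: leq_trans leZ (leq_trans _ (mxrankM_maxr i q)).
  by move: iq; rewrite -row_full_unit => /eqP->.
apply/eqP; rewrite -submx0; apply/row_subP=> j.
have /sub_kermxP : (row j U <= kermx k)%MS by rewrite kU row_sub.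
move=> Uk; rewrite submx0; apply/eqP; apply: (row_free_inj e_free).
by rewrite mul0mx exprS -mulmxE /e !mulmxA Uk !mul0mx.
Qed.

Lemma some_moduleP (C : module -> Prop) : (exists N, C N) -> C (some_module C).
Proof. by rewrite /some_module; case: pselect => // exC _; apply: projT2. Qed.

Lemma is_Omega_exists M : exists N, is_Omega M N.
Proof.
have [P [f fcov]] := projective_cover_exists M; have [_ Hf _ _] := fcov.
have [N [k [Hk k_free kE]]] := submodule_exists (hom_ker_module Hf).
by exists N, P, f; split=> //; exists k.
Qed.

Lemma is_OmegaV_exists M : exists N, is_OmegaV M N.
Proof.
have [Q [f fhull]] := injective_hull_exists M; have [_ Hf _ _] := fhull.
have modf : mxmodule Q f.
  by rewrite -[f]mul1mx; apply: hom_im_module (mxmodule1 M).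
have [N [q [Hq q_full qE]]] := quotient_exists modf.
by exists N, Q, f; split=> //; exists q.
Qed.

Lemma OmegaP M : is_Omega M (Omega M).
Proof. by apply: (some_moduleP (C := is_Omega M)); apply: is_Omega_exists. Qed.

Lemma OmegaVP M : is_OmegaV M (OmegaV M).
Proof. by apply: (some_moduleP (C := is_OmegaV M)); apply: is_OmegaV_exists. Qed.

Lemma unitmx_rank n (A : 'M[F]_n) : A \in unitmx -> \rank A = n.
Proof. by rewrite -row_full_unit => /eqP. Qed.

Lemma rdegree0_unit0 X : (0 : 'M[F]_(rdegree X)) \in unitmx -> rdegree X = 0%N.
Proof. by move/unitmx_rank; rewrite mxrank0. Qed.

(** A projective summand Q of the kernel is injective, so the projection to Q extends to a map h on
    the cover. The endomorphism [e] satisfies e h = 0 and e f = f, so the kernel of h maps onto M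
    and is everything; thus Q = 0. *)
Lemma Omega_projective_free M N : is_Omega M N -> projective_free N.
Proof.
case=> P [f [[Pproj Hf f_full Pess] [k [Hk k_free kE]]]] Q Qproj.
case/summand_dsummand=> i [q [Hi Hq iq]].
have Qinj : injective_module Q by exact/trace_split_injective/projective_trace_split.
have [h Hh kh] := Qinj _ _ _ _ Hk k_free Hq.
have kf : k *m f = 0 by apply/sub_kermxP; rewrite kE.
pose u := invmx (i *m q).
pose e := 1%:M - h *m u *m (i *m k).
have eh : e *m h = 0.
  by rewrite /e mulmxBl mul1mx -!mulmxA kh /u mulVmx // mulmx1 subrr.
have ef : e *m f = f by rewrite /e mulmxBl mul1mx -!mulmxA kf !mulmx0 subr0.
have full : row_full (kermx h).
  apply: Pess; first exact: hom_ker_module.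
  rewrite -sub1mx; apply: submx_trans (_ : f <= _)%MS; first by rewrite sub1mx.
  by rewrite -{1}ef submxMr //; apply/sub_kermxP.
apply: rdegree0_unit0; suff <- : i *m q = 0 by [].
rewrite -kh; suff -> : h = 0 by rewrite !mulmx0.
by move: full => /row_fullP[h' h'1]; rewrite -[h]mul1mx -h'1 -mulmxA mulmx_ker mulmx0.
Qed.

(** The stable image of [f *m h] is projective and a summand of N, hence 0, so [f *m h] is
    nilpotent. *)
Lemma projective_free_unit N P (f : 'M_(rdegree P, rdegree N)) (h : 'M_(rdegree N, rdegree P)) :
  projective_free N -> projective P -> is_hom f -> is_hom h ->
  1%:M - f *m h \in unitmx.
Proof.
move=> Nfree Pproj Hf Hh; have Hfh := homM Hf Hh.
have [n [Z [i [q [Hi Hq qi iq i_free]]]]] := fitting Hfh.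
have Zproj : projective Z by apply: dsummand_projective Pproj; exists i, q.
have Z0 : rdegree Z = 0%N.
  apply: (Nfree Z Zproj); apply: dsummand_split.
  exists (i *m f), (h *m (f *m h) ^+ n *m q); split.
  - exact: homM.
  - by apply: homM => //; apply: homM => //; apply: homX.
  have -> : i *m f *m (h *m (f *m h) ^+ n *m q) = (i *m q) *m (i *m q).
    have E : (f *m h) *m (f *m h) ^+ n = q *m i by rewrite qi exprS.
    by rewrite !mulmxA -(mulmxA i f) -(mulmxA i (f *m h)) E !mulmxA.
  by rewrite unitmx_mul iq.
have nil : (f *m h) ^+ n.+1 = 0.
  apply/eqP; rewrite -mxrank_eq0 -qi -leqn0; apply: leq_trans (mxrankM_maxr _ _) _.
  by rewrite -Z0 rank_leq_row.
have E := subrXX_comm n.+1 (commr_sym (commr1 (f *m h))).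
rewrite nil expr1n subr0 in E.
by have [] := mulmx1_unit (esym E).
Qed.

Lemma projective_free0 X : rdegree X = 0%N -> projective_free X.
Proof.
move=> X0 P _ [Y S]; have := mxrank_rsim S; rewrite X0 => /eqP.
by rewrite eq_sym addn_eq0 => /andP[/eqP].
Qed.

Lemma projective0 X : rdegree X = 0%N -> projective X.
Proof.
move=> X0; apply: trace_split_projective; exists 0.
by apply/eqP; rewrite -subr_eq0 -mxrank_eq0 -leqn0 -X0 rank_leq_row.
Qed.

Lemma dadd_projective X Y : projective X -> projective Y -> projective (dadd_grepr X Y).
Proof.
move=> Xproj Yproj A B e f He e_full Hf; have [Hi1 Hi2 Hq1 Hq2] := dadd_homs X Y.
have [h1 Hh1 E1] := Xproj _ _ _ _ He e_full (homM Hi1 Hf).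
have [h2 Hh2 E2] := Yproj _ _ _ _ He e_full (homM Hi2 Hf).
exists (col_mx 1%:M 0 *m h1 + col_mx 0 1%:M *m h2).
  by apply: homD; [exact: homM Hq1 Hh1 | exact: homM Hq2 Hh2].
rewrite mulmxDl -!mulmxA E1 E2 !mulmxA -mulmxDl !mul_col_row.
rewrite !(mulmx0, mul0mx, mulmx1, mul1mx) add_block_mx !(addr0, add0r).
by rewrite -scalar_mx_block mul1mx.
Qed.

Lemma rsim_dadd2 X X' Y Y' : mx_rsim X X' -> mx_rsim Y Y' ->
  mx_rsim (dadd_grepr X Y) (dadd_grepr X' Y').
Proof.
move=> /rsim_homs[f [h [Hf Hh fh hf]]] /rsim_homs[f' [h' [Hf' Hh' fh' hf']]].
apply: (@homs_rsim _ _ _ (dadd_grepr X Y) (dadd_grepr X' Y')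
  (block_mx f 0 0 f') (block_mx h 0 0 h')).
- move=> g Gg /=; rewrite !mulmx_block !(mulmx0, mul0mx, addr0, add0r).
  by rewrite Hf ?Hf'.
- by rewrite mulmx_block !(mulmx0, mul0mx, addr0, add0r) fh fh' -scalar_mx_block.
by rewrite mulmx_block !(mulmx0, mul0mx, addr0, add0r) hf hf' -scalar_mx_block.
Qed.

Lemma rsim_daddA X Y Z :
  mx_rsim (dadd_grepr X (dadd_grepr Y Z)) (dadd_grepr (dadd_grepr X Y) Z).
Proof.
apply: mx_rsim_sym; pose e := esym (addnA (rdegree X) (rdegree Y) (rdegree Z)).
have cast_comm n1 n2 (e' : n1 = n2) (A : 'M[F]_n1) :
    A *m castmx (erefl _, e') 1%:M = castmx (erefl _, e') 1%:M *m castmx (e', e') A.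
  by case: _ / e'; rewrite !castmx_id mulmx1 mul1mx.
exists (castmx (erefl _, e) 1%:M).
- exact: e.
- by rewrite /row_free; case: _ / e; rewrite castmx_id mxrank1.
move=> g Gg /=; rewrite cast_comm; congr (_ *m _).
have := @block_mxA _ _ _ _ _ _ _ (X g) 0 0 0 (Y g) 0 0 0 (Z g).
by rewrite /= !row_mx0 !col_mx0.
Qed.

Lemma rsim_daddC X Y : mx_rsim (dadd_grepr X Y) (dadd_grepr Y X).
Proof.
apply: (@homs_rsim _ _ _ (dadd_grepr X Y) (dadd_grepr Y X)
  (block_mx 0 1%:M 1%:M 0) (block_mx 0 1%:M 1%:M 0)).
- move=> g Gg /=; rewrite !mulmx_block !(mulmx0, mul0mx, addr0, add0r).
  by rewrite !mul1mx !mulmx1.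
- by rewrite mulmx_block !(mulmx0, mul0mx, addr0, add0r, mul1mx) -scalar_mx_block.
by rewrite mulmx_block !(mulmx0, mul0mx, addr0, add0r, mul1mx) -scalar_mx_block.
Qed.

Lemma rsim_dadd0 X Y : rdegree X = 0%N -> mx_rsim (dadd_grepr X Y) Y.
Proof.
move=> X0; have [Hi1 Hi2 Hq1 Hq2] := dadd_homs X Y.
exists (col_mx 0 1%:M); [by rewrite /= X0 | | by move=> g Gg; exact: Hq2].
have E : \rank (col_mx 0 1%:M : 'M[F]_(rdegree X + rdegree Y, rdegree Y)) = rdegree Y.
  by rewrite rank_col_0mx mxrank1.
by rewrite /row_free E /= X0.
Qed.

Lemma projective_free_decomposition M :
  exists N P, [/\ projective P, projective_free N & mx_rsim M (dadd_grepr N P)].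
Proof.
have [n le_Mn] := ubnP (rdegree M); elim: n M le_Mn => // n IHn M le_Mn.
have [Mfree|nfree] := pselect (projective_free M).
  exists M, grepr0; split=> //; first exact: projective0.
  apply/mx_rsim_sym/(mx_rsim_trans (rsim_daddC _ _)); exact: rsim_dadd0.
have [P [Pproj [M' SM] P_gt0]] : exists P, [/\ projective P, is_summand P M & rdegree P <> 0%N].
  apply: contrapT => noP; apply: nfree => P Pproj PM; apply: contrapT => P0.
  by apply: noP; exists P.
have [|N [P' [P'proj Nfree SM']]] := IHn M'.
  by have := mxrank_rsim SM => /=; lia.
exists N, (dadd_grepr P' P); split=> //; first exact: dadd_projective.
apply: (mx_rsim_trans SM); apply: (mx_rsim_trans (rsim_daddC _ _)).
apply: (mx_rsim_trans (rsim_dadd2 SM' (mx_rsim_refl _))).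
exact/mx_rsim_sym/rsim_daddA.
Qed.

Lemma is_core_exists M : exists N, is_core M N.
Proof.
pose C r := `[< exists N, [/\ is_summand N M, projective_free N & rdegree N = r] >].
have exC : exists r, C r.
  exists 0%N; apply/asboolP; exists grepr0; split=> //; last exact: projective_free0.
  by exists M; apply/mx_rsim_sym/rsim_dadd0.
have ubC r : C r -> (r <= rdegree M)%N.
  by case/asboolP=> N [[Y /mxrank_rsim/= ->] _ <-]; apply: leq_addr.
case: (ex_maxnP exC ubC) => r /asboolP[N [NM Nfree <-]] maxr.
by exists N; split=> // N' N'M N'free; apply: maxr; apply/asboolP; exists N'.
Qed.

Lemma coreP M : is_core M (core M).
Proof. by apply: (some_moduleP (C := is_core M)); apply: is_core_exists. Qed.

(** The core is characterised by its dimension only. Comparison with a decomposition into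
    projective-free M0 and projective P shows that P is a summand of the complement N', and then the
    dimensions leave no room for more. *)
Lemma core_complement M N : is_core M N ->
  exists2 P, projective P & mx_rsim M (dadd_grepr N P).
Proof.
case=> -[N' SM] Nfree maxN; exists N' => //.
have [M0 [P [Pproj M0free SM0]]] := projective_free_decomposition M.
have [i1 [q1 [i2 [q2 [[Hi1 Hq1 Hi2 Hq2] [iq1 iq2 iq12 iq21] E]]]]] := rsim_dadd_homs SM.
have [_ [_ [j [r [[_ _ Hj Hr] [_ jr _ _] _]]]]] := rsim_dadd_homs SM0.
(* The two paths from P to P, through N and through N', add up to the identity; by
   [projective_free_unit] the second one is invertible. *)
have u : (j *m q2) *m (i2 *m r) \in unitmx.
  have -> : (j *m q2) *m (i2 *m r) = 1%:M - (j *m q1) *m (i1 *m r).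
    have <- : j *m (q1 *m i1 + q2 *m i2) *m r = 1%:M by rewrite E mulmx1.
    by rewrite mulmxDr mulmxDl !mulmxA addrAC subrr add0r.
  by apply: (projective_free_unit (N := N)) => //; apply: homM.
have [Y SY] : is_summand P N'.
  by apply: dsummand_split; exists (j *m q2), (i2 *m r); split=> //; apply: homM.
have leM0 : (rdegree M0 <= rdegree N)%N by apply: maxN => //; exists P.
have Y0 : rdegree Y = 0%N.
  have := mxrank_rsim SM; have := mxrank_rsim SM0; have := mxrank_rsim SY => /=.
  by move=> -> ->; lia.
have : dsummand N' P.
  have := mx_rsim_trans SY (mx_rsim_trans (rsim_daddC _ _) (rsim_dadd0 _ Y0)).
  case/rsim_homs=> f [h [Hf Hh fh _]].
  by exists f, h; rewrite fh unitmx1.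
by move/dsummand_projective; apply.
Qed.

End RelativeTrace.

(** * Groups with a Sylow subgroup of order p *)

(** Every orbit of s on D has p elements and contributes Phi x (1 + K + ... + K^(p-1)). With K the
    action of c, sums over free C-orbits lie in the image of the norm. *)
Lemma free_orbit_sum (F : fieldType) (T : finType) (s : {perm T}) (p m : nat)
    (D : {set T}) (Phi : T -> 'rV[F]_m) (K : 'M[F]_m) :
  prime p -> (s ^+ p = 1)%g ->
  {in D, forall x, [/\ s x \in D, s x != x & Phi (s x) = Phi x *m K]} ->
  ((\sum_(x in D) Phi x)%R <= (\sum_(i < p) K ^+ i)%R)%MS.
Proof.
move=> p_prime sp; have [n] := ubnP #|D|; elim: n D => // n IHn D le_Dn HD.
have [->|[x Dx]] := set_0Vmem D; first by rewrite big_set0 sub0mx.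
have iterD i : (s ^+ i)%g x \in D.
  elim: i => [|i IHi]; first by rewrite expg0 perm1.
  by rewrite expgSr permM; case: (HD _ IHi).
have Phi_iter i : Phi ((s ^+ i)%g x) = Phi x *m K ^+ i.
  elim: i => [|i IHi]; first by rewrite expg0 perm1 mulmx1.
  rewrite expgSr permM; have [_ _ ->] := HD _ (iterD i).
  by rewrite IHi -mulmxA mulmxE -exprSr.
have cardO : #|porbit s x| = p.
  have : (#|porbit s x| %| p)%N.
    apply: dvdn_trans (_ : _ %| #[s]%g)%N _; last by rewrite order_dvdn sp.
    by rewrite porbitE; apply: dvdn_orbit.
  have [_ pP] := primeP p_prime; move/pP => /orP[/eqP c1|/eqP //].
  have [_ /negP[]] := HD _ Dx.
  have /card1P[y Oy] : #|porbit s x| == 1%N by apply/eqP.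
  have := Oy x; have := Oy (s x); rewrite porbit_id -[s x]/((s ^+ 1)%g x) mem_porbit !inE.
  by move=> /esym/eqP-> /esym/eqP<-.
have OD : porbit s x \subset D by apply/subsetP=> y /porbitP[i ->].
rewrite (big_setID (porbit s x)) /= (setIidPr OD); apply: addmx_sub.
  have -> : \sum_(y in porbit s x) Phi y = Phi x *m \sum_(i < p) K ^+ i.
    rewrite (eq_bigl (mem (traject s x p))); last first.
      by move=> y; rewrite -cardO porbit_traject.
    rewrite -big_uniq -?cardO ?uniq_traject_porbit //= cardO.
    have -> : traject s x p = [seq (s ^+ i)%g x | i <- iota 0 p].
      apply: (@eq_from_nth _ x); rewrite size_traject ?size_map ?size_iota // => i ip.
      by rewrite nth_traject // (nth_map 0%N) ?size_iota // nth_iota // permX.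
    rewrite big_map mulmx_sumr -(big_mkord xpredT (fun i => Phi x *m K ^+ i)).
    by rewrite /index_iota subn0; apply: eq_bigr => i _.
  exact: submxMl.
apply: IHn.
  rewrite cardsD (setIidPr OD) cardO.
  have : (0 < #|D|)%N by apply/card_gt0P; exists x.
  have := prime_gt0 p_prime; lia.
move=> y /setDP[Dy nOy]; have [Dsy ne E] := HD _ Dy; split=> //.
apply/setDP; split=> //; apply: contra nOy.
by rewrite -!eq_porbit_mem -[s y]/((s ^+ 1)%g y) porbit_perm.
Qed.

Lemma expr_first_order (F : fieldType) m (n S Q1 : 'M[F]_m) (z : F) k :
    GRing.comm n Q1 -> S = z *: 1%:M + n *m Q1 ->
  exists2 Q, GRing.comm n Q & S ^+ k = z ^+ k *: 1%:M + n *m Q.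
Proof.
move=> cQ1 S1; elim: k => [|k [Q cQ IHk]].
  by exists 0; [apply: commr0 | rewrite !expr0 scale1r mulmx0 addr0].
have cZ b (A : 'M[F]_m) : GRing.comm n A -> GRing.comm n (b *: A).
  by rewrite /GRing.comm -!mulmxE -scalemxAr -scalemxAl => ->.
exists (z *: Q + z ^+ k *: Q1 + Q *m n *m Q1).
  apply: commrD; first by apply: commrD; apply: cZ.
  by apply: commrM => //; apply: commrM => //; apply: commr_refl.
have -> : n *m (z *: Q + z ^+ k *: Q1 + Q *m n *m Q1)
    = z *: (n *m Q) + z ^+ k *: (n *m Q1) + n *m Q *m (n *m Q1).
  by rewrite !mulmxDr -!scalemxAr !mulmxA.
rewrite exprSr IHk S1 -!mulmxE mulmxDl !mulmxDr -!scalemxAl -!scalemxAr !mul1mx !mulmx1.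
by rewrite scalerA -exprSr -!addrA; congr (_ + _); rewrite addrCA.
Qed.

(** * Transfer from a Sylow subgroup of order p *)

Section CyclicSubgroup.

Variables (F : fieldType) (p : nat) (gT : finGroupType) (G : {group gT}) (c : gT).
Hypotheses (charFp : p \in [pchar F]) (Gc : c \in G) (oc : #[c]%g = p).
Hypothesis p'index : ~~ (p %| #|G : <[c]>|%g)%N.

Local Notation module := (representation F G).
Implicit Types M N X Y P : module.

Fact p_prime : prime p. Proof. exact: pcharf_prime charFp. Qed.
Fact p_gt1 : (1 < p)%N. Proof. exact: prime_gt1 p_prime. Qed.
Fact p_gt0 : (0 < p)%N. Proof. exact: prime_gt0 p_prime. Qed.
Local Hint Resolve p_prime p_gt1 p_gt0 : core.
Local Notation C := <[c]>%g.

Fact sCG : C \subset G. Proof. by rewrite cycle_subG. Qed.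
Local Hint Resolve sCG : core.

Definition nil_mx M : 'M[F]_(rdegree M) := M c - 1.

Lemma repr_mxXn M g i : g \in G -> M (g ^+ i)%g = M g ^+ i.
Proof.
move=> Gg; elim: i => [|i IHi]; first by rewrite expg0 repr_mx1.
by rewrite expgS repr_mxM ?groupX // IHi exprS.
Qed.

Lemma nil_mxp M : nil_mx M ^+ p = 0.
Proof.
by rewrite /nil_mx (subr1X_mx charFp) -repr_mxXn // -oc expg_order repr_mx1 subrr.
Qed.

Lemma nil_mx_pred M : nil_mx M ^+ p.-1 = \sum_(i < p) M c ^+ i.
Proof. exact: subr1X_pred_mx. Qed.

Lemma nil_mx_fixed M r (y : 'M_(r, rdegree M)) : y *m nil_mx M = 0 <-> y *m M c = y.
Proof.
by rewrite mulmxBr mulmx1; split=> [/eqP|->]; rewrite ?subrr // subr_eq0 => /eqP.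
Qed.

Lemma fixed_cycle M r (y : 'M_(r, rdegree M)) z :
  y *m M c = y -> z \in C -> y *m M z = y.
Proof.
move=> yc /cycleP[i ->]; rewrite repr_mxXn //.
elim: i => [|i IHi]; first by rewrite mulmx1.
by rewrite exprS -mulmxE mulmxA yc.
Qed.

Lemma hom_nil M N (f : 'M_(rdegree M, rdegree N)) :
  M c *m f = f *m N c -> nil_mx M *m f = f *m nil_mx N.
Proof. by move=> Hf; rewrite mulmxBl mulmxBr Hf mul1mx mulmx1. Qed.

Lemma hom_nilX M N (f : 'M_(rdegree M, rdegree N)) i :
  M c *m f = f *m N c -> nil_mx M ^+ i *m f = f *m nil_mx N ^+ i.
Proof. by move/hom_nil/simmx_expr. Qed.

Lemma hom_cycle M N (f : 'M_(rdegree M, rdegree N)) z :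
  M c *m f = f *m N c -> z \in C -> M z *m f = f *m N z.
Proof. by move=> Hf /cycleP[i ->]; rewrite !repr_mxXn //; apply: simmx_expr. Qed.

Lemma sum_cycle (V : zmodType) (Phi : gT -> V) :
  \sum_(z in C) Phi z = \sum_(i < p) Phi (c ^+ i)%g.
Proof.
have defC : C = [set (c ^+ (i : 'I_p))%g | i : 'I_p].
  apply/setP=> z; apply/cycleP/imsetP => [[i ->]|[i _ ->]]; last by exists i.
  have lt_ip : (i %% p < p)%N by rewrite ltn_mod.
  by exists (Ordinal lt_ip); rewrite //= -oc expg_mod_order.
rewrite defC big_imset //= => i j _ _ /eqP; rewrite eq_expg_mod_order oc.
by rewrite !modn_small // => /eqP/val_inj.
Qed.

Lemma sum_cycle_nil M : \sum_(z in C) M z = nil_mx M ^+ p.-1.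
Proof.
by rewrite sum_cycle nil_mx_pred; apply: eq_bigr => i _; rewrite repr_mxXn.
Qed.

(** A vector fixed by c equals its image under the trace of [th], a sum over G, which c permutes
    freely by right multiplication. *)
Lemma projective_cfree M : projective M -> cfree p (nil_mx M).
Proof.
case/projective_trace_split=> th th1; apply/row_subP=> j.
set y := row j _; have yc : y *m M c = y.
  by apply/nil_mx_fixed/sub_kermxP/row_sub.
rewrite -[y]mulmx1 -th1 mulmx_sumr nil_mx_pred.
pose s := perm (mulIg c).
have sE i g : (s ^+ i)%g g = (g * c ^+ i)%g.
  elim: i => [|i IHi]; first by rewrite !expg0 perm1 mulg1.
  by rewrite !expgSr permM IHi permE mulgA.
have sP : (s ^+ p = 1)%g by apply/permP=> g; rewrite sE -oc expg_order mulg1 perm1.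
apply: (free_orbit_sum p_prime sP) => g Gg; rewrite permE /=; split.
- by rewrite groupM.
- by rewrite -{2}[g]mulg1 (inj_eq (mulgI g)) -order_eq1 oc gtn_eqF.
rewrite invMg (repr_mxM M) ?groupV // (repr_mxM M) // !mulmxA.
by rewrite (fixed_cycle yc) // groupV cycle_id.
Qed.

(** The representative is immaterial for maps commuting with c, by [coset_termE]. *)
Definition coset_term M N (f : 'M_(rdegree M, rdegree N)) (A : {set gT}) :=
  M (repr A)^-1%g *m f *m N (repr A).

Definition transfer M N (f : 'M_(rdegree M, rdegree N)) : 'M_(rdegree M, rdegree N) :=
  \sum_(A in rcosets C G) coset_term f A.

Lemma repr_rcoset_in g : g \in G -> repr (C :* g)%g \in G.
Proof.
move=> Gg; have := mem_repr_rcoset <[c]>%G g.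
by case/rcosetP=> z Cz ->; rewrite groupM // (subsetP sCG).
Qed.

Lemma coset_termE M N (f : 'M_(rdegree M, rdegree N)) g :
  M c *m f = f *m N c -> g \in G ->
  coset_term f (C :* g)%g = M g^-1%g *m f *m N g.
Proof.
move=> Hf Gg; rewrite /coset_term.
have /rcosetP[z Cz ->] := mem_repr_rcoset <[c]>%G g.
have Gz := subsetP sCG z Cz.
rewrite invMg !repr_mxM ?groupV // -!mulmxA; congr (_ *m _).
by rewrite (mulmxA f) -(hom_cycle Hf Cz) !mulmxA -repr_mxM ?groupV // mulVg repr_mx1 mul1mx.
Qed.

Lemma transfer_hom M N (f : 'M_(rdegree M, rdegree N)) :
  M c *m f = f *m N c -> is_hom (transfer f).
Proof.
move=> Hf h Gh; rewrite /transfer mulmx_sumr mulmx_suml.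
rewrite (reindex_inj (can_inj (rcosetK h))) /=.
apply: eq_big => [A|A].
  apply/rcosetsP/rcosetsP=> [[g Gg E]|[g Gg ->]].
    by exists (g * h^-1)%g; rewrite ?groupM ?groupV // rcosetM -E rcosetK.
  by exists (g * h)%g; rewrite ?groupM // rcosetM.
case/rcosetsP=> g Gg E.
have -> : A = (C :* (g * h^-1))%g by rewrite rcosetM -E rcosetK.
rewrite -rcosetM mulgKV !coset_termE ?groupM ?groupV //.
rewrite invMg invgK !repr_mxM ?groupV // !mulmxA -(mulmxA _ (N h^-1%g)).
by rewrite -(repr_mxM N) ?groupV // mulVg repr_mx1 mulmx1.
Qed.

Lemma sum_transfer M N (th : 'M_(rdegree M, rdegree N)) :
  gtr th = transfer (\sum_(z in C) M z^-1%g *m th *m N z).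
Proof.
rewrite /gtr /transfer (set_partition_big _ (rcosets_partition sCG)) /=.
apply: eq_bigr => A /rcosetsP[g Gg ->].
set f := \sum_(z in C) _.
have Hf : M c *m f = f *m N c.
  rewrite mulmx_sumr mulmx_suml (reindex_inj (mulIg c)) /=.
  apply: eq_big => [z|z Cz]; first by rewrite groupMr ?cycle_id.
  rewrite groupMr ?cycle_id // in Cz; have Gz := subsetP sCG z Cz.
  rewrite invMg (repr_mxM M) ?groupV // (repr_mxM N) // !mulmxA.
  by rewrite -(repr_mxM M) ?groupV // mulgV repr_mx1 mul1mx.
rewrite coset_termE // mulmx_sumr mulmx_suml -rcosetE big_imset /=; last first.
  by move=> x y _ _ /mulIg.
apply: eq_bigr => z Cz; have Gz := subsetP sCG z Cz.
by rewrite invMg (repr_mxM M) ?groupV // (repr_mxM N) // !mulmxA.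
Qed.

Lemma transfer1 M : transfer (M := M) (N := M) 1%:M = (#|G : C|%g)%:R%:M.
Proof.
rewrite /transfer (eq_bigr (fun=> 1%:M)) => [|A /rcosetsP[g Gg ->]].
  by rewrite sumr_const -scaler_nat scalemx1.
have Gr := repr_rcoset_in Gg.
by rewrite /coset_term mulmx1 -repr_mxM ?groupV // mulVg repr_mx1.
Qed.

(** The trace is taken in two stages: a map with C-trace 1 has G-trace |G : C|, which is invertible
    in F. *)
Lemma cfree_projective M : cfree p (nil_mx M) -> projective M.
Proof.
move=> Mfree; pose nu := nil_mx M ^+ p.-1; pose th := pinvmx nu.
pose E := \sum_(z in C) M z^-1%g *m th *m M z.
(* On fixed vectors the sum collapses to y th times the norm, which returns y because freeness puts
   y in the image of the norm. *)
have fixE r (y : 'M_(r, rdegree M)) : y *m nil_mx M = 0 -> y *m E = y.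
  move=> yn; have yc : y *m M c = y by apply/nil_mx_fixed.
  rewrite mulmx_sumr.
  rewrite (eq_bigr (fun z => y *m th *m M z)) => [|z Cz]; last first.
    by rewrite !mulmxA (fixed_cycle yc) ?groupV.
  rewrite -mulmx_sumr sum_cycle_nil mulmxKpV //.
  by apply: submx_trans Mfree; apply/sub_kermxP.
have nE : nil_mx M *m E = E *m nil_mx M.
  apply: hom_nil; rewrite mulmx_sumr mulmx_suml (reindex_inj (mulIg c)) /=.
  apply: eq_big => [z|z Cz]; first by rewrite groupMr ?cycle_id.
  rewrite groupMr ?cycle_id // in Cz; have Gz := subsetP sCG z Cz.
  rewrite invMg (repr_mxM M) ?groupV // (repr_mxM M) // !mulmxA.
  by rewrite -(repr_mxM M) ?groupV // mulgV repr_mx1 mul1mx.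
(* E commutes with the nilpotent c - 1, so a nonzero kernel would contain a nonzero fixed vector,
   contrary to [fixE]. *)
have uE : E \in unitmx.
  rewrite -row_free_unit; apply/inj_row_free => v vE; apply/eqP/negPn/negP=> nz_v.
  have exj : exists j, v *m nil_mx M ^+ j == 0 by exists p; rewrite nil_mxp mulmx0.
  case: (ex_minnP exj) => -[|j] /eqP vj minj; first by rewrite mulmx1 in vj;
    rewrite vj eqxx in nz_v.
  have /eqP[] : v *m nil_mx M ^+ j != 0 by apply/negP=> /minj; rewrite ltnn.
  rewrite -(fixE _ (v *m nil_mx M ^+ j)); last by rewrite -mulmxA mulmxE -exprSr.
  by rewrite -mulmxA (simmx_expr _ nE) mulmxA vE mul0mx.
pose k := #|G : C|%g%:R : F.
have nz_k : k != 0 by rewrite -(dvdn_pcharf charFp).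
pose E' := invmx E.
have cE' : M c *m E' = E' *m M c.
  have cE : M c *m E = E *m M c.
    by move: nE; rewrite mulmxBl mulmxBr mul1mx mulmx1 => /addIr.
  by rewrite -[RHS](mulmxK uE) -(mulmxA E') cE mulmxA mulVmx // mul1mx.
have E'1 : \sum_(z in C) M z^-1%g *m (th *m E') *m M z = 1%:M.
  rewrite -(mulmxV uE) mulmx_suml; apply: eq_bigr => z Cz.
  by rewrite -!mulmxA -(hom_cycle cE' Cz).
apply: trace_split_projective; exists (k^-1 *: (th *m E')).
rewrite /gtr (eq_bigr (fun g => k^-1 *: (M g^-1%g *m (th *m E') *m M g))) => [|g _].
  rewrite -scaler_sumr -/(gtr _) sum_transfer E'1 transfer1 -scalemx1 scalerA.
  by rewrite mulVf // scale1r.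
by rewrite -scalemxAr -scalemxAl.
Qed.

Definition local_hom M N (f : 'M_(rdegree M, rdegree N)) : Prop :=
  {in 'N_G(C)%g, forall g, M g *m f = f *m N g}.

Fact normC : c \in 'N_G(C)%g.
Proof. by rewrite inE Gc (subsetP (normG C)) ?cycle_id. Qed.

Local Hint Resolve normC : core.

(* On a vector fixed by [c] the cosets of [C] outside its normaliser contribute a
   sum over free [C]-orbits, which lies in the image of the norm of [C]. *)
Lemma transfer_fixed M N (f : 'M_(rdegree M, rdegree N)) (y : 'rV_(rdegree M)) :
  local_hom f -> y *m M c = y ->
  (y *m transfer f - #|'N_G(C) : C|%g%:R *: (y *m f) <= nil_mx N ^+ p.-1)%MS.
Proof.
move=> Hf yc; have Hc := Hf c normC.
have sCN : C \subset 'N_G(C)%g by rewrite cycle_subG.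
have sNG : 'N_G(C)%g \subset G by apply: subsetIl.
rewrite /transfer (big_setID (rcosets C 'N_G(C))) /=.
have -> : rcosets C G :&: rcosets C 'N_G(C) = rcosets C 'N_G(C).
  apply/setIidPr/subsetP=> A /rcosetsP[g Ng ->]; apply/rcosetsP; exists g => //.
  exact: subsetP sNG g Ng.
rewrite mulmxDr addrAC (eq_bigr (fun=> f)) => [|A /rcosetsP[g Ng ->]]; last first.
  have Gg := subsetP sNG g Ng.
  by rewrite coset_termE // Hf ?groupV // -mulmxA -repr_mxM ?groupV // mulVg repr_mx1 mulmx1.
rewrite sumr_const -scaler_nat -scalemxAr subrr add0r mulmx_sumr nil_mx_pred.
pose s := perm (can_inj (rcosetK c)).
have sE i A : (s ^+ i)%g A = (A :* c ^+ i)%g.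
  elim: i => [|i IHi]; first by rewrite !expg0 perm1 mulg1.
  by rewrite !expgSr permM IHi permE rcosetM.
have sP : (s ^+ p = 1)%g by apply/permP=> A; rewrite sE -oc expg_order mulg1 perm1.
apply: (free_orbit_sum p_prime sP) => A /setDP[/rcosetsP[g Gg ->] nNg].
rewrite permE /= -rcosetM; split.
- apply/setDP; split; first by apply/rcosetsP; exists (g * c)%g; rewrite ?groupM.
  apply: contra nNg => /rcosetsP[x Nx E]; apply/rcosetsP; exists (x * c^-1)%g.
    by rewrite groupM ?groupV.
  by rewrite rcosetM -E rcosetM rcosetK.
- apply: contra nNg => /eqP E; apply/rcosetsP; exists g => //.
  have : (g * c)%g \in (C :* g)%g by rewrite -E rcoset_refl.
  rewrite mem_rcoset => Cgc; rewrite inE Gg -groupV inE;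
    apply/subsetP=> _ /imsetP[_ /cycleP[i ->] ->].
  by rewrite conjXg groupX //; move: Cgc; rewrite conjgE invgK mulgA.
rewrite !coset_termE ?groupM // invMg !repr_mxM ?groupV // !mulmxA.
by rewrite (fixed_cycle yc) // groupV cycle_id.
Qed.

Lemma index_norm_neq0 : #|'N_G(C) : C|%g%:R != 0 :> F.
Proof.
rewrite -(dvdn_pcharf charFp); apply: contra p'index => /dvdn_trans; apply.
by apply: indexSg; rewrite ?cycle_subG ?subsetIl.
Qed.

(** Conjugation by g sends c to some c^b, and c^b - 1 is a multiple of c - 1. *)
Lemma nilX_norm M g k : g \in 'N_G(C)%g ->
  (exists A, nil_mx M ^+ k *m M g = A *m nil_mx M ^+ k) /\
  (exists B, M g *m nil_mx M ^+ k = nil_mx M ^+ k *m B).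
Proof.
move=> Ng; have Gg : g \in G by case/setIP: Ng.
have conjC x : x \in 'N_G(C)%g -> exists b, (c ^ x = c ^+ b)%g.
  case/setIP=> _ /normP nx; apply/cycleP.
  by have : (c ^ x \in C :^ x)%g; [rewrite memJ_conjg cycle_id | rewrite nx].
have geo b : M c ^+ b - 1 = nil_mx M * \sum_(i < b) M c ^+ i by rewrite subrX1.
have cS b : GRing.comm (nil_mx M) (\sum_(i < b) M c ^+ i).
  apply: commr_sum => i _; apply: commrX; apply: commr_sym.
  by apply: commrB; [exact: commr_refl | exact: commr1].
split; elim: k => [|k [A IHk]].
- by exists (M g); rewrite expr0 mul1mx mulmx1.
- have [b cb] := conjC g Ng.
  exists (A *m (\sum_(i < b) M c ^+ i)).
  have E : nil_mx M *m M g = M g *m (M c ^+ b - 1).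
    rewrite mulmxBl mulmxBr mul1mx mulmx1 -repr_mxXn // -cb -!repr_mxM ?groupJ //.
    by rewrite -conjgC.
  have nS : nil_mx M ^+ k * (nil_mx M * \sum_(i < b) M c ^+ i)
      = (\sum_(i < b) M c ^+ i) * nil_mx M ^+ k.+1.
    by rewrite mulrA -exprSr; apply/commr_sym/commrX/commr_sym/cS.
  rewrite [in LHS]exprSr -mulmxE -mulmxA E geo mulmxA IHk -(mulmxA A) -(mulmxA A).
  by congr (_ *m _); exact: nS.
- by exists (M g); rewrite expr0 mul1mx mulmx1.
have [b cb] := conjC g^-1%g (groupVr Ng).
exists ((\sum_(i < b) M c ^+ i) *m A).
have E : M g *m nil_mx M = (M c ^+ b - 1) *m M g.
  rewrite mulmxBl mulmxBr mul1mx mulmx1 -repr_mxXn // -cb -!repr_mxM ?groupJ ?groupV //.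
  by rewrite conjgE invgK -!mulgA mulVg mulg1.
have nS : nil_mx M * (\sum_(i < b) M c ^+ i) * nil_mx M ^+ k
    = nil_mx M ^+ k.+1 * \sum_(i < b) M c ^+ i.
  rewrite -mulrA exprS -mulrA; congr (_ * _); exact/commrX/commr_sym/cS.
rewrite [in LHS]exprS -mulmxE mulmxA E geo -(mulmxA _ (M g)) IHk !mulmxA.
by congr (_ *m _); exact: nS.
Qed.

Lemma imX_norm M g k : g \in 'N_G(C)%g -> (nil_mx M ^+ k *m M g <= nil_mx M ^+ k)%MS.
Proof. by case/(nilX_norm M k)=> -[A ->] _; apply: submxMl. Qed.

Lemma kerX_norm M g k r (y : 'M_(r, rdegree M)) : g \in 'N_G(C)%g ->
  y *m nil_mx M ^+ k = 0 -> y *m M g *m nil_mx M ^+ k = 0.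
Proof. by case/(nilX_norm M k)=> _ [B E] yk; rewrite -mulmxA E mulmxA yk mul0mx. Qed.

(** * Eigenvalues of the complement h on the blocks of c *)

Section Complement.

Variables (h : gT) (a : nat).
Hypotheses (Gh : h \in G) (ch : (c ^ h = c ^+ a)%g) (hp : (h ^+ p.-1 = 1)%g).
Hypothesis a_prim : p.-1.-primitive_root (a%:R : F).
Hypothesis normCh : ('N_G(C) \subset C * <[h]>)%g.

Local Notation z := (a%:R : F).

Fact Nh : h \in 'N_G(C)%g.
Proof.
rewrite inE Gh inE; apply/subsetP=> _ /imsetP[_ /cycleP[i ->] ->].
by rewrite conjXg ch -expgM mem_cycle.
Qed.

Fact predp_gt0 : (0 < p.-1)%N. Proof. by have := p_gt1; case: (p) => [|[]]. Qed.

Fact predp_neq0 : p.-1%:R != 0 :> F.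
Proof. by rewrite -(dvdn_pcharf charFp) gtnNdvd ?predp_gt0 // ltn_predL. Qed.

Local Hint Resolve Nh predp_gt0 predp_neq0 : core.

Lemma local_hom_gen M N (f : 'M_(rdegree M, rdegree N)) :
  M c *m f = f *m N c -> M h *m f = f *m N h -> local_hom f.
Proof.
move=> Hc Hh g /(subsetP normCh)/mulsgP[x y Cx /cycleP[i ->] ->].
have Gx : x \in G by apply: subsetP sCG x Cx.
have Hi : M (h ^+ i)%g *m f = f *m N (h ^+ i)%g.
  by rewrite !repr_mxXn //; apply: simmx_expr.
rewrite (repr_mxM M) ?groupX // (repr_mxM N) ?groupX // -mulmxA Hi.
by rewrite (mulmxA (M x)) (hom_cycle Hc Cx) -mulmxA.
Qed.

Definition eigproj M (mu : F) : 'M[F]_(rdegree M) :=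
  p.-1%:R^-1 *: \sum_(i < p.-1) mu ^- i *: M h ^+ i.

Lemma hX1 M : M h ^+ p.-1 = 1.
Proof. by rewrite -repr_mxXn // hp repr_mx1. Qed.

Lemma eigproj_eigen M mu : mu ^+ p.-1 = 1 -> eigproj M mu *m M h = mu *: eigproj M mu.
Proof.
move=> mu1; have nz_mu : mu != 0.
  by apply: contra_eq_neq mu1 => ->; rewrite expr0n gtn_eqF // eq_sym oner_eq0.
rewrite /eigproj -scalemxAl scalerA mulrC -scalerA; congr (_ *: _).
rewrite mulmx_suml scaler_sumr.
pose Phi i := mu *: (mu ^- i *: M h ^+ i).
rewrite (eq_bigr (fun i : 'I_p.-1 => Phi i.+1)) => [|i _]; last first.
  rewrite /Phi scalerA -scalemxAl mulmxE -exprSr; congr (_ *: _).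
  by rewrite exprS invfM mulrA divff ?mul1r.
apply: (addrI (Phi 0%N)); rewrite -(big_ord_recl _ (fun i : 'I_p.-1.+1 => Phi i)).
rewrite big_ord_recr /= addrC; congr (_ + _).
by rewrite /Phi hX1 mu1 !expr0.
Qed.

Lemma sum_eigproj M : \sum_(j < p.-1) eigproj M (z ^+ j) = 1%:M.
Proof.
rewrite /eigproj -scaler_sumr exchange_big /=.
rewrite (eq_bigr (fun i : 'I_p.-1 => (\sum_(j < p.-1) (z ^- i) ^+ j) *: M h ^+ i)); last first.
  by move=> i _; rewrite scaler_suml; apply: eq_bigr => j _; rewrite -!exprVn -!exprM mulnC.
pose T (i : 'I_p.-1) := (\sum_(j < p.-1) (z ^- i) ^+ j) *: M h ^+ i.
pose i0 := Ordinal predp_gt0.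
have T0 i : i != i0 -> T i = 0.
  move=> ne_i; rewrite /T; suff -> : \sum_(j < p.-1) (z ^- i) ^+ j = 0 by rewrite scale0r.
  have nz : z ^- i - 1 != 0.
    rewrite subr_eq0 invr_eq1 -(prim_order_dvd a_prim) gtnNdvd ?ltn_ord //.
    by rewrite lt0n; rewrite -(inj_eq val_inj) in ne_i.
  apply: (mulfI nz); rewrite mulr0 -subrX1 exprVn -exprM mulnC exprM.
  by rewrite (prim_expr_order a_prim) expr1n invr1 subrr.
have sumT : \sum_(i < p.-1) T i = T i0.
  by rewrite (bigD1 i0) // [X in T i0 + X = _]big1 ?addr0.
suff : p.-1%:R^-1 *: (\sum_(i < p.-1) T i) = 1%:M by [].
rewrite sumT /T.
have -> : \sum_(j < p.-1) (z ^- i0) ^+ j = p.-1%:R.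
  rewrite (eq_bigr (fun=> 1)) ?sumr_const ?card_ord // => j _.
  by rewrite /i0 /= expr0 invr1 expr1n.
by rewrite scalerA mulVf // scale1r expr0.
Qed.

(** Every term of the average defining the projection fixes v modulo U. *)
Lemma eigproj_mod M mu (U : 'M_(rdegree M)) (v : 'rV_(rdegree M)) :
    mu ^+ p.-1 = 1 -> (U *m M h <= U)%MS -> (v *m M h - mu *: v <= U)%MS ->
  (v *m eigproj M mu - v <= U)%MS.
Proof.
move=> mu1 Uh vU; have nz_mu : mu != 0.
  by apply: contra_eq_neq mu1 => ->; rewrite expr0n gtn_eqF // eq_sym oner_eq0.
have vX i : (v *m M h ^+ i - mu ^+ i *: v <= U)%MS.
  elim: i => [|i IHi]; first by rewrite !expr0 mulmx1 scale1r subrr sub0mx.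
  rewrite exprSr -mulmxE mulmxA -[v *m _](subrK (mu ^+ i *: v)) mulmxDl.
  rewrite -addrA addmx_sub ?(submx_trans (submxMr _ IHi)) //.
  by rewrite -scalemxAl exprSr -scalerA -scalerBr scalemx_sub.
have -> : v *m eigproj M mu - v =
    p.-1%:R^-1 *: \sum_(i < p.-1) mu ^- i *: (v *m M h ^+ i - mu ^+ i *: v).
  rewrite -scalemxAr mulmx_sumr.
  under [in RHS]eq_bigr do rewrite scalerBr scalerA mulVf ?expf_neq0 // scale1r scalemxAr.
  rewrite sumrB sumr_const card_ord scalerBr -[v *+ _]scaler_nat scalerA mulVf //.
  by rewrite scale1r.
by apply/scalemx_sub/summx_sub => i _; apply/scalemx_sub.
Qed.

Lemma eigproj_hom M N (f : 'M_(rdegree M, rdegree N)) mu :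
  M h *m f = f *m N h -> eigproj M mu *m f = f *m eigproj N mu.
Proof.
move=> Hf; rewrite -scalemxAl -scalemxAr mulmx_suml mulmx_sumr; congr (_ *: _).
by apply: eq_bigr => i _; rewrite -scalemxAl -scalemxAr (simmx_expr _ Hf).
Qed.

(* The size of a Jordan block of [c] and the eigenvalue of [h] on its generator:
   by [typed_summand] these data determine a module whose restriction to [C] has
   a single nonfree summand.  They play the part of the Green correspondence. *)
Definition typed M k lam (x : 'rV_(rdegree M)) : Prop :=
  generates (nil_mx M) k x /\ x *m M h = lam *: x.

(** The components of x in the eigenspaces of h are all killed by the k-th power and add up to x, so
    one of them still generates. *)
Lemma typed_exists M k x : generates (nil_mx M) k x ->
  exists (j : 'I_p.-1) x', typed (M := M) k (z ^+ j) x'.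
Proof.
case/andP=> /eqP xk xk1.
have [[j Hj]|no] := pselect (exists j : 'I_p.-1,
    ~~ (x *m eigproj M (z ^+ j) *m nil_mx M ^+ k.-1 <= nil_mx M ^+ k)%MS).
  exists j, (x *m eigproj M (z ^+ j)); split; last first.
    rewrite -mulmxA eigproj_eigen -?scalemxAr //.
    by rewrite -exprM mulnC exprM (prim_expr_order a_prim) expr1n.
  rewrite /generates Hj andbT; apply/eqP.
  rewrite -scalemxAr -scalemxAl mulmx_sumr mulmx_suml big1 ?scaler0 // => i _.
  rewrite -scalemxAr -scalemxAl -repr_mxXn // kerX_norm ?scaler0 //.
  by rewrite groupX.
case/negP: xk1; rewrite -[x]mulmx1 -(sum_eigproj M) mulmx_sumr mulmx_suml.
apply: summx_sub => j _; apply: contrapT => /negP nj; apply: no; by exists j.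
Qed.

(** Since c^a - 1 is a multiple of c - 1 with constant coefficient a, moving h past (c - 1)^k costs
    the factor a^k to leading order. This is the origin of the eigenvalue shift under Omega. *)
Lemma nilX_h M k : exists2 Q, GRing.comm (nil_mx M) Q &
  nil_mx M ^+ k *m M h = M h *m (z ^+ k *: nil_mx M ^+ k + nil_mx M ^+ k.+1 *m Q).
Proof.
pose S := \sum_(i < a) M c ^+ i; pose n := nil_mx M.
have cS b : GRing.comm n (\sum_(i < b) M c ^+ i).
  apply: commr_sum => i _; apply: commrX; apply: commr_sym.
  by apply: commrB; [exact: commr_refl | exact: commr1].
have E1 : n *m M h = M h *m (n *m S).
  have -> : n *m S = M c ^+ a - 1 by rewrite subrX1.
  rewrite /n /nil_mx mulmxBl mulmxBr mul1mx mulmx1 -repr_mxXn // -ch.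
  by rewrite -!repr_mxM ?groupJ // -conjgC.
pose Q1 := \sum_(i < a) \sum_(j < i) M c ^+ j.
have cQ1 : GRing.comm n Q1 by apply: commr_sum => i _; apply: cS.
have S1 : S = z *: 1%:M + n *m Q1.
  rewrite mulmx_sumr (eq_bigr (fun i : 'I_a => M c ^+ i - 1)) => [|i _]; last by rewrite subrX1.
  by rewrite sumrB sumr_const card_ord scaler_nat addrC subrK.
have [Q cQ Sk] := expr_first_order k cQ1 S1.
have E : (n *m S) ^+ k = z ^+ k *: n ^+ k + n ^+ k.+1 *m Q.
  rewrite mulmxE exprMn_comm; last exact: cS.
  by rewrite Sk -mulmxE mulmxDr -scalemxAr mulmx1 mulmxA exprSr.
by exists Q; rewrite // (simmx_expr k E1) E.
Qed.

(** A map of rank one sending x to a multiple of v is made to commute with c by a sum over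
    complementary powers of c - 1, and then with h by averaging. The kernel of c - 1 goes into the
    socle of the block of v, which is what bounds the number of blocks later. *)
Lemma typed_map X M k lam (x : 'rV_(rdegree X)) (v : 'rV_(rdegree M)) :
    (0 < k)%N -> lam ^+ p.-1 = 1 ->
    typed (M := X) k lam x -> typed (M := M) k lam v ->
  exists f : 'M_(rdegree X, rdegree M),
    [/\ local_hom f, x *m f *m nil_mx M ^+ k.-1 = v *m nil_mx M ^+ k.-1 &
        (kermx (nil_mx X) *m f <= v *m nil_mx M ^+ k.-1)%MS].
Proof.
case: k => // k _ lam1 [/andP[/eqP xk xk1] xh] [/andP[/eqP vk _] vh].
rewrite /= in xk1 *.
pose nX := nil_mx X; pose nM := nil_mx M.
have nz_lam : lam != 0.
  by apply: contra_eq_neq lam1 => ->; rewrite expr0n gtn_eqF // eq_sym oner_eq0.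
(* Here k is the predecessor of the block size. The form l vanishes on the image of the (k+1)-st
   power, so that the first term cancels when c - 1 is applied to [f0]. *)
have [l lk xl] : exists2 l : 'cV_(rdegree X), nX ^+ k.+1 *m l = 0 & x *m nX ^+ k *m l = 1%:M.
  pose K := cokermx (nX ^+ k.+1).
  have : x *m nX ^+ k *m K != 0 by apply: contra xk1 => /eqP E; rewrite submxE; apply/eqP.
  move def_y : (x *m _ *m K) => y; case/matrix0Pn=> i [j]; rewrite ord1 => nz.
  exists ((y 0 j)^-1 *: (K *m delta_mx j 0)).
    by rewrite -scalemxAr mulmxA mulmx_coker mul0mx scaler0.
  rewrite -scalemxAr mulmxA def_y -colE; apply/matrixP=> s t.
  by rewrite !mxE !ord1 mulVf.
have expS m (N : 'M[F]_m) i : N *m N ^+ i = N ^+ i.+1 by rewrite exprS.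
have expSr m (N : 'M[F]_m) i : N ^+ i *m N = N ^+ i.+1 by rewrite exprSr.
pose f0 := \sum_(i < k.+1) nX ^+ (k - i) *m (l *m v) *m nM ^+ i.
have f0c : X c *m f0 = f0 *m M c.
  suff E : nX *m f0 = f0 *m nM.
    by move: E; rewrite mulmxBl mulmxBr mul1mx mulmx1 => /addIr.
  rewrite mulmx_sumr mulmx_suml big_ord_recl [RHS]big_ord_recr /=.
  rewrite subn0 !mulmxA expS lk !mul0mx add0r.
  rewrite -(mulmxA _ (nM ^+ k)) expSr -(mulmxA _ v) vk !mulmx0 addr0.
  apply: eq_bigr => i _; rewrite /bump /= add1n !mulmxA expS -(mulmxA _ (nM ^+ i)) expSr.
  by rewrite (subnSK (ltn_ord i)).
have xf0 : x *m f0 *m nM ^+ k = v *m nM ^+ k.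
  rewrite mulmx_sumr mulmx_suml big_ord_recl big1 ?addr0 => [|i _].
    by rewrite /= subn0 expr0 mulmx1 !mulmxA xl mul1mx.
  have nMk : nM ^+ (bump 0 i) *m nM ^+ k = nM ^+ k.+1 *m nM ^+ i.
    by rewrite !mulmxE -!exprD /bump /= add1n addSn addnC -addSn addnC.
  by rewrite -!mulmxA nMk (mulmxA v) vk !(mul0mx, mulmx0).
have kerf0 r (y : 'M_(r, rdegree X)) : y *m nX = 0 -> (y *m f0 <= v *m nM ^+ k)%MS.
  move=> yn; rewrite mulmx_sumr big_ord_recr /= big1 ?add0r => [|i _].
    by rewrite subnn expr0 mul1mx !mulmxA -(mulmxA _ v) submxMl.
  rewrite -(subnSK (ltn_ord i)).
  by rewrite exprS -mulmxE !mulmxA yn !mul0mx.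
(* The conjugates of [f0] by powers of h; they still commute with c because h normalises C. *)
pose t i := X (h ^- i)%g *m f0 *m M (h ^+ i)%g.
have Nhi i : (h ^+ i)%g \in 'N_G(C)%g by rewrite groupX.
have Ghi i : (h ^+ i)%g \in G by rewrite groupX.
have tc i : X c *m t i = t i *m M c.
  have Cc : (c ^ (h ^- i) \in C)%g.
    have := groupVr (Nhi i); case/setIP=> _ /normP nx.
    by have : (c ^ (h ^- i) \in C :^ (h ^- i))%g; [rewrite memJ_conjg cycle_id | rewrite nx].
  rewrite /t !mulmxA -(repr_mxM X) ?groupV // conjgC (repr_mxM X) ?groupV ?groupJ ?groupV //.
  rewrite -!mulmxA (mulmxA (X (c ^ _)%g)) (hom_cycle f0c Cc) -!mulmxA; do 2 congr (_ *m _).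
  by rewrite -!(repr_mxM M) ?groupJ ?groupV // conjgE invgK -!mulgA mulVg mulg1.
pose f := p.-1%:R^-1 *: \sum_(i < p.-1) t i.
have th i : X h *m t i.+1 = t i *m M h.
  rewrite /t !mulmxA -(repr_mxM X) ?groupV // expgSr invMg mulgA mulgV mul1g.
  by rewrite (repr_mxM M) // !mulmxA.
(* The shifted sum ends with t(p-1), which is t(0) as h^(p-1) = 1. *)
have sumt : \sum_(i < p.-1) t i.+1 = \sum_(i < p.-1) t i.
  apply: (addrI (t 0%N)); rewrite -(big_ord_recl _ (fun i : 'I_p.-1.+1 => t i)).
  by rewrite big_ord_recr /= addrC /t hp expg0.
have fh : X h *m f = f *m M h.
  rewrite -scalemxAr -scalemxAl -[in LHS]sumt mulmx_sumr mulmx_suml.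
  by rewrite (eq_bigr (fun i : 'I_p.-1 => t i *m M h)).
have fc : X c *m f = f *m M c.
  rewrite -scalemxAr -scalemxAl; congr (_ *: _).
  by rewrite mulmx_sumr mulmx_suml; apply: eq_bigr => i _; apply: tc.
have xhV i : x *m X (h ^- i)%g = lam ^- i *: x.
  have xhi : x *m X (h ^+ i)%g = lam ^+ i *: x.
    elim: i => [|i IHi]; first by rewrite expg0 repr_mx1 mulmx1 expr0 scale1r.
    by rewrite expgSr repr_mxM // mulmxA IHi -scalemxAl xh scalerA exprSr.
  rewrite -[x in LHS](scale1r) -(mulVf (expf_neq0 i nz_lam)) -scalerA -xhi.
  by rewrite -scalemxAl -mulmxA -repr_mxM ?groupV // mulgV repr_mx1 mulmx1.
have vhi i : v *m M (h ^+ i)%g = lam ^+ i *: v.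
  elim: i => [|i IHi]; first by rewrite expg0 repr_mx1 mulmx1 expr0 scale1r.
  by rewrite expgSr repr_mxM // mulmxA IHi -scalemxAl vh scalerA exprSr.
exists f; split; first exact: local_hom_gen.
  rewrite -scalemxAr -scalemxAl mulmx_sumr mulmx_suml.
  rewrite (eq_bigr (fun=> v *m nM ^+ k)) => [|i _].
    by rewrite sumr_const card_ord -scaler_nat scalerA mulVf // scale1r.
  rewrite /t !mulmxA xhV -!scalemxAl.
  have E : (x *m f0 - v) *m nM ^+ k = 0 by rewrite mulmxBl xf0 subrr.
  have := kerX_norm (Nhi i) E; rewrite !mulmxBl => /eqP; rewrite subr_eq0 => /eqP->.
  by rewrite vhi -scalemxAl scalerA mulVf ?expf_neq0 // scale1r.
rewrite -scalemxAr scalemx_sub // mulmx_sumr summx_sub // => i _.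
rewrite /t !mulmxA.
have Kn : kermx nX *m X (h ^- i)%g *m nX = 0.
  have := kerX_norm (M := X) (k := 1) (y := kermx nX) (groupVr (Nhi i)).
  by rewrite expr1; apply; rewrite mulmx_ker.
apply: submx_trans (submxMr _ (kerf0 _ _ Kn)) _.
move: (nat_of_ord i) => {Kn}i; elim: i => [|i IHi]; first by rewrite expg0 repr_mx1 mulmx1.
rewrite expgSr repr_mxM // mulmxA; apply: submx_trans (submxMr _ IHi) _.
have [Q _ E] := nilX_h M k.
rewrite -mulmxA E mulmxA vh -scalemxAl mulmxDr mulmxA vk mul0mx addr0.
by rewrite -scalemxAr !scalemx_sub.
Qed.

Lemma norm_fixed_nil M N (f : 'M_(rdegree M, rdegree N)) (y : 'rV_(rdegree M)) :
  local_hom f -> y *m nil_mx M = 0 ->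
  exists s, y *m transfer f = #|'N_G(C) : C|%g%:R *: (y *m f) + s *m nil_mx N ^+ p.-1.
Proof.
move=> Hf /nil_mx_fixed yc; have /submxP[s E] := transfer_fixed Hf yc.
by exists s; rewrite -E addrC subrK.
Qed.

(** The map f from the block of x to itself transfers to a scalar b, and b = |N(C) : C| by
    evaluation at the socle vector y. On any other w in the kernel, f takes values in the line of y,
    so w lies in that line modulo the image of the norm. *)
Lemma endo_scalar_blk1 M :
    (forall e, is_hom (M := M) (N := M) e -> exists b, e = b%:M) ->
    ~~ cfree p (nil_mx M) -> blk p (nil_mx M) = 1%N.
Proof.
move=> Msc nfree; have [k [x0 [kP gx0]]] := not_cfree_generates p_gt0 nfree.
have /andP[k_gt0 lt_kp] := kP.
have [j [x tx]] := typed_exists gx0; set lam := z ^+ j in tx.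
have lam1 : lam ^+ p.-1 = 1.
  by rewrite /lam -exprM mulnC exprM (prim_expr_order a_prim) expr1n.
have [f [Hf xf kerf]] := typed_map k_gt0 lam1 tx tx.
have Hc : M c *m f = f *m M c by apply: Hf normC.
have [b Tb] := Msc _ (transfer_hom Hc).
pose k0 : F := #|'N_G(C) : C|%g%:R; have nz_k0 : k0 != 0 := index_norm_neq0.
have [gx _] := tx; have /andP[/eqP xk nxk] := gx.
pose y := x *m nil_mx M ^+ k.-1.
have yn : y *m nil_mx M = 0 by apply/sub_kermxP/generates_ker.
have yf : y *m f = y.
  by rewrite /y -mulmxA (hom_nilX _ Hc) mulmxA xf.
have pk : (nil_mx M ^+ p.-1 <= nil_mx M ^+ k)%MS.
  by apply: expmx_le; rewrite -ltnS prednK.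
have bk0 : b = k0.
  have [s] := norm_fixed_nil Hf yn; rewrite yf Tb mul_mx_scalar => E.
  apply/eqP; rewrite -subr_eq0; apply: contraR nxk => nz.
  have {E} E : (b - k0) *: y = s *m nil_mx M ^+ p.-1 by rewrite scalerBl E addrC addKr.
  rewrite -/y -(eqmx_scale _ nz) E; apply: submx_trans (submxMl _ _) pk.
have kerM : (kermx (nil_mx M) <= y + nil_mx M ^+ p.-1)%MS.
  apply/row_subP=> i; set w := row i _.
  have wn : w *m nil_mx M = 0 by apply/sub_kermxP/row_sub.
  have [s] := norm_fixed_nil Hf wn; rewrite Tb bk0 mul_mx_scalar => E.
  rewrite -(eqmx_scale _ nz_k0) E addmx_sub_adds ?submxMl // scalemx_sub //.
  by apply: submx_trans kerf; rewrite submxMr ?row_sub.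
have : (\rank (kermx (nil_mx M)) <= (rk (nil_mx M) p.-1).+1)%N.
  apply: leq_trans (mxrankS kerM) (leq_trans (mxrank_adds_leqif _ _) _).
  by rewrite -[X in (_ <= X)%N]add1n leq_add2r rank_leq_row.
have := generates_blk p_gt0 (nil_mxp M) kP gx.
by rewrite /blk; move: (\rank _) (rk _ _) => r1 r2; clear; lia.
Qed.

Lemma rk_nil_rsim M N i : mx_rsim M N -> rk (nil_mx M) i = rk (nil_mx N) i.
Proof.
case/rsim_homs=> f [f' [Hf _ ff' f'f]]; apply: simmx_rk.
by apply: simmx_inv ff' f'f _; apply/hom_nil/Hf.
Qed.

Lemma nil_dadd X Y : nil_mx (dadd_grepr X Y) = block_mx (nil_mx X) 0 0 (nil_mx Y).
Proof. by rewrite /nil_mx [1 in LHS]scalar_mx_block opp_block_mx add_block_mx !subr0. Qed.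

Lemma rk_nil_dadd X Y i :
  rk (nil_mx (dadd_grepr X Y)) i = (rk (nil_mx X) i + rk (nil_mx Y) i)%N.
Proof. by rewrite nil_dadd rk_diag. Qed.

Lemma blk_dadd M X Y : mx_rsim M (dadd_grepr X Y) ->
  blk p (nil_mx M) = (blk p (nil_mx X) + blk p (nil_mx Y))%N.
Proof.
move=> S; have := blkE p_gt0 (nil_mxp M); rewrite !(rk_nil_rsim _ S) !rk_nil_dadd.
have := blkE p_gt0 (nil_mxp X); have := blkE p_gt0 (nil_mxp Y).
have := mxrank_rsim S => /=.
move: (rk _ _) (rk _ _) (rk _ _) (rk _ _) (blk _ _) (blk _ _) (blk _ _).
move=> n1 n2 n3 n4 n5 n6 n7; clear; lia.
Qed.

(** The two transfers compose to an endomorphism e of X multiplying the nonfree socle vector by a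
    unit modulo the norm. So the stable image of e contains the only nonfree block; its complement
    is projective, hence 0, and e is bijective. *)
Lemma typed_summand X M k lam (x : 'rV_(rdegree X)) (v : 'rV_(rdegree M)) :
    projective_free X -> blk p (nil_mx X) = 1%N -> (0 < k < p)%N -> lam ^+ p.-1 = 1 ->
    typed (M := X) k lam x -> typed (M := M) k lam v ->
  is_summand X M.
Proof.
move=> Xfree blkX kP lam1 tx tv; have /andP[k_gt0 lt_kp] := kP.
have [f [Hf xf _]] := typed_map k_gt0 lam1 tx tv.
have [g [Hg vg _]] := typed_map k_gt0 lam1 tv tx.
have fc : X c *m f = f *m M c by apply: Hf normC.
have gc : M c *m g = g *m X c by apply: Hg normC.
pose k0 : F := #|'N_G(C) : C|%g%:R; have nz_k0 : k0 != 0 := index_norm_neq0.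
have [gx _] := tx; have /andP[/eqP xk nxk] := gx.
have [gv _] := tv.
pose y := x *m nil_mx X ^+ k.-1; pose w := v *m nil_mx M ^+ k.-1.
have yn : y *m nil_mx X = 0 by apply/sub_kermxP/generates_ker.
have wn : w *m nil_mx M = 0 by apply/sub_kermxP/generates_ker.
have yf : y *m f = w by rewrite /y -mulmxA (hom_nilX _ fc) mulmxA xf.
have wg : w *m g = y by rewrite /w -mulmxA (hom_nilX _ gc) mulmxA vg.
have Tf := transfer_hom fc; have Tg := transfer_hom gc.
pose e := transfer f *m transfer g.
have He : is_hom (M := X) (N := X) e by apply: homM Tf Tg.
have ye : exists s, y *m e = (k0 * k0) *: y + s *m nil_mx X ^+ p.-1.
  have [s1 E1] := norm_fixed_nil Hf yn; have [s2 E2] := norm_fixed_nil Hg wn.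
  exists (k0 *: s2 + s1 *m transfer g).
  rewrite /e mulmxA E1 yf mulmxDl -scalemxAl E2 wg -(mulmxA s1) (hom_nilX _ (Tg c Gc)).
  by rewrite scalerDr scalerA -addrA mulmxDl -scalemxAl mulmxA.
have yeX m : exists s, y *m e ^+ m = (k0 * k0) ^+ m *: y + s *m nil_mx X ^+ p.-1.
  have [s0 E0] := ye; elim: m => [|m [s IHm]].
    by exists 0; rewrite !expr0 mulmx1 scale1r mul0mx addr0.
  exists ((k0 * k0) ^+ m *: s0 + s *m e).
  rewrite exprSr -mulmxE mulmxA IHm mulmxDl -scalemxAl E0 -(mulmxA s) (hom_nilX _ (He c Gc)).
  by rewrite scalerDr scalerA -exprSr -addrA mulmxDl -scalemxAl mulmxA.
have [m [Y [i [q [Hi Hq qi iq i_free]]]]] := fitting He.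
have pk : (nil_mx X ^+ p.-1 <= nil_mx X ^+ k)%MS.
  by apply: expmx_le; rewrite -ltnS prednK.
have nfreeY : ~~ cfree p (nil_mx Y).
  apply/negP=> Yfree; have [s E] := yeX m.+1.
  case/negP: nxk; rewrite -/y.
  have nz : (k0 * k0) ^+ m.+1 != 0 by rewrite expf_neq0 // mulf_neq0.
  rewrite -(eqmx_scale _ nz) -[_ *: y](addrK (s *m nil_mx X ^+ p.-1)) -E.
  apply: submx_trans pk; rewrite addmx_sub ?eqmx_opp ?submxMl // -qi mulmxA.
  have : (y *m q <= nil_mx Y ^+ p.-1)%MS.
    apply: submx_trans Yfree; apply/sub_kermxP.
    by rewrite -mulmxA -(hom_nil (Hq c Gc)) mulmxA yn mul0mx.
  by case/submxP=> t ->; rewrite -mulmxA (hom_nilX _ (Hi c Gc)) mulmxA submxMl.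
have [Z [k' [_ _ _ SXY]]] := split_summand Hi Hq iq.
have Z0 : rdegree Z = 0%N.
  apply: Xfree; last by exists Y; apply: mx_rsim_trans SXY (rsim_daddC _ _).
  apply: cfree_projective; rewrite cfree_blk ?nil_mxp //.
  have := blk_dadd SXY; rewrite blkX.
  have : blk p (nil_mx Y) != 0%N by rewrite -cfree_blk ?nil_mxp.
  by case: (blk p (nil_mx Y)) => [|[|n]] //; case: (blk p (nil_mx Z)).
have defX : rdegree X = rdegree Y by have := mxrank_rsim SXY; rewrite /= Z0 addn0.
apply: dsummand_split; exists (transfer f), (transfer g); split=> //.
suff : e ^+ m.+1 \in unitmx by rewrite exprS -mulmxE unitmx_mul => /andP[].
rewrite -row_full_unit /row_full eqn_leq rank_leq_col -qi mxrankMfree //.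
rewrite [X in (X <= _)%N]defX.
by apply: leq_trans (mxrankM_maxr i q); rewrite unitmx_rank.
Qed.

Lemma typed_kernel N P M k lam (x : 'rV_(rdegree M))
    (i : 'M_(rdegree N, rdegree P)) (f : 'M_(rdegree P, rdegree M)) :
    projective P -> is_hom i -> is_hom f -> row_free i -> row_full f ->
    (i :=: kermx f)%MS -> (0 < k < p)%N -> lam ^+ p.-1 = 1 -> typed (M := M) k lam x ->
  exists x', typed (M := N) (p - k) (lam * z ^+ k) x'.
Proof.
move=> Pproj Hi Hf i_free /row_fullP[f' f'f] iE kP lam1 [/andP[/eqP xk nxk] xh].
have /andP[k_gt0 lt_kp] := kP.
have Pfree := projective_cfree Pproj.
pose nP := nil_mx P; pose nN := nil_mx N.
have nf r := hom_nilX r (Hf c Gc); have ni r := hom_nilX r (Hi c Gc).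
have if0 : i *m f = 0 by apply/sub_kermxP; rewrite iE.
pose mu := lam * z ^+ k.
have mu1 : mu ^+ p.-1 = 1.
  by rewrite exprMn lam1 mul1r -exprM mulnC exprM (prim_expr_order a_prim) expr1n.
(* A lift of x to P that is an eigenvector of h for the same eigenvalue. *)
pose w := x *m f' *m eigproj P lam.
have wf : w *m f = x.
  rewrite /w -mulmxA (eigproj_hom lam (Hf h Gh)) mulmxA -(mulmxA x) f'f mulmx1.
  have := eigproj_mod (M := M) (U := 0) (v := x) lam1.
  rewrite mul0mx submx_refl xh subrr sub0mx => /(_ isT isT).
  by rewrite submx0 subr_eq0 => /eqP.
have wh : w *m P h = lam *: w by rewrite /w -mulmxA eigproj_eigen // -scalemxAr.
pose u := w *m nP ^+ k.
have /submxP[x0 def_u] : (u <= i)%MS.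
  by rewrite iE; apply/sub_kermxP; rewrite -mulmxA nf mulmxA wf xk.
(* w (c - 1)^k lies in the kernel N and generates a block there, but is an eigenvector of h only
   modulo the next power; its eigencomponent replaces it. *)
pose x' := x0 *m eigproj N mu.
have [r def_x'] : exists r, x' *m i = u + r *m nP ^+ k.+1.
  have : (u *m eigproj P mu - u <= nP ^+ k.+1)%MS.
    apply: eigproj_mod => //; first by apply: imX_norm.
    have [Q cQ E] := nilX_h P k.
    have cQ' : nil_mx P ^+ k.+1 *m Q = Q *m nil_mx P ^+ k.+1.
      by rewrite !mulmxE; apply/commr_sym/commrX/commr_sym.
    rewrite /u -mulmxA E cQ' mulmxA wh -!scalemxAl mulmxDr -scalemxAr scalerDr scalerA.
    by rewrite addrAC subrr add0r scalemx_sub // mulmxA submxMl.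
  case/submxP=> r E; exists r.
  by rewrite -E addrC subrK /x' -mulmxA (eigproj_hom mu (Hi h Gh)) mulmxA -def_u.
have nPge j : (p <= j)%N -> nP ^+ j = 0.
  by move=> le; rewrite -(subnK le) exprD nil_mxp mulr0.
exists x'; split; last by rewrite /x' -mulmxA eigproj_eigen // -scalemxAr.
have le_kp := ltnW lt_kp.
have nPD s t : nP ^+ s *m nP ^+ t = nP ^+ (s + t) by rewrite mulmxE -exprD.
apply/andP; split.
  apply/eqP; apply: (row_free_inj i_free); rewrite mul0mx -mulmxA ni mulmxA def_x'.
  rewrite mulmxDl -/nP /u -!mulmxA !nPD subnKC // addSn subnKC //.
  by rewrite !nPge // !mulmx0 addr0.
(* If x' did not generate, w (c - 1)^(k-1) minus an element of N would be killed by (c - 1)^(p-k),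
   hence by freeness lie in the image of (c - 1)^k; its image in M contradicts the choice of x. *)
apply: contra nxk => /submxP[t E].
have := congr1 (mulmx^~ i) E; rewrite -!mulmxA !ni !mulmxA def_x' mulmxDl.
rewrite -/nP /u -!mulmxA !nPD addSnnS prednK ?subn_gt0 // subnKC //.
rewrite (nPge p) // mulmx0 addr0.
have -> : (k + (p - k).-1 = p.-1)%N by move: kP; clear; lia.
have -> : p.-1 = (k.-1 + (p - k))%N by move: kP; clear; lia.
rewrite -nPD !mulmxA => /eqP; rewrite -subr_eq0 -mulmxBl => /eqP/sub_kermxP.
move=> /submx_trans/(_ (cfree_ker p_gt0 (nil_mxp P) Pfree (leq_subr k p))).
rewrite subKn // => /submxP[s Es].
have := congr1 (mulmx^~ f) Es; rewrite mulmxBl -!mulmxA if0 !mulmx0 subr0 !nf !mulmxA wf.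
by move=> ->; apply: submxMl.
Qed.

Lemma kernel_rk N P M (i : 'M_(rdegree N, rdegree P)) (f : 'M_(rdegree P, rdegree M)) j :
    projective P -> is_hom i -> is_hom f -> row_free i -> row_full f ->
    (i :=: kermx f)%MS -> (j <= p)%N ->
  (rk (nil_mx M) j + rdegree N = rk (nil_mx P) j + rk (nil_mx N) (p - j))%N.
Proof.
move=> Pproj Hi Hf i_free f_full iE le_jp.
exact: (exact_rk p_gt0 (nil_mxp P) (projective_cfree Pproj) le_jp
  (hom_nil (Hi c Gc)) (hom_nil (Hf c Gc)) i_free f_full iE).
Qed.

Lemma kernel_blk N P M (i : 'M_(rdegree N, rdegree P)) (f : 'M_(rdegree P, rdegree M)) :
    projective P -> is_hom i -> is_hom f -> row_free i -> row_full f ->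
    (i :=: kermx f)%MS ->
  blk p (nil_mx N) = blk p (nil_mx M).
Proof.
move=> Pproj Hi Hf i_free f_full iE.
have E j := kernel_rk (j := j) Pproj Hi Hf i_free f_full iE.
have aux dP dN dM m1 mq b1 b2 q r1 rq n1 nq : (n1 + nq + b1 = dN ->
    m1 + mq + b2 = dM -> dM + dN = dP + 0 -> m1 + dN = r1 + nq -> mq + dN = rq + n1 ->
    r1 = q * rq -> dP = q.+1 * rq -> b1 = b2)%N.
  by rewrite mulSn; move: (q * rq)%N => t; clear; lia.
have Pfree := projective_cfree Pproj.
apply: (aux (rdegree P) _ _ _ _ _ _ p.-1 (rk (nil_mx P) 1) (rk (nil_mx P) p.-1) _ _ (blkE p_gt0 (nil_mxp N)) (blkE p_gt0 (nil_mxp M))).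
- by have := E 0%N (leq0n p); rewrite !rk0 subn0 (rkp (nil_mxp N)).
- by have := E 1%N p_gt0; rewrite subn1.
- by have := E p.-1 (leq_pred p); rewrite -subn1 subKn // subn1.
- by have := cfree_rk p_gt0 (nil_mxp P) Pfree p_gt0; rewrite subn1.
by have := cfree_rk p_gt0 (nil_mxp P) Pfree (leq0n p); rewrite rk0 subn0 prednK.
Qed.

Lemma OmegaE M : exists P (i : 'M_(rdegree (Omega M), rdegree P)) (f : 'M_(rdegree P, rdegree M)),
  [/\ projective P, is_hom i & is_hom f] /\ [/\ row_free i, row_full f & (i :=: kermx f)%MS].
Proof.
have [P [f [[Pproj Hf f_full _] [i [Hi i_free iE]]]]] := OmegaP M.
by exists P, i, f.
Qed.

Lemma blk_Omega M : blk p (nil_mx (Omega M)) = blk p (nil_mx M).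
Proof.
by have [P [i [f [[? ? ?] [? ? ?]]]]] := OmegaE M; apply: (@kernel_blk _ P M i f).
Qed.

Lemma blk_iter_Omega M n : blk p (nil_mx (iter n (@Omega F gT G) M)) = blk p (nil_mx M).
Proof. by elim: n => //= n <-; apply: blk_Omega. Qed.

Lemma typed_Omega M k j x : (0 < k < p)%N -> typed (M := M) k (z ^+ j) x ->
  exists x', typed (M := Omega M) (p - k) (z ^+ (j + k)) x'.
Proof.
move=> kP tx; have [P [i [f [[? ? ?] [? ? ?]]]]] := OmegaE M; rewrite exprD.
apply: (typed_kernel (P := P) (i := i) (f := f)) tx => //.
by rewrite -exprM mulnC exprM (prim_expr_order a_prim) expr1n.
Qed.

(** Two translates restore the size k and add k + (p - k) = p to the exponent, which is 1 modulo p -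
    1. *)
Lemma typed_Omega2 M k j x m : (0 < k < p)%N -> typed (M := M) k (z ^+ j) x ->
  exists x', typed (M := iter m.*2 (@Omega F gT G) M) k (z ^+ (j + m)) x'.
Proof.
move=> kP tx; elim: m => [|m [y ty]]; first by rewrite addn0; exists x.
have [y1 ty1] := typed_Omega kP ty.
have kP' : (0 < p - k < p)%N by lia.
have [y2 ty2] := typed_Omega kP' ty1.
exists y2; move: ty2; rewrite subKn; last by lia.
have -> : (j + m + k + (p - k) = j + m.+1 + p.-1)%N by lia.
by rewrite [z ^+ (j + m.+1 + _)]exprD (prim_expr_order a_prim) mulr1.
Qed.

Lemma exists_shift (i j : 'I_p.-1) :
  exists m, (m < p.-1)%N /\ z ^+ (i + m) = z ^+ j.
Proof.
have ip := ltn_ord i; have jp := ltn_ord j.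
have [le_ij|lt_ji] := leqP i j.
  by exists (j - i)%N; rewrite subnKC //; split=> //; apply: leq_ltn_trans (leq_subr _ _) jp.
exists (p.-1 + j - i)%N; split; first by lia.
have -> : (i + (p.-1 + j - i) = p.-1 + j)%N by lia.
by rewrite exprD (prim_expr_order a_prim) mul1r.
Qed.

(** * Decomposition into Heller translates of a family *)

Section Family.

Variable D : 'I_p.-1 -> module.
Hypothesis D_blk : forall j, blk p (nil_mx (D j)) = 1%N.
Hypothesis D_gen : forall j, exists k x,
  generates (nil_mx (D j)) k x /\ (k = j.+1 \/ k = (p - j.+1)%N).

Lemma Omega_iter_projective_free M n : projective_free (iter n.+1 (@Omega F gT G) M).
Proof. exact: Omega_projective_free (OmegaP _). Qed.

(** A nonfree block of M of size k is matched with the block of D(k-1): by an even number of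
    translates when the latter has size k, by an odd number when it has size p - k. *)
Lemma Heller_summand M : ~ projective M ->
  exists n (j : 'I_p.-1), (n < (p.-1).*2)%N /\ is_summand (iter n.+1 (@Omega F gT G) (D j)) M.
Proof.
move=> nproj; have nfree : ~~ cfree p (nil_mx M) by apply/negP => /cfree_projective.
have [k [v0 [kP gv0]]] := not_cfree_generates p_gt0 nfree.
have [i0 [v tv]] := typed_exists gv0.
have ltj : (k.-1 < p.-1)%N by lia.
pose j := Ordinal ltj; have [k' [x0 [gx0 def_k']]] := D_gen j.
have [j0 [x tx]] := typed_exists gx0.
have lam1 i : (z ^+ i) ^+ p.-1 = 1.
  by rewrite -exprM mulnC exprM (prim_expr_order a_prim) expr1n.
have done_ n y : typed (M := iter n.+1 (@Omega F gT G) (D j)) k (z ^+ i0) y ->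
    is_summand (iter n.+1 (@Omega F gT G) (D j)) M.
  move=> ty; apply: (typed_summand (k := k) (lam := z ^+ i0) (x := y) (v := v)) => //.
    exact: Omega_iter_projective_free.
  by rewrite blk_iter_Omega.
have [Ek'|Ek'] : k' = k \/ k' = (p - k)%N.
  by case: def_k' => ->; [left | right]; rewrite /= prednK //; case/andP: kP.
- rewrite {}Ek' in gx0 tx {def_k'}.
  have [y1 ty1] := typed_Omega2 1 kP tx.
  have [m0 [lt_m E]] : exists m, (m < p.-1)%N /\ z ^+ (j0 + 1 + m) = z ^+ i0.
    have [m [lt_m E]] := exists_shift j0 i0.
    (* Zero translates would not guarantee a projective-free module; p - 1 pairs of translates have
       the same effect on the eigenvalue. *)
    case: m lt_m E => [|m] lt_m E; last by exists m; rewrite addnAC addn1 -addnS; split=> //;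
      apply: ltnW.
    exists p.-2; split; first by lia.
    have -> : (j0 + 1 + p.-2 = j0 + 0 + p.-1)%N by lia.
    by rewrite exprD E (prim_expr_order a_prim) mulr1.
  have [y ty] := typed_Omega2 m0.+1 kP tx.
  exists (m0.*2.+1), j; split; first by lia.
  by apply: (done_ _ y); move: ty; rewrite -E addnAC addn1 -addnS.
rewrite {}Ek' in gx0 tx {def_k'}; have kP' : (0 < p - k < p)%N by lia.
have lt_j1 : ((j0 + (p - k)) %% p.-1 < p.-1)%N by rewrite ltn_mod.
have [m [lt_m E]] := exists_shift (Ordinal lt_j1) i0.
have [y1 ty1] := typed_Omega2 m kP' tx.
have [y ty] := typed_Omega kP' ty1.
exists m.*2, j; split; first by lia.
apply: (done_ _ y); move: ty; rewrite subKn; last by lia.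
rewrite -E /= addnAC [z ^+ (j0 + _ + _)]exprD.
by rewrite -(prim_expr_mod a_prim (j0 + (p - k))) -exprD.
Qed.

Lemma Heller_decomposition M : exists P (s : seq (nat * 'I_p.-1)),
  [/\ projective P, all (fun x => x.1 < (p.-1).*2)%N s &
      mx_rsim M (dadd_grepr P
        (\big[@dadd_grepr _ _ _/grepr0]_(x <- s) iter x.1.+1 (@Omega F gT G) (D x.2)))].
Proof.
have [n le_Mn] := ubnP (rdegree M); elim: n M le_Mn => // n IHn M le_Mn.
have [Mproj|nproj] := pselect (projective M).
  exists M, [::]; rewrite big_nil; split=> //.
  by apply/mx_rsim_sym/(mx_rsim_trans (rsim_daddC _ _))/rsim_dadd0.
have [i [j [lt_i [M' SM]]]] := Heller_summand nproj.
set X := iter i.+1 (@Omega F gT G) (D j) in SM.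
have X_gt0 : (0 < rdegree X)%N.
  have b1 : blk p (nil_mx X) = 1%N by rewrite blk_iter_Omega.
  by apply: leq_trans (rank_leq_row (kermx (nil_mx X))); rewrite -b1 leq_subr.
have [|P [s [Pproj sP SM']]] := IHn M'.
  by have := mxrank_rsim SM => /=; lia.
exists P, ((i, j) :: s); split=> //; first by rewrite /= lt_i.
rewrite big_cons /= -/X; apply: (mx_rsim_trans SM).
apply: (mx_rsim_trans (rsim_dadd2 (mx_rsim_refl X) SM')).
apply: (mx_rsim_trans (rsim_daddA _ _ _)).
apply: (mx_rsim_trans (rsim_dadd2 (rsim_daddC X P) (mx_rsim_refl _))).
exact/mx_rsim_sym/rsim_daddA.
Qed.

(** * The function phi on modules *)

Section Gamma.

Variable R : realType.

Definition phi M : R := jdim R p (nil_mx M).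

Lemma phi_dadd X Y : phi (dadd_grepr X Y) = phi X + phi Y.
Proof. by rewrite /phi nil_dadd jdim_diag. Qed.

Lemma phi_rsim M N : mx_rsim M N -> phi M = phi N.
Proof. by move=> S; apply: eq_qsum => // i _; rewrite (rk_nil_rsim _ S). Qed.

Lemma phi_projective P : projective P -> phi P = 0.
Proof.
move=> /projective_cfree Pfree.
rewrite -(qsum_linear p_gt1 ((rk (nil_mx P) p.-1)%:R : R)).
apply: eq_qsum => // i /ltnW le_ip.
by rewrite (cfree_rk p_gt0 (nil_mxp P) Pfree le_ip) natrM mulrC.
Qed.

Lemma phi_kernel N P M (i : 'M_(rdegree N, rdegree P)) (f : 'M_(rdegree P, rdegree M)) :
    projective P -> is_hom i -> is_hom f -> row_free i -> row_full f ->
    (i :=: kermx f)%MS -> phi N = phi M.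
Proof.
move=> Pproj Hi Hf i_free f_full iE; have Pfree := projective_cfree Pproj.
apply: (qsum_exact p_gt1 (a := (rk (nil_mx P) p.-1)%:R) (b := (rdegree N)%:R)).
- by rewrite (rkp (nil_mxp N)).
- by rewrite (rkp (nil_mxp M)).
move=> j le_jp; rewrite -natrD (kernel_rk Pproj Hi Hf i_free f_full iE le_jp).
by rewrite natrD (cfree_rk p_gt0 (nil_mxp P) Pfree le_jp) natrM mulrC.
Qed.

Lemma phi_Omega M : phi (Omega M) = phi M.
Proof.
by have [P [i [f [[? ? ?] [? ? ?]]]]] := OmegaE M; apply: (@phi_kernel _ P M i f).
Qed.

Lemma phi_OmegaV M : phi (OmegaV M) = phi M.
Proof.
have [Q [f [[Qinj Hf f_free _] [q [Hq q_full qE]]]]] := OmegaVP M; apply/esym.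
apply: (@phi_kernel _ Q _ f q) => //; first exact/trace_split_projective/injective_trace_split.
by apply: eqmx_sym.
Qed.

Lemma phi_core M : phi (core M) = phi M.
Proof.
have [P Pproj /phi_rsim->] := core_complement (coreP M).
by rewrite phi_dadd (phi_projective Pproj) addr0.
Qed.

Lemma phi_heller i M : phi (heller i M) = phi M.
Proof.
case: i => [[|n]|n]; first exact: phi_core.
  by rewrite /heller; elim: n.+1 => //= m <-; apply: phi_Omega.
by rewrite /heller; elim: n.+1 => //= m <-; apply: phi_OmegaV.
Qed.

Lemma phi_tensor M N : phi (tensor M N) = phi M * phi N.
Proof.
rewrite /phi -(jdim_tens R charFp (nil_mxp N) (nil_mxp M)); congr (jdim _ _ _).
by rewrite /nil_mx /tens ![1 + (_ - 1)]addrC !subrK.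
Qed.

Lemma phi_D j : phi (D j) = qdim R p j.+1.
Proof.
have [k [x [gx def_k]]] := D_gen j; have lt_j := ltn_ord j.
have kP : (0 < k < p)%N by case: def_k => ->; lia.
transitivity (qdim R p k); last by case: def_k => -> //; rewrite qdimB //; lia.
rewrite /phi /jdim.
rewrite (eq_qsum p_gt1 (g := fun i => (rk (nil_mx (D j)) p.-1)%:R * (p - i)%:R + (k - i)%:R)).
  rewrite (qsumD _ (fun i => _ * (p - i)%:R)) qsum_linear // add0r qsum_block //; lia.
move=> i /ltnW le_ip.
by rewrite (blk1_rk p_gt0 (nil_mxp _) kP gx (D_blk j) le_ip) natrD natrM [X in X + _]mulrC.
Qed.

End Gamma.

End Family.

End Complement.

End CyclicSubgroup.

(** * The invariant as a ring homomorphism *)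

Section RootLimit.

Variable R : realType.
Import numFieldNormedType.Exports.
Local Open Scope classical_set_scope.

Lemma cvg_root_const (K : R) : 0 < K -> (fun n => K `^ (n.+1%:R^-1)) @ \oo --> (1 : R).
Proof.
move=> K_gt0; have -> : (fun n => K `^ (n.+1%:R^-1)) = (fun n => expR (harmonic n * ln K)).
  by apply/funext => n; rewrite /powR gt_eqF.
have h : (fun n => harmonic n * ln K) @ \oo --> (0 * ln K : R).
  by apply: cvgM; [exact: cvg_harmonic | exact: cvg_cst].
rewrite mul0r in h; rewrite -expR0.
by apply: (cvg_comp _ _ h); apply: continuous_expR.
Qed.

Lemma root_expn (x : R) n : 0 <= x -> (x ^+ n.+1) `^ (n.+1%:R^-1) = x.
Proof.
by move=> x0; rewrite -powR_mulrn // -powRrM mulfV ?powRr1 // pnatr_eq0.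
Qed.

Lemma limn_sup_root (u : nat -> R) (x K L : R) :
    0 <= x -> 0 < K -> 0 < L ->
    (forall n, 0 <= u n /\ x ^+ n.+1 <= L * u n /\ u n <= K * x ^+ n.+1) ->
  limn_sup (fun n => u n `^ (n.+1%:R^-1)) = x.
Proof.
move=> x0 K0 L0 bound; suff /cvg_limn_inf_sup[] : (fun n => u n `^ (n.+1%:R^-1)) @ \oo --> x by [].
apply: (@squeeze_cvgr _ _ _ _ (fun n => L^-1 `^ (n.+1%:R^-1) * x) (fun n => K `^ (n.+1%:R^-1) * x)).
- near=> n; have [un0 [lb ub]] := bound n.
  have inv0 : 0 <= n.+1%:R^-1 :> R by rewrite invr_ge0.
  have xn0 : 0 <= x ^+ n.+1 by apply: exprn_ge0.
  rewrite -[X in _ * X <= _](root_expn n x0) -[X in _ <= _ * X](root_expn n x0).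
  rewrite -!powRM ?invr_ge0 ?(ltW L0) ?(ltW K0) //.
  have lb' : L^-1 * x ^+ n.+1 <= u n by rewrite mulrC ler_pdivrMr // mulrC.
  have Kx : 0 <= K * x ^+ n.+1 by rewrite mulr_ge0 // ltW.
  have Lx : 0 <= L^-1 * x ^+ n.+1 by rewrite mulr_ge0 // invr_ge0 ltW.
  by apply/andP; split; apply: ge0_ler_powR.
- rewrite -[x in X in _ --> X]mul1r; apply: cvgM; last exact: cvg_cst.
  by apply: cvg_root_const; rewrite invr_gt0.
by rewrite -[x in X in _ --> X]mul1r; apply: cvgM; [exact: cvg_root_const | exact: cvg_cst].
Unshelve. all: by end_near. Qed.

End RootLimit.

Section Gamma.

Variables (R : realType) (F : fieldType) (gT : finGroupType) (G : {group gT}).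
Local Notation module := (representation F G).
Variables (phi : module -> R) (I : finType) (X : I -> module).

Hypothesis phi_rsim : forall M N : module, mx_rsim M N -> phi M = phi N.
Hypothesis phi_dadd : forall M N, phi (dadd_grepr M N) = phi M + phi N.
Hypothesis phi_projective : forall P, projective P -> phi P = 0.
Hypothesis phi_tensor : forall M N, phi (tensor M N) = phi M * phi N.
Hypothesis phi_X : forall i, 1 <= phi (X i).
Hypothesis decomposition : forall M : module, exists (P : module) (s : seq I),
  projective P /\ mx_rsim M (dadd_grepr P (\big[@dadd_grepr _ _ _/grepr0]_(i <- s) X i)).

Lemma phi_sum s : phi (\big[@dadd_grepr _ _ _/grepr0]_(i <- s) X i) = \sum_(i <- s) phi (X i).
Proof.
elim: s => [|i s IHs]; rewrite ?big_nil ?big_cons; last by rewrite phi_dadd IHs.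
exact/phi_projective/projective0.
Qed.

Lemma rdegree_sum s :
  rdegree (\big[@dadd_grepr _ _ _/grepr0]_(i <- s) X i) = (\sum_(i <- s) rdegree (X i))%N.
Proof. by elim: s => [|i s IHs]; rewrite ?big_nil ?big_cons //= IHs. Qed.

Lemma phi_decomposition M : exists s, phi M = \sum_(i <- s) phi (X i).
Proof.
have [P [s [Pproj S]]] := decomposition M; exists s.
by rewrite (phi_rsim S) phi_dadd (phi_projective Pproj) add0r phi_sum.
Qed.

Lemma phi_ge0 M : 0 <= phi M.
Proof.
have [s ->] := phi_decomposition M; apply: sumr_ge0 => i _.
by apply: le_trans (phi_X i).
Qed.

Let K : R := 1 + \sum_i (rdegree (X i))%:R.
Let L : R := 1 + \sum_i phi (X i).

(** The core has no projective part, so it is a sum of modules X i alone, each with phi between 1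
    and L and dimension between 1 and K. *)
Lemma core_bounds M :
  phi M <= L * (rdegree (core M))%:R /\ (rdegree (core M))%:R <= K * phi M.
Proof.
have [P' P'proj SM] := core_complement (coreP M).
have [_ Cfree _] := coreP M.
have -> : phi M = phi (core M).
  by rewrite (phi_rsim SM) phi_dadd (phi_projective P'proj) addr0.
have [P [s [Pproj S]]] := decomposition (core M).
have P0 : rdegree P = 0%N by apply: Cfree => //;
  exists (\big[@dadd_grepr _ _ _/grepr0]_(i <- s) X i).
rewrite (phi_rsim S) phi_dadd (phi_projective Pproj) add0r phi_sum.
have -> : rdegree (core M) = (\sum_(i <- s) rdegree (X i))%N.
  by rewrite (mxrank_rsim S) /= P0 rdegree_sum.
rewrite natr_sum !mulr_sumr; split; apply: ler_sum => i _.
  have d1 : 1 <= (rdegree (X i))%:R :> R.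
    rewrite ler1n lt0n; apply/eqP => d0.
    by have := phi_X i; rewrite phi_projective ?ler10 //; apply: projective0.
  apply: le_trans (_ : L <= _); last by rewrite ler_peMr // addr_ge0 // sumr_ge0 // => j _;
    apply: phi_ge0.
  rewrite /L (bigD1 i) //= [1 + _]addrC -addrA lerDl addr_ge0 //.
  by apply: sumr_ge0 => j _; apply: phi_ge0.
apply: le_trans (_ : K <= _); last by rewrite ler_peMr // addr_ge0 // sumr_ge0.
by rewrite /K (bigD1 i) //= [1 + _]addrC -addrA lerDl addr_ge0 // sumr_ge0.
Qed.

Lemma phi_tensor_power M n : phi (tensor_power M n.+1) = phi M ^+ n.+1.
Proof.
rewrite /tensor_power iteropS; elim: n => [|n IHn]; first by rewrite expr1.
by rewrite iterS phi_tensor IHn -exprS.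
Qed.

Lemma bs_gamma_phi M : bs_gamma R M = phi M.
Proof.
apply: (limn_sup_root (K := K) (L := L)).
- exact: phi_ge0.
- by rewrite /K ltr_pwDl ?ltr01 // sumr_ge0.
- rewrite /L ltr_pwDl ?ltr01 // sumr_ge0 // => i _; apply: phi_ge0.
move=> n; split=> //; rewrite -phi_tensor_power; exact: core_bounds.
Qed.

End Gamma.

(** * Hook Specht modules *)

Section Heads.

Variables (F : fieldType) (gT : finGroupType) (G : {group gT}).
Local Notation module := (representation F G).

Definition simple_module (N : module) : Prop :=
  forall U : 'M[F]_(rdegree N), mxmodule N U -> U != 0 -> row_full U.

Variables (S : module) (r : nat) (Gam : 'M[F]_(rdegree S, r)).
Hypothesis Gam_neq0 : Gam != 0.
Hypothesis ker_module : mxmodule S (kermx Gam).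
Hypothesis ker_max : forall U : 'M[F]_(rdegree S),
  mxmodule S U -> ~~ (U <= kermx Gam)%MS -> row_full U.

Lemma ker_proper : ~~ (1%:M <= kermx Gam)%MS.
Proof. by apply: contra Gam_neq0 => /sub_kermxP; rewrite mul1mx => ->. Qed.

Lemma ker_max_submod : max_submod S (kermx Gam) 1%:M.
Proof.
split; first by rewrite /ltmx submx1 ker_proper.
move=> W [modW /andP[_ nW] /andP[_ /negP]]; apply.
by rewrite sub1mx; apply: ker_max.
Qed.

(** By [ker_max] the kernel of Gam is the only maximal submodule. *)
Lemma radical_ker (J : 'M[F]_(rdegree S)) : is_radical J <-> (J :=: kermx Gam)%MS.
Proof.
have maxE (U : 'M[F]_(rdegree S)) :
    mxmodule S U -> max_submod S U 1%:M -> (U :=: kermx Gam)%MS.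
  move=> modU [/andP[_ nU] maxU]; apply/eqmxP.
  have leU : (U <= kermx Gam)%MS.
    by apply: contraR nU => /(ker_max modU); rewrite sub1mx.
  rewrite leU /=; apply: contrapT => /negP nle.
  apply: (maxU (kermx Gam)); split; [exact: ker_module| |].
    by rewrite /ltmx leU.
  by rewrite /ltmx submx1 ker_proper.
split=> [radJ | JE v].
  apply/eqmxP/andP; split; apply/row_subP=> i.
    by apply: (radJ _).1; rewrite ?row_sub //; apply: ker_max_submod.
  by apply/(radJ _).2 => U modU /(maxE _ modU)->; apply: row_sub.
split=> [vJ U modU /(maxE _ modU)-> | ]; first by rewrite -JE.
by move=> h; rewrite JE; apply: h ker_max_submod.
Qed.

Lemma is_head_exists : exists N, is_head S N.
Proof.
have [N [q [Hq q_full qE]]] := quotient_exists ker_module.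
by exists N, (kermx Gam), q; split=> //; apply/radical_ker.
Qed.

Lemma head_simple : simple_module (head_module S) /\ rdegree (head_module S) = \rank Gam.
Proof.
have [J [q [/radical_ker JE Hq q_full qE]]] := some_moduleP is_head_exists.
move: q Hq q_full qE; rewrite -/(head_module S) => q Hq q_full qE.
have {JE} qE : (kermx q :=: kermx Gam)%MS := eqmx_trans qE JE.
split; last first.
  have := mxrank_ker q; rewrite qE mxrank_ker => E.
  have := rank_leq_row Gam; have := rank_leq_row q.
  by have /eqP := q_full; lia.
move=> U modU nzU; have /row_fullP[q' q'q] := q_full.
pose W := kermx (q *m cokermx U).
have WP m (v : 'M_(m, rdegree S)) : (v <= W)%MS = (v *m q <= U)%MS.
  by apply/sub_kermxP/idP => [|]; rewrite mulmxA submxE => /eqP.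
have modW : mxmodule S W.
  apply/mxmoduleP=> g Gg; rewrite WP -mulmxA Hq // mulmxA.
  by apply: mxmodule_trans => //; rewrite -WP.
have fullW : row_full W.
  apply: ker_max => //; apply: contra nzU => leW.
  have : (U *m q' <= kermx q)%MS by rewrite qE; apply: submx_trans leW;
    rewrite WP -mulmxA q'q mulmx1.
  by move/sub_kermxP; rewrite -mulmxA q'q mulmx1 => ->.
rewrite -sub1mx -q'q; apply: submx_trans (_ : q' *m q <= U)%MS => //.
by rewrite -WP; apply: submx_trans (submx1 _) _; rewrite sub1mx.
Qed.

End Heads.

Lemma simple_endo_scalar (F : closedFieldType) (gT : finGroupType) (G : {group gT})
    (N : representation F G) (e : 'M_(rdegree N)) :
  simple_module N -> is_hom (M := N) (N := N) e -> exists b, e = b%:M.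
Proof.
move=> Nsimple He; have [N0|N_gt0] := posnP (rdegree N).
  exists 0; apply/eqP; rewrite -subr_eq0 -mxrank_eq0 -leqn0.
  by apply: leq_trans (rank_leq_row _) _; rewrite N0.
have [b] : exists b, root (char_poly e) b.
  by apply/closed_rootP; rewrite size_char_poly eqSS; lia.
rewrite -eigenvalue_root_char => /eigenvalueP[v ve nz_v].
exists b; apply/eqP; rewrite -subr_eq0.
have Hb : is_hom (M := N) (N := N) (e - b%:M).
  by apply: homB => // g _; rewrite scalar_mxC.
have : row_full (kermx (e - b%:M)).
  apply: Nsimple; first exact: hom_ker_module.
  apply: contra nz_v => /eqP K0; rewrite -submx0 -K0; apply/sub_kermxP.
  by rewrite mulmxBr ve mul_mx_scalar subrr.
by case/row_fullP=> h h1; rewrite -[e - _]mul1mx -h1 -mulmxA mulmx_ker mulmx0.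
Qed.

Lemma idempotent_factor (F : fieldType) n r (C : 'M[F]_(n, r)) (R : 'M[F]_(r, n)) :
  row_full C -> row_free R -> (C *m R) *m (C *m R) = C *m R -> R *m C = 1%:M.
Proof.
move=> /row_fullP[C' C'C] /row_freeP[R' RR'] /(congr1 (fun A => C' *m A *m R')).
by rewrite !mulmxA C'C !mul1mx -!mulmxA RR' !mulmx1.
Qed.

Lemma idempotent_trace (F : fieldType) n (P : 'M[F]_n) :
  P *m P = P -> \tr P = (\rank P)%:R.
Proof.
move=> PP; rewrite -[in LHS](mulmx_base P) mxtrace_mulC.
rewrite (idempotent_factor (col_base_full P) (row_base_free P)) ?mxtrace1 //.
by rewrite mulmx_base.
Qed.

(** * Minors and determinant identities *)

Section CauchyBinet.

Variables (F : fieldType) (n j : nat).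
Implicit Types (X Y : 'M[F]_n) (a b c : {ffun 'I_j -> 'I_n}).

(** The indices run over all functions, not only increasing ones. Functions with a repeated value
    contribute 0 and every j-element set is met j! times, whence the factor in [Cauchy_Binet]. *)
Definition minor X a b : F := \det (\matrix_(x < j, y < j) X (a x) (b y)).

Lemma minorE X a b : minor X a b = \sum_(s : 'S_j) (-1) ^+ s * \prod_x X (a x) (b (s x)).
Proof. by apply: eq_bigr => s _; congr (_ * _); apply: eq_bigr => x _; rewrite mxE. Qed.

Lemma minor_tr X a b : minor X^T a b = minor X b a.
Proof. by rewrite /minor -det_tr; congr (\det _); apply/matrixP=> x y; rewrite !mxE. Qed.

Lemma minor_perml X a b x y : x != y -> a x = a y -> minor X a b = 0.
Proof. by move=> ne axy; apply: (determinant_alternate ne) => z; rewrite !mxE axy. Qed.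

Lemma minor_permr X a b x y : x != y -> b x = b y -> minor X a b = 0.
Proof. by rewrite -minor_tr; apply: minor_perml. Qed.

Lemma Cauchy_Binet X Y a c :
  \sum_b minor X a b * minor Y b c = (j`!)%:R * minor (X *m Y) a c.
Proof.
(* Composing the index function with t removes t from the first factor; the sum over functions then
   factors into entries of X Y. *)
have E (s : 'S_j) : \sum_b minor X a b * \prod_x Y (b x) (c (s x)) =
    \sum_(t : 'S_j) (-1) ^+ t * \prod_x (X *m Y) (a x) (c (s (t x))).
  under eq_bigr do rewrite minorE mulr_suml.
  rewrite exchange_big; apply: eq_bigr => t _.
  under [in RHS]eq_bigr do rewrite mxE.
  rewrite (bigA_distr_bigA (fun x z => X (a x) z * Y z (c (s (t x))))) mulr_sumr.
  have inj_t : injective (fun b => [ffun x => b (t x)] : {ffun 'I_j -> 'I_n}).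
    move=> b b' /ffunP bb'; apply/ffunP=> x; have := bb' (t^-1%g x).
    by rewrite !ffunE permKV.
  rewrite [RHS](reindex_inj inj_t); apply: eq_bigr => b _; rewrite -mulrA; congr (_ * _).
  rewrite [X in _ * X](reindex_inj (@perm_inj _ t)) -big_split /=.
  by apply: eq_bigr => x _; rewrite ffunE.
under eq_bigr do rewrite (minorE Y) mulr_sumr.
rewrite exchange_big /=.
under eq_bigr => s _.
  under eq_bigr do rewrite mulrCA; rewrite -mulr_sumr E; over.
rewrite /=; under eq_bigr do rewrite mulr_sumr.
rewrite exchange_big /=; transitivity (\sum_(t : 'S_j) minor (X *m Y) a c); last first.
  by rewrite sumr_const cardT -cardE card_Sn mulr_natl.
apply: eq_bigr => t _; rewrite minorE [RHS](reindex_inj (mulgI t)) /=; apply: eq_bigr => s _.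
rewrite odd_permM signr_addb mulrCA mulrA; congr (_ * _).
by apply: eq_bigr => x _; rewrite permM.
Qed.

End CauchyBinet.

(** Both sequences are completed to enumerations of T, which are matched by position. *)
Lemma perm_map_seq (T : finType) (s1 s2 : seq T) :
  uniq s1 -> uniq s2 -> size s1 = size s2 -> exists g : {perm T}, map g s1 = s2.
Proof.
move=> u1 u2 s12; case E1: s1 => [|x0 s0].
  by exists 1%g; case: s2 s12 {u2}; rewrite E1.
rewrite -E1 {s0 E1}.
pose e (s : seq T) := s ++ [seq x <- enum T | x \notin s].
have uniq_e s : uniq s -> uniq (e s).
  move=> us; rewrite cat_uniq us filter_uniq ?enum_uniq // andbT.
  by apply/hasPn=> x; rewrite mem_filter => /andP[].
have mem_e s x : x \in e s by rewrite mem_cat mem_filter mem_enum /= andbT orbN.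
have size_e s : uniq s -> size (e s) = #|T|.
  by move=> /uniq_e us; rewrite -(card_uniqP us) -cardsT; apply: eq_card => x; rewrite mem_e inE.
pose g x := nth x (e s2) (index x (e s1)).
have gE x y : g x = nth y (e s2) (index x (e s1)).
  by apply: set_nth_default; rewrite size_e // -(size_e s1) // index_mem.
have g_inj : injective g.
  move=> x y; rewrite (gE x y) (gE y y) => /eqP; rewrite nth_uniq ?size_e //.
  - by move=> /eqP/(congr1 (nth x (e s1))); rewrite !nth_index.
  - by rewrite -(size_e s1) // index_mem.
  - by rewrite -(size_e s1) // index_mem.
  exact: uniq_e.
exists (perm g_inj).
apply: (@eq_from_nth _ x0) => [|i]; rewrite size_map // => lt_i.
rewrite (nth_map x0) // permE (gE _ x0) index_cat mem_nth // index_uniq //.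
by rewrite nth_cat -s12 lt_i.
Qed.

Lemma perm_extend (T I : finType) (h f : I -> T) :
  injective h -> injective f -> exists g : {perm T}, forall i, g (h i) = f i.
Proof.
move=> h_inj f_inj.
have [||| g] := @perm_map_seq T (map h (enum I)) (map f (enum I)).
- by rewrite map_inj_uniq ?enum_uniq.
- by rewrite map_inj_uniq ?enum_uniq.
- by rewrite !size_map.
by rewrite -map_comp => /eq_in_map gE; exists g => i; apply: gE; rewrite mem_enum.
Qed.

(** Adding all other rows to the first makes it constant 1, and multiples of it are then subtracted
    from the others. *)
Lemma det_col_sums1 (F : comUnitRingType) j (A : 'M[F]_(1 + j)) (w : 'cV[F]_j) :
  (forall y, \sum_x A x y = 1) ->
  \det A = \det (block_mx 1%:M (const_mx 1) (dlsubmx A - w) (drsubmx A - w *m const_mx 1)).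
Proof.
move=> sumA; have -> : \det A =
    \det (block_mx 1%:M 0 (- w) 1%:M *m (block_mx 1%:M (const_mx 1) 0 1%:M *m A)).
  by rewrite !det_mulmx det_lblock det_ublock !det1 !mul1r.
congr (\det _); rewrite -{1}[A]submxK !mulmx_block !mul1mx !mul0mx !add0r !addr0.
have sumE (y : 'I_(1 + j)) : A (lshift j 0) y + \sum_k A (rshift 1 k) y = 1.
  by rewrite -(sumA y) big_split_ord big_ord1.
have -> : ulsubmx A + const_mx 1 *m dlsubmx A = 1%:M.
  apply/matrixP=> x y; rewrite !ord1 !mxE eqxx -[RHS](sumE (lshift j 0)).
  by congr (_ + _); apply: eq_bigr => k _; rewrite !mxE mul1r.
have -> : ursubmx A + const_mx 1 *m drsubmx A = const_mx 1.
  apply/matrixP=> x y; rewrite !ord1 !mxE -[RHS](sumE (rshift 1 y)).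
  by congr (_ + _); apply: eq_bigr => k _; rewrite !mxE mul1r.
by rewrite !mulNmx mulmx1 ![- _ + _]addrC.
Qed.

(** Clearing the bordered matrix [M] below its corner leaves 1 plus the all-ones matrix; clearing it
    to the right leaves the number j + 1. *)
Lemma det_add_const1 (F : comUnitRingType) j :
  \det (1%:M + const_mx 1 : 'M[F]_j) = j.+1%:R.
Proof.
pose M : 'M[F]_(1 + j) := block_mx 1%:M (- const_mx 1) (const_mx 1) 1%:M.
transitivity (\det M).
  transitivity (\det (block_mx 1%:M 0 (- const_mx 1) 1%:M *m M)).
    rewrite mulmx_block !mul1mx !mul0mx !addr0 mulmx1 addNr mulmxN mulNmx opprK.
    rewrite det_ublock det1 mul1r addrC; congr (\det (_ + _)).
    by apply/matrixP=> x y; rewrite !mxE big_ord1 !mxE mulr1.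
  by rewrite det_mulmx det_lblock !det1 !mul1r.
transitivity (\det (block_mx 1%:M (const_mx 1) 0 1%:M *m M)); last first.
  by rewrite mulmx_block !mul1mx !mul0mx !add0r mulmx1 addNr det_lblock det1 mulr1
    det_mx11 !mxE -natr1 addrC; congr (_ + _);
      rewrite (eq_bigr (fun=> 1)) ?sumr_const ?card_ord // => k _;
    rewrite !mxE mulr1.
by rewrite det_mulmx det_ublock !det1 !mul1r.
Qed.

Lemma action_mx_entry (F : fieldType) (gT : finGroupType) (T : finType)
    (to : {action gT &-> T}) (v : 'rV[F]_#|T|) g x :
  (v *m action_mx F to g) 0 (enum_rank x) = v 0 (enum_rank (to x g^-1%g)).
Proof.
rewrite mxE (bigD1 (enum_rank (to x g^-1%g))) //= big1 => [|k ne_k]; rewrite !mxE !enum_rankK.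
  by rewrite actKVin ?inE // eqxx mulr1 addr0.
case: (x =P _) ne_k => [-> | _ _]; last by rewrite mulr0.
by rewrite actKin ?inE // enum_valK eqxx.
Qed.

Lemma action_mx_tr (F : fieldType) (gT : finGroupType) (T : finType)
    (to : {action gT &-> T}) g :
  (action_mx F to g)^T = action_mx F to g^-1%g.
Proof.
apply/matrixP=> x y; rewrite !mxE; congr (_%:R); congr nat_of_bool.
by apply/eqP/eqP=> ->; rewrite ?actKin ?actKVin ?inE.
Qed.

(** * Tableaux and tabloids of hook shape *)

Section Hook.

Variables j q : nat.
Local Notation n := (j.+1 + q)%N.
(** Written as in [hook_D], to which it reduces for p = j.+1 + q. *)
Definition hook := (j.+1 + q - j)%N :: nseq j 1%N.

Definition hook_base_pos (x : 'I_n) : 'I_n * 'I_n :=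
  if (x <= j)%N then (x, ord0)
  else (ord0, Ordinal (leq_ltn_trans (leq_subr j x) (ltn_ord x))).

Lemma hook_nth r : nth 0%N hook r = (if r == 0 then q.+1 else (r <= j) : nat)%N.
Proof. by case: r => [|r] /=; [lia | rewrite nth_nseq; case: ltnP]. Qed.

Lemma hook_base_pos_diagram x : ((hook_base_pos x).2 < nth 0 hook (hook_base_pos x).1)%N.
Proof.
rewrite hook_nth /hook_base_pos; case: (leqP x j) => /= x_j; first by rewrite x_j; case: eqP.
by have := ltn_ord x; lia.
Qed.

Lemma hook_base_pos_onto (z : 'I_n * 'I_n) :
  (z.2 < nth 0 hook z.1)%N -> exists x, hook_base_pos x = z.
Proof.
case: z => r c; rewrite hook_nth /= => lt_c.
have [c0|c_gt0] := posnP c.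
  exists r; rewrite /hook_base_pos; have -> : (r <= j)%N by move: lt_c; rewrite c0;
    case: eqP => [->|_] //; rewrite lt0b.
  by congr (_, _); apply: val_inj; rewrite /= c0.
have r0 : r = 0%N :> nat by move: lt_c; case: eqP => // _; case: (r <= j)%N => /=; lia.
have lt_n : (j + c < n)%N by move: lt_c; rewrite r0 /=; lia.
exists (Ordinal lt_n); have nle : (j + c <= j)%N = false by lia.
rewrite /hook_base_pos /= nle.
by congr (_, _); apply: val_inj; rewrite /= ?r0 ?addKn.
Qed.

Lemma hook_base_pos_inj : injective hook_base_pos.
Proof.
move=> x y; rewrite /hook_base_pos; have := ltn_ord x; have := ltn_ord y.
by case: (leqP x j) => xj; case: (leqP y j) => yj lty ltx /[dup];
  move=> /(congr1 (fun z => val z.1))/= e1 /(congr1 (fun z => val z.2))/= e2;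
    apply: val_inj => /=; lia.
Qed.

Lemma hook_base_subproof : is_tableau hook [ffun x => hook_base_pos x].
Proof.
apply/andP; split; last by apply/forallP=> x; rewrite ffunE hook_base_pos_diagram.
by apply/injectiveP=> x y; rewrite !ffunE => /hook_base_pos_inj.
Qed.

Definition hook_base : tableau n hook := Sub _ hook_base_subproof.

Lemma hook_tableau (t : tableau n hook) : exists g, t = tableau_act hook_base g.
Proof.
have /andP[/injectiveP t_inj /forallP t_in] := valP t.
have ex_y x : exists y, hook_base_pos y == val t x.
  by have [y <-] := hook_base_pos_onto (t_in x); exists y.
pose y x := xchoose (ex_y x); have yE x : hook_base_pos (y x) = val t x := eqP (xchooseP (ex_y x)).
have y_inj : injective y by move=> x x' /(congr1 hook_base_pos); rewrite !yE => /t_inj.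
exists (perm y_inj)^-1%g; apply: val_inj; apply/ffunP=> x.
by rewrite /= !ffunE invgK permE yE.
Qed.

Local Notation w := (lshift q).
Local Notation tabloid := (tabloid n hook).

Lemma hook_rows (f : tabloid) :
  exists g : 'S_n, forall x, val f x = if (g x <= j)%N then g x else ord0.
Proof.
have /existsP[t /andP[tab_t /eqP ft]] := valP f.
have [g tE] := hook_tableau (Sub t tab_t).
exists g^-1%g => x; rewrite ft ffunE; have -> : t = val (tableau_act hook_base g) by rewrite -tE.
by rewrite /= !ffunE /hook_base_pos; case: ifP.
Qed.

(* The entries of [f] below its first row; the default value is never used. *)
Definition leg (f : tabloid) : {ffun 'I_j -> 'I_n} :=
  [ffun i : 'I_j => odflt ord0 [pick x | val f x == i.+1 :> nat]].

Lemma hook_row_le (f : tabloid) x : (val f x <= j)%N.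
Proof. by have [g ->] := hook_rows f; case: ifP. Qed.

Lemma legE (f : tabloid) (i : 'I_j) x : (val f x == i.+1 :> nat) = (x == leg f i).
Proof.
have [g fE] := hook_rows f; have lt_i : (i.+1 < n)%N by have := ltn_ord i; lia.
have E y : (val f y == i.+1 :> nat) = (y == g^-1%g (Ordinal lt_i)).
  rewrite fE -(inj_eq (@perm_inj _ g)) permKV -val_eqE /=; case: leqP => //= lt_gy.
  by rewrite eq_sym; apply/esym/eqP => gy; move: lt_gy; rewrite gy ltnNge ltn_ord.
rewrite E ffunE; case: pickP => [y /=|/(_ (g^-1%g (Ordinal lt_i)))]; rewrite E; first by move/eqP->.
by rewrite eqxx.
Qed.

End Hook.

(** * The column antisymmetriser of the hook *)

Section HookAntisymmetriser.

Variables (F : fieldType) (j q : nat).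
Local Notation n := (j.+1 + q)%N.
Local Notation tabloid := (tabloid n (hook j q)).
Local Notation base := (hook_base j q).
Local Notation act := (tabloid_action n (hook j q)).
Local Notation delta f := (delta_mx 0 (enum_rank f) : 'rV[F]_#|{: tabloid}|).
Implicit Types f : tabloid.

Lemma hook_column_stabiliser (s : 'S_n) :
  (s \in column_stabiliser base) = [forall x : 'I_n, if (x <= j)%N then (s x <= j)%N else s x == x].
Proof.
rewrite inE; apply: (@eq_forallb 'I_n) => x; rewrite /= !ffunE /hook_base_pos -2!val_eqE.
case: (leqP x j) => xj; case: (leqP (s x) j) => sxj //=.
- by apply/negbTE; rewrite -lt0n subn_gt0.
- by rewrite [LHS]eq_sym; apply/eqP/eqP; lia.
by apply/eqP/eqP; lia.
Qed.

Definition column_antisym : 'M[F]_#|{: tabloid}| :=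
  \sum_(s in column_stabiliser base) (-1) ^+ s *: action_mx F act s.

Definition row_incidence f : 'M[F]_j.+1 :=
  \matrix_(z, y) (val f (lshift q y) == z :> nat)%:R.

(** A signed sum over permutations is a determinant once membership in the column stabiliser and the
    equality of the two tabloids are expressed by vanishing entries. The resulting matrix is block
    diagonal. *)
Lemma column_antisym_det f f' :
  (delta f *m column_antisym) 0 (enum_rank f') =
  \det ((row_incidence f)^T *m row_incidence f') *
  \prod_(x < q) (val f' (rshift j.+1 x) == val f (rshift j.+1 x))%:R.
Proof.
pose N : 'M[F]_n := \matrix_(x, y) (if (x <= j)%N then (y <= j)%N && (val f' y == val f x)
                        else (y == x) && (val f' y == val f x))%:R.
transitivity (\det N).
  rewrite mulmx_sumr summxE big_mkcond /=; apply: eq_bigr => s _.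
  rewrite (eq_bigr (fun x : 'I_n => (if (x <= j)%N then (s x <= j)%N && (val f' (s x) == val f x)
                        else (s x == x) && (val f' (s x) == val f x))%:R)); last first.
    by move=> x _; rewrite mxE.
  rewrite hook_column_stabiliser -scalemxAr delta_action_mx !mxE /= (inj_eq enum_rank_inj).
  case: forallP => [Cs | nCs].
    congr (_ * _); rewrite eq_sym; case: (tabloid_act f s =P f') => [<- | ne].
      rewrite big1 // => x _; have := Cs x; rewrite /= !ffunE permK eqxx.
      by case: ifP => _ ->.
    apply/esym/eqP/prodf_eq0; have /existsP[x nx] : [exists x : 'I_n, val f' (s x) != val f x].
      apply: contra_notT ne => /existsPn ne; apply: val_inj; apply/ffunP=> x; rewrite ffunE.
      by have /negPn/eqP := ne (s^-1%g x); rewrite permKV.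
    by exists x => //; rewrite (negPf nx) !andbF if_same.
  have /existsP[x nx] : [exists x : 'I_n, ~~ (if (x <= j)%N then (s x <= j)%N else s x == x)].
    by apply/existsPn => nn; apply: nCs => x; apply/negPn.
  by rewrite (bigD1 x) //=; move: nx; case: ifP => _ /negPf->; rewrite mul0r mulr0.
pose D : 'rV[F]_q := \row_x (val f' (rshift j.+1 x) == val f (rshift j.+1 x))%:R.
have -> : N = block_mx ((row_incidence f)^T *m row_incidence f') 0 0 (diag_mx D).
  rewrite -[LHS]submxK; congr block_mx; apply/matrixP=> x y; rewrite !mxE /=.
  - have ltx : (val f (lshift q x) < j.+1)%N by rewrite ltnS hook_row_le.
    have le_ord (z : 'I_j.+1) : (z <= j)%N by rewrite -ltnS.
    rewrite !le_ord /= (bigD1 (Ordinal ltx)) //= !mxE eqxx mul1r.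
    rewrite big1 ?addr0 // => z; rewrite -val_eqE /= eq_sym => /negPf ne_z.
    by rewrite !mxE ne_z mul0r.
  - by rewrite -ltnS ltn_ord ltnNge leq_addr.
  - by rewrite leqNgt leq_addr /= -val_eqE /= ltn_eqF // (leq_trans (ltn_ord y)) // leq_addr.
  rewrite leqNgt leq_addr /= (inj_eq (@rshift_inj _ _)) eq_sym; case: eqP => [->|_] //=.
by rewrite det_ublock det_diag; congr (_ * _); apply: eq_bigr => x _; rewrite mxE.
Qed.

(** A leg entry of f beyond the first j + 1 entries would leave a zero row in the incidence
    matrix. *)
Lemma row_incidence_beyond f x : \det (row_incidence f) != 0 -> val f (rshift j.+1 x) = ord0.
Proof.
move=> nz_det; apply: val_inj => /=; case E: (val f _ : nat) => [//|i].
have lt_i : (i < j)%N by have := hook_row_le f (rshift j.+1 x); rewrite E.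
case/eqP: nz_det; have ltz : (i.+1 < j.+1)%N by [].
rewrite (expand_det_row _ (Ordinal ltz)) big1 // => y _; rewrite !mxE /=.
move/eqP: E; rewrite (legE f (Ordinal lt_i)) => /eqP E.
rewrite (legE f (Ordinal lt_i)) -E -val_eqE /= ltn_eqF ?mul0r //.
by rewrite (leq_trans (ltn_ord y)) // leq_addr.
Qed.

(** The antisymmetriser has rank one: it is e^T e for the base polytabloid e, which yields James's
    identity [column_antisym_mul]. *)
Lemma column_antisym_entry f f' :
  (delta f *m column_antisym) 0 (enum_rank f') =
  \det (row_incidence f) * \det (row_incidence f').
Proof.
rewrite column_antisym_det det_mulmx det_tr.
have [->|nz] := eqVneq (\det (row_incidence f)) 0; first by rewrite !mul0r.
have [->|nz'] := eqVneq (\det (row_incidence f')) 0; first by rewrite !mulr0 mul0r.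
by rewrite big1 ?mulr1 // => x _; rewrite !row_incidence_beyond // eqxx.
Qed.

Lemma polytabloid_base :
  polytabloid F base = delta (tabloid_of base) *m column_antisym.
Proof.
rewrite mulmx_sumr; apply: eq_bigr => s _; rewrite -scalemxAr delta_action_mx.
by congr (_ *: delta_mx 0 (enum_rank _)); apply: val_inj; rewrite /= rows_relabel.
Qed.

Lemma polytabloid_base_entry f :
  polytabloid F base 0 (enum_rank f) = \det (row_incidence f).
Proof.
rewrite polytabloid_base column_antisym_entry; set A := row_incidence (tabloid_of base).
have -> : A = 1%:M; last by rewrite det1 mul1r.
apply/matrixP=> z y; rewrite !mxE /= !ffunE /hook_base_pos /= -ltnS ltn_ord /=.
by rewrite eq_sym.
Qed.

Lemma column_antisym_mul (v : 'rV[F]_#|{: tabloid}|) :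
  v *m column_antisym = (v *m (polytabloid F base)^T) 0 0 *: polytabloid F base.
Proof.
apply/rowP=> k; rewrite -[k]enum_valK !mxE mulr_suml.
apply: eq_bigr => l _; rewrite -[l]enum_valK mxE !polytabloid_base_entry -mulrA.
by rewrite -column_antisym_entry -rowE mxE.
Qed.

End HookAntisymmetriser.

Lemma prime_ndvd_fact p m : prime p -> (m < p)%N -> ~~ (p %| m`!)%N.
Proof.
move=> p_pr; elim: m => [|m IHm] lt_m; first by rewrite fact0 dvdn1 gtn_eqF ?prime_gt1.
by rewrite factS Euclid_dvdM // negb_or IHm ?(ltnW lt_m) // gtnNdvd.
Qed.

(** * Spanning forms and their Gram matrix *)

Section HookForms.

Variables (F : fieldType) (j q : nat).
Local Notation n := (j.+1 + q)%N.
Local Notation tabloid := (tabloid n (hook j q)).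
Local Notation base := (hook_base j q).
Local Notation act := (tabloid_action n (hook j q)).
Local Notation S := (specht_mx F n (hook j q)).
Implicit Types (f : tabloid) (a b : {ffun 'I_j -> 'I_n}).

(** Its rows are the differences e_z - e_0. The Specht module of the hook is the j-th exterior power
    of the module they span, and the minors below are the coordinates of their wedge products. *)
Definition leg_diff : 'M[F]_n := 1%:M - (const_mx 1 : 'cV_n) *m (delta_mx 0 ord0 : 'rV_n).
Local Notation D := leg_diff.

Lemma leg_diffE z y : D z y = (z == y)%:R - (ord0 == y)%:R.
Proof. by rewrite !mxE big_ord1 !mxE mul1r eqxx [_ == ord0]eq_sym. Qed.

Lemma leg_diff0 y : D ord0 y = 0.
Proof. by rewrite leg_diffE subrr. Qed.

Lemma minor_leg_diff0 a b i : a i = ord0 -> minor D a b = 0.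
Proof.
move=> ai0; rewrite /minor (expand_det_row _ i) big1 // => y _.
by rewrite mxE ai0 leg_diff0 mul0r.
Qed.

(* These vectors, indexed by all the functions [a], span the Specht module.  The
   polytabloids span it too, but for this family the Cauchy-Binet formula makes
   the Gram matrix a scalar multiple of an idempotent. *)
Definition hook_forms : 'M[F]_(#|{: {ffun 'I_j -> 'I_n}}|, #|{: tabloid}|) :=
  \matrix_(u, v) minor D (enum_val u) (leg (enum_val v)).

(** An entry lies in exactly one row of f, so the columns of the incidence matrix sum to 1 and
    [det_col_sums1] applies. *)
Lemma hook_polytabloid_det (g : 'S_n) f :
  polytabloid F (tableau_act base g) 0 (enum_rank f) =
  \det (\matrix_(x < j.+1, y < j.+1)
          if unlift ord0 x is Some i then D (g (lshift q y)) (leg f i) else 1).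
Proof.
rewrite -polytabloid_act action_mx_entry polytabloid_base_entry.
set A : 'M_(1 + j) := row_incidence _ _.
have AE x y : A x y = (val f (g (lshift q y)) == x :> nat)%:R.
  by rewrite !mxE /= ffunE invgK.
rewrite (det_col_sums1 (\col_i (ord0 == leg f i)%:R)) => [|y]; last first.
  have lty : (val f (g (lshift q y)) < 1 + j)%N by rewrite ltnS hook_row_le.
  rewrite (bigD1 (Ordinal lty)) //= AE eqxx big1 ?addr0 // => x.
  by rewrite AE -val_eqE /= eq_sym => /negPf->.
have un i : unlift ord0 (rshift 1 i) = Some i.
  have -> : rshift 1 i = lift ord0 i by apply: val_inj.
  by rewrite liftK.
congr (\det _); apply/matrixP=> x y; rewrite [RHS]mxE.
case: (split_ordP x) => i ->; last rewrite un leg_diffE -legE.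
  have -> : unlift ord0 (lshift j i) = None.
    by rewrite (_ : lshift j i = ord0) ?unlift_none //; apply: val_inj; rewrite /= ord1.
  by case: (split_ordP y) => k ->; rewrite ?block_mxEul ?block_mxEur !mxE ?ord1.
case: (split_ordP y) => k ->; rewrite ?block_mxEdl ?block_mxEdr.
  by rewrite 3!mxE AE !mxE.
by rewrite 3!mxE AE !mxE big_ord1 !mxE mulr1.
Qed.

Definition leg_choice (g : 'S_n) (y : 'I_j.+1) : {ffun 'I_j -> 'I_n} :=
  [ffun k => g (lshift q (lift y k))].

Lemma hook_polytabloid_expand (g : 'S_n) :
  polytabloid F (tableau_act base g) =
  \sum_(y < j.+1) (-1) ^+ y *: row (enum_rank (leg_choice g y)) hook_forms.
Proof.
apply/rowP=> v; rewrite -[v]enum_valK hook_polytabloid_det summxE.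
rewrite (expand_det_row _ ord0); apply: eq_bigr => y _.
rewrite !mxE unlift_none mul1r /cofactor add0n !enum_rankK; congr (_ * _).
rewrite /minor -det_tr; congr (\det _); apply/matrixP=> x k.
rewrite [LHS]mxE [LHS]mxE [LHS]mxE [LHS]mxE [RHS]mxE liftK.
by rewrite [leg_choice g y x]ffunE.
Qed.

Lemma hook_forms_sub : (hook_forms <= S)%MS.
Proof.
apply/row_subP=> u; rewrite -[u]enum_valK; set a := enum_val u.
have rowE v : row (enum_rank a) hook_forms 0 v = minor D a (leg (enum_val v)).
  by rewrite !mxE enum_rankK.
have [/existsP[i /eqP ai]|/existsPn a_neq0] := boolP [exists i, a i == ord0].
  rewrite (_ : row _ _ = 0) ?sub0mx //; apply/rowP=> v.
  by rewrite rowE (minor_leg_diff0 _ ai) mxE.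
have [a_inj|/injectivePn[x [y ne_xy axy]]] := boolP (injectiveb a); last first.
  rewrite (_ : row _ _ = 0) ?sub0mx //; apply/rowP=> v.
  by rewrite rowE (minor_perml _ _ ne_xy axy) mxE.
(* With 0 in the corner of the tableau, every term of the expansion but the first involves row 0 of
   D, which is zero; the form of a is thus a polytabloid. *)
pose h y := if unlift (@ord0 j) y is Some i then a i else ord0.
have h_inj : injective h.
  move=> x y; rewrite /h; case: unliftP => [x'|] ->; case: unliftP => [y'|] -> //.
  - by move/(injectiveP _ a_inj)->.
  - by move/eqP; rewrite (negPf (a_neq0 _)).
  - by move/esym/eqP; rewrite (negPf (a_neq0 _)).
have [g gE] := perm_extend (@lshift_inj j.+1 q) h_inj.
have := hook_polytabloid_expand g; rewrite big_ord_recl expr0 scale1r.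
rewrite big1 => [|y _]; last first.
  pose k0 := Ordinal (leq_ltn_trans (leq0n y) (ltn_ord y)).
  apply/rowP=> v; rewrite !mxE enum_rankK (@minor_leg_diff0 _ _ k0) ?mulr0 //.
  rewrite ffunE gE /h; have -> : lift (lift ord0 y) k0 = ord0 by apply: val_inj.
  by rewrite unlift_none.
rewrite addr0; have -> : leg_choice g ord0 = a.
  by apply/ffunP=> k; rewrite ffunE gE /h liftK.
by move <-; rewrite (sumsmx_sup (tableau_act base g)) ?genmxE.
Qed.

Lemma specht_forms : (S :=: hook_forms)%MS.
Proof.
apply/eqmxP; rewrite hook_forms_sub andbT; apply/sumsmx_subP=> t _.
have [g ->] := hook_tableau t; rewrite genmxE hook_polytabloid_expand.
by apply: summx_sub => y _; rewrite scalemx_sub ?row_sub.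
Qed.

Lemma leg_onto b : injective b -> exists f : tabloid, leg f = b.
Proof.
move=> b_inj; have h_inj : injective (fun i : 'I_j => lshift q (lift ord0 i)).
  by move=> i i' /lshift_inj/lift_inj.
have [g gE] := perm_extend h_inj b_inj.
exists (tabloid_of (tableau_act base g)); apply/ffunP=> i; apply/esym/eqP; rewrite -legE.
by rewrite /= !ffunE -gE permK /hook_base_pos /= ltn_ord.
Qed.

Lemma leg_injective : injective (fun f : tabloid => leg f).
Proof.
move=> f f' ff'; apply: val_inj; apply/ffunP=> x; apply: val_inj => /=.
have rowE (f1 f2 : tabloid) k : leg f1 = leg f2 -> val f1 x = k.+1 :> nat -> val f2 x = k.+1 :> nat.
  move=> f12 f1k; have lt_k : (k < j)%N by have := hook_row_le f1 x; rewrite f1k.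
  by apply/eqP; rewrite (legE _ (Ordinal lt_k)) -f12 -legE f1k.
case E: (val f x : nat) => [|k]; last by rewrite (rowE f f' k).
by case E': (val f' x : nat) => [//|k]; rewrite (rowE f' f k) in E.
Qed.

Definition leg_gram : 'M[F]_n := D *m D^T.

(** Cauchy-Binet sums over all functions, but those that are not legs of tabloids are not injective
    and give 0. *)
Lemma hook_gram a a' :
  (hook_forms *m hook_forms^T) (enum_rank a) (enum_rank a') = (j`!)%:R * minor leg_gram a a'.
Proof.
rewrite -Cauchy_Binet mxE (reindex (@enum_rank tabloid)) /=; last exact/onW_bij/enum_rank_bij.
pose F0 b := minor D a b * minor D^T b a'.
rewrite (eq_bigr (fun f : tabloid => F0 (leg f))) => [|f _]; last first.
  by rewrite !mxE !enum_rankK /F0 minor_tr.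
rewrite [RHS](bigID (mem [set leg f | f : tabloid])) /= [X in _ = _ + X]big1 ?addr0.
  by rewrite big_imset //= => f f' _ _; apply: leg_injective.
move=> b; apply: contraNeq; rewrite /F0 => nz.
have [|f <-] := @leg_onto b; last exact: imset_f.
apply/injectiveP; apply: contraR nz => /injectivePn[x [y ne_xy bxy]].
by rewrite (minor_permr _ _ ne_xy bxy) mul0r.
Qed.

Section Characteristic.

Hypothesis charF : n \in [pchar F].

(** With u the column of ones, D u = 0 and u^T u = n = 0. Hence D^T D is the identity up to terms
    killed by D on the left or by D^T on the right. *)
Lemma leg_gram_idem : leg_gram *m leg_gram = leg_gram.
Proof.
pose u : 'M[F]_(n, 1) := const_mx 1; pose o : 'M[F]_(1, n) := delta_mx 0 ord0.
have ou : o *m u = 1%:M by rewrite -rowE; apply/rowP=> k; rewrite !ord1 !mxE eqxx.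
have Du : D *m u = 0 by rewrite mulmxBl mul1mx -mulmxA ou mulmx1 subrr.
have uu : u^T *m u = 0.
  apply/rowP=> k; rewrite !mxE (eq_bigr (fun=> 1)) => [|z _]; last by rewrite !mxE mulr1.
  by rewrite sumr_const card_ord (pcharf0 charF).
have E : D^T *m D = 1%:M - u *m o - o^T *m u^T.
  have -> : D^T = 1%:M - o^T *m u^T by rewrite /leg_diff raddfB /= trmx1 trmx_mul.
  rewrite -[D]/(1%:M - u *m o) mulmxBl mul1mx mulmxBr mulmx1.
  by rewrite mulmxA -(mulmxA o^T) uu mulmx0 mul0mx subr0.
rewrite /leg_gram mulmxA -(mulmxA D D^T) E 2!mulmxBr mulmx1 2!mulmxBl.
rewrite (mulmxA D u) Du mul0mx mul0mx subr0 -mulmxA -(mulmxA o^T) -trmx_mul Du.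
by rewrite linear0 !mulmx0 subr0.
Qed.

Lemma fact_neq0 : (j`!)%:R != 0 :> F.
Proof.
by rewrite -(dvdn_pcharf charF) prime_ndvd_fact ?(pcharf_prime charF) // ltnS leq_addr.
Qed.

(** The factors are n - (i+1), each equal to -(i+1) in F. *)
Lemma ffact_char : ((j + q) ^_ j)%:R = (-1) ^+ j * (j`!)%:R :> F.
Proof.
rewrite ffact_prod fact_prod big_add1 big_mkord !natr_prod -[j in _ ^+ j]card_ord -prodr_const.
rewrite -big_split /=; apply: eq_bigr => i _; rewrite mulN1r; apply/eqP.
rewrite -subr_eq0 opprK -natrD; have -> : (j + q - i + i.+1 = n)%N by have := ltn_ord i; lia.
by rewrite (pcharf0 charF).
Qed.

(** Off the index 0, D D^T is the identity plus the all-ones matrix. *)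
Lemma leg_gram_minor a :
  minor leg_gram a a = if [forall i, a i != ord0] && injectiveb a then j.+1%:R else 0.
Proof.
case: andP => [[/forallP a_neq0 /injectiveP a_inj] | na].
  rewrite -det_add_const1; congr (\det _); apply/matrixP=> x y; rewrite !mxE.
  rewrite (eq_bigr (fun z => (z == a y)%:R * (a x == z)%:R - (z == ord0)%:R * (a x == z)%:R
     - (z == a y)%:R * (ord0 == z)%:R + (z == ord0)%:R * (ord0 == z)%:R)) => [|z _]; last first.
    by rewrite [D^T _ _]mxE !leg_diffE [a y == z]eq_sym [z == ord0]eq_sym; ring.
  have sumE (z1 z2 : 'I_n) : \sum_z (z == z1)%:R * (z2 == z)%:R = (z2 == z1)%:R :> F.
    by rewrite (bigD1 z1) //= eqxx mul1r big1 ?addr0 // => z /negPf->; rewrite mul0r.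
  rewrite big_split /= !sumrB !sumE (inj_eq a_inj) (negPf (a_neq0 x)).
  by rewrite [ord0 == _]eq_sym (negPf (a_neq0 y)) eqxx !subr0.
have [/existsP[i /eqP ai]|/existsPn a_neq0] := boolP [exists i, a i == ord0].
  rewrite /minor (expand_det_row _ i) big1 // => y _; rewrite !mxE big1 ?mul0r // => z _.
  by rewrite ai leg_diff0 mul0r.
have [a_inj|/injectivePn[x [y ne_xy axy]]] := boolP (injectiveb a); last first.
  exact: minor_perml ne_xy axy.
by case: na; split=> //; apply/forallP.
Qed.

(** A second use of Cauchy-Binet gives Q^2 = (j!)^2 Q. The trace of Q is j! (j+1) times the number
    of injective functions avoiding 0, which [ffact_char] evaluates in F. *)
Lemma hook_gram_rank :
  (\rank (hook_forms *m hook_forms^T))%:R = (-1) ^+ j * j.+1%:R :> F.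
Proof.
set Q := hook_forms *m _; have fact0 := fact_neq0.
have QE u v : Q u v = (j`!)%:R * minor leg_gram (enum_val u) (enum_val v).
  by rewrite -hook_gram !enum_valK.
have QQ : Q *m Q = (j`!)%:R ^+ 2 *: Q.
  apply/matrixP=> u v; rewrite [LHS]mxE [RHS]mxE QE -[X in minor X _ _]leg_gram_idem -Cauchy_Binet.
  rewrite (reindex (@enum_rank {ffun 'I_j -> 'I_n})) /=; last exact/onW_bij/enum_rank_bij.
  by rewrite mulr_sumr; apply: eq_bigr => b _; rewrite !QE enum_rankK; ring.
pose P := (j`!)%:R ^- 2 *: Q.
have PP : P *m P = P.
  by rewrite -scalemxAl -scalemxAr QQ !scalerA mulfVK // expf_neq0.
have -> : \rank Q = \rank P by rewrite mxrank_scale_nz // invr_eq0 expf_neq0.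
rewrite -idempotent_trace // mxtraceZ /mxtrace.
rewrite (reindex (@enum_rank {ffun 'I_j -> 'I_n})) /=; last exact/onW_bij/enum_rank_bij.
rewrite (eq_bigr (fun a => (j`!)%:R * minor leg_gram a a)) => [|a _]; last by rewrite QE enum_rankK.
rewrite -mulr_sumr; under eq_bigr do rewrite leg_gram_minor; rewrite -big_mkcond sumr_const.
have -> : #|[pred a : {ffun 'I_j -> 'I_n} | [forall i, a i != ord0] && injectiveb a]| = ((j + q) ^_ j)%N.
  have <- : (#|predC1 (ord0 : 'I_n)| ^_ #|'I_j| = (j + q) ^_ j)%N by rewrite cardC1 !card_ord.
  rewrite -card_inj_ffuns_on; apply: eq_card => a; rewrite !inE; congr (_ && _).
rewrite -[_ *+ ((j + q) ^_ j)]mulr_natl ffact_char; move: fact0; clear; move: (j`!)%:R => c nz_c.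
by field.
Qed.

Lemma hook_gram_neq0 : (0 < q)%N -> (\rank (hook_forms *m hook_forms^T))%:R != 0 :> F.
Proof.
move=> q_gt0; rewrite hook_gram_rank mulf_neq0 ?signr_eq0 //.
by rewrite -(dvdn_pcharf charF) gtnNdvd // -[X in (X < _)%N]addn0 ltn_add2l.
Qed.

End Characteristic.

End HookForms.

(** * James's submodule argument *)

Section HookHead.

Variables (F : fieldType) (j q : nat).
Local Notation n := (j.+1 + q)%N.
Local Notation base := (hook_base j q).
Local Notation act := (tabloid_action n (hook j q)).
Local Notation S := (specht_mx F n (hook j q)).
Local Notation E := (hook_forms F j q).
Local Notation Sp := (specht F n (hook j q)).

Hypothesis charF : n \in [pchar F].
Hypothesis q_gt0 : (0 < q)%N.

(** As the forms span the Specht module, the kernel of this pairing is the radical of its bilinear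
    form. *)
Definition hook_form : 'M[F]_(rdegree Sp, _) := row_base S *m E^T.
Local Notation Gam := hook_form.

Lemma hook_form_rank : \rank Gam = \rank (E *m E^T).
Proof. by apply/eqmx_rank/eqmxP/eqmxMr/eqmx_trans/specht_forms/eq_row_base. Qed.

Lemma row_base_specht g : row_base S *m action_mx F act g = Sp g *m row_base S.
Proof.
have := val_submodJ (specht_module F n (hook j q)) 1%:M (in_setT g).
by rewrite mul1mx /val_submod /= mul1mx => <-.
Qed.

Lemma hook_form_ker_module : mxmodule Sp (kermx Gam).
Proof.
apply/mxmoduleP=> g _; apply/sub_kermxP.
have /submxP[X EX] : (E *m action_mx F act g^-1%g <= E)%MS.
  rewrite -(eqmxMr _ (specht_forms F j q)) -specht_forms.
  exact: (mxmoduleP (specht_module F n (hook j q)) _ (in_setT _)).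
have GE : Sp g *m Gam = Gam *m X^T.
  rewrite /hook_form mulmxA -row_base_specht -[LHS]mulmxA -[RHS]mulmxA; congr (_ *m _).
  by rewrite -trmx_mul -EX trmx_mul action_mx_tr invgK.
by rewrite -mulmxA GE mulmxA mulmx_ker mul0mx.
Qed.

(** A submodule outside the kernel pairs nontrivially with some polytabloid, after translation with
    the base one. The antisymmetriser then puts the base polytabloid into it, and the translates of
    that one span everything. *)
Lemma hook_form_ker_max (U : 'M[F]_(rdegree Sp)) :
  mxmodule Sp U -> ~~ (U <= kermx Gam)%MS -> row_full U.
Proof.
move=> modU nU; pose V := U *m row_base S.
have modV g : (V *m action_mx F act g <= V)%MS.
  rewrite -mulmxA row_base_specht mulmxA submxMr //.
  exact: (mxmoduleP modU _ (in_setT _)).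
have VE0 : V *m E^T != 0.
  by apply: contra nU => /eqP; rewrite -mulmxA => VE; apply/sub_kermxP.
have [t Vt] : exists t, V *m (polytabloid F t)^T != 0.
  apply: contrapT => nt; case/eqP: VE0; apply: trmx_inj; rewrite trmx_mul trmxK trmx0.
  apply/sub_kermxP; rewrite -specht_forms; apply/sumsmx_subP=> t _; rewrite genmxE.
  apply/sub_kermxP; apply: trmx_inj; rewrite trmx_mul trmxK trmx0.
  by apply: contrapT => /eqP Vt; apply: nt; exists t.
have [g tE] := hook_tableau t; move: Vt; rewrite {}tE -polytabloid_act trmx_mul action_mx_tr mulmxA.
set W := V *m _ => We.
have sWV : (W <= V)%MS by apply: modV.
have [i Wi] : exists i, row i W *m (polytabloid F base)^T != 0.
  apply: contrapT => nt; case/eqP: We; apply/row_matrixP=> i; rewrite row_mul row0.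
  by apply: contrapT => /eqP Wi; apply: nt; exists i.
have sbV : (polytabloid F base <= V)%MS.
  have nz : (row i W *m (polytabloid F base)^T) 0 0 != 0.
    by apply: contra Wi => /eqP z; apply/eqP/rowP=> k; rewrite !ord1 z mxE.
  rewrite -(eqmx_scale _ nz) -column_antisym_mul mulmx_sumr.
  apply: summx_sub => s _; rewrite -scalemxAr scalemx_sub //.
  apply: submx_trans (modV s); apply: submxMr; apply: submx_trans sWV; exact: row_sub.
have sSV : (row_base S <= V)%MS.
  rewrite eq_row_base; apply/sumsmx_subP=> t' _; rewrite genmxE.
  have [g' ->] := hook_tableau t'; rewrite -polytabloid_act.
  exact: submx_trans (submxMr _ sbV) (modV g').
have /submxP[h] := sSV; rewrite mulmxA -[LHS]mul1mx => /(row_free_inj (row_base_free S)) hU.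
by apply/row_fullP; exists h.
Qed.

Lemma hook_head_simple :
  simple_module (head_module Sp) /\
  (rdegree (head_module Sp))%:R = (-1) ^+ j * j.+1%:R :> F.
Proof.
have Gam0 : Gam != 0.
  rewrite -mxrank_eq0 hook_form_rank; apply: contraTneq (hook_gram_neq0 charF q_gt0) => ->.
  by rewrite eqxx.
have [simpleD ->] := head_simple Gam0 hook_form_ker_module hook_form_ker_max.
by rewrite hook_form_rank hook_gram_rank.
Qed.

End HookHead.

Lemma hook_D_simple (F : fieldType) p j : p \in [pchar F] -> (j < p.-1)%N ->
  simple_module (hook_D F p j) /\ (rdegree (hook_D F p j))%:R = (-1) ^+ j * j.+1%:R :> F.
Proof.
move=> charFp lt_j; have [q pE] : exists q, p = (j.+1 + q.+1)%N by exists (p - j.+2)%N; lia.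
by rewrite {}pE in charFp *; apply: (@hook_head_simple _ _ q.+1).
Qed.

(** * The symmetric group of prime degree *)

Lemma natr_inj_char (F : fieldType) p m k : p \in [pchar F] ->
  m%:R = k%:R :> F -> m = k %[mod p].
Proof.
move=> charFp; wlog le_mk : m k / (m <= k)%N => [IH mk|].
  by case: (leqP m k) => [/IH|/ltnW/IH]; [apply | move=> E; rewrite E].
move=> mk; apply/esym/eqP; rewrite eqn_mod_dvd // (dvdn_pcharf charFp).
by rewrite natrB // mk subrr.
Qed.

(** F may be larger than the prime field, and a must serve as an exponent of c. *)
Lemma primitive_nat (F : fieldType) p : p \in [pchar F] ->
  exists a, p.-1.-primitive_root (a%:R : F).
Proof.
move=> charFp; have p_pr := pcharf_prime charFp; have p_gt1 := prime_gt1 p_pr.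
pose rs : seq F := [seq s%:R | s <- iota 1 p.-1].
suff /hasP[z /mapP[a _ ->] pz] : has p.-1.-primitive_root rs by exists a.
apply: has_prim_root; rewrite ?size_map ?size_iota //; first by rewrite -ltnS prednK ?prime_gt0.
  apply/allP=> z /mapP[s]; rewrite mem_iota => /andP[s_gt0 lt_s] ->.
  have nz_s : s%:R != 0 :> F by rewrite -(dvdn_pcharf charFp) gtnNdvd //; lia.
  apply/unity_rootP/(mulfI nz_s); rewrite mulr1 -exprS prednK ?prime_gt0 //.
  rewrite -natrX -(GRing.natr_mod_pchar charFp) fermat_little //.
  by rewrite GRing.natr_mod_pchar.
rewrite map_inj_in_uniq ?iota_uniq // => s t; rewrite !mem_iota => sP tP.
by move=> /(natr_inj_char charFp); rewrite !modn_small //; lia.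
Qed.

Section SymmetricGroup.

Variables (F : fieldType) (p a : nat).
Hypothesis charFp : p \in [pchar F].
Hypothesis a_prim : p.-1.-primitive_root (a%:R : F).

Fact Sp_prime : prime p. Proof. exact: pcharf_prime charFp. Qed.
Fact Sp_gt0 : (0 < p)%N. Proof. exact: prime_gt0 Sp_prime. Qed.
Local Hint Resolve Sp_prime Sp_gt0 : core.

Definition Sp_cycle : 'S_p := perm (@ordS_inj p).
Local Notation c := Sp_cycle.

Lemma Sp_scale_inj : injective (fun x : 'I_p => Ordinal (ltn_pmod (a * x) Sp_gt0)).
Proof.
have nz_a : a%:R != 0 :> F by rewrite (prim_root_eq0 a_prim) -lt0n -ltnS prednK ?prime_gt1.
move=> x y /(congr1 val)/= /(congr1 (fun k => k%:R : F)).
rewrite !(GRing.natr_mod_pchar charFp) !natrM => /(mulfI nz_a).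
by move/(natr_inj_char charFp); rewrite !modn_small // => /val_inj.
Qed.

Definition Sp_scale : 'S_p := perm Sp_scale_inj.
Local Notation h := Sp_scale.

Lemma Sp_cycleX k x : (c ^+ k)%g x = ((x + k) %% p)%N :> nat.
Proof.
elim: k => [|k IHk]; first by rewrite expg0 perm1 addn0 modn_small.
by rewrite expgSr permM permE /= IHk -addn1 modnDml addn1 addnS.
Qed.

Lemma Sp_scaleX k x : (h ^+ k)%g x = ((a ^ k * x) %% p)%N :> nat.
Proof.
elim: k => [|k IHk]; first by rewrite expg0 perm1 mul1n modn_small.
by rewrite expgSr permM permE /= IHk modnMmr mulnA expnS.
Qed.

Lemma Sp_cycle_order : #[c]%g = p.
Proof.
apply: nt_prime_order => //.
  by apply/permP=> x; apply: val_inj; rewrite /= Sp_cycleX perm1 modnDr modn_small.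
apply/eqP=> /permP/(_ (Ordinal Sp_gt0))/(congr1 val); rewrite permE perm1 /=.
by rewrite modn_small // prime_gt1.
Qed.

Lemma Sp_cycle_index : ~~ (p %| #|[set: 'S_p] : <[c]>|%g)%N.
Proof.
have := Lagrange (subsetT <[c]>%G); rewrite /= -orderE Sp_cycle_order cardsT card_Sn.
have -> : (p`! = p * p.-1`!)%N by case: (p) Sp_gt0.
move/eqP; rewrite eqn_pmul2l // => /eqP->.
by apply: prime_ndvd_fact => //; rewrite prednK.
Qed.

Lemma Sp_scale_cycle m : (c ^ (h ^+ m) = c ^+ (a ^ m))%g.
Proof.
apply: (mulgI (h ^+ m)%g); rewrite -conjgC; apply/permP=> x; apply: val_inj.
rewrite /= !permM -[c in LHS]expg1 Sp_scaleX !Sp_cycleX Sp_scaleX modnMmr modnDml.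
by rewrite mulnDr muln1.
Qed.

Lemma Sp_scale_order : (h ^+ p.-1 = 1)%g.
Proof.
apply/permP=> x; apply: val_inj; rewrite /= Sp_scaleX perm1.
have /(natr_inj_char charFp) E : (a ^ p.-1)%:R = 1%:R :> F by rewrite natrX (prim_expr_order a_prim).
by rewrite -modnMml E modnMml mul1n modn_small.
Qed.

(** An element g of the normaliser raises c to a power u, which is a power of a modulo p. Dividing
    by a power of h leaves an element commuting with the p-cycle c; such an element is determined by
    the image of 0, so it is a power of c. *)
Lemma Sp_normaliser : ('N_[set: 'S_p](<[c]>) \subset <[c]> * <[h]>)%g.
Proof.
apply/subsetP=> g /setIP[_ /normP Ng].
have : (c ^ g \in <[c]> :^ g)%g by rewrite memJ_conjg cycle_id.
rewrite Ng => /cycleP[u cgu].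
have nz_u : u%:R != 0 :> F.
  rewrite -(dvdn_pcharf charFp) -Sp_cycle_order order_dvdn -cgu conjg_eq1.
  by rewrite -order_eq1 Sp_cycle_order gtn_eqF ?prime_gt1.
have /(prim_rootP a_prim)[m um] : u%:R ^+ p.-1 = 1 :> F.
  apply: (mulfI nz_u); rewrite mulr1 -exprS prednK // -natrX -(GRing.natr_mod_pchar charFp).
  by rewrite fermat_little // GRing.natr_mod_pchar.
pose y := (g * (h ^+ m)^-1)%g; have cy : (c ^ y = c)%g.
  rewrite conjgM cgu; have -> : (c ^+ u = c ^ (h ^+ m))%g.
    rewrite Sp_scale_cycle; apply/eqP; rewrite eq_expg_mod_order Sp_cycle_order.
    by apply/eqP/(natr_inj_char charFp); rewrite um natrX.
  by rewrite conjgK.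
pose o := Ordinal Sp_gt0; have yE : y = (c ^+ y o)%g.
  apply/permP=> x; have -> : x = (c ^+ x)%g o by apply: val_inj;
    rewrite /= Sp_cycleX add0n modn_small.
  rewrite -[LHS]permM conjgC conjXg cy permM; apply: val_inj.
  by rewrite /= !Sp_cycleX modnDml add0n addnC.
have -> : g = (y * h ^+ m)%g by rewrite mulgKV.
by rewrite mem_mulg ?mem_cycle // yE mem_cycle.
Qed.

End SymmetricGroup.

(** c^-1 - 1 is c - 1 times the unit -c^-1, which commutes with it, and transposition preserves
    ranks. *)
Lemma phi_dual (F : fieldType) p (gT : finGroupType) (G : {group gT}) (c : gT)
    (R : realType) (M : representation F G) :
  c \in G -> (1 < p)%N -> phi p c R (dual_module M) = phi p c R M.
Proof.
move=> Gc p_gt1; apply: eq_qsum => // i _; congr (_%:R); rewrite /rk.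
have VK : M c *m M c^-1%g = 1%:M by rewrite -repr_mxM ?groupV // mulgV repr_mx1.
have KV : M c^-1%g *m M c = 1%:M by rewrite -repr_mxM ?groupV // mulVg repr_mx1.
pose A := - M c^-1%g; have Au : A \in unitmx.
  by have /mulmx1_unit[] : A *m - M c = 1%:M by rewrite mulNmx mulmxN opprK.
have -> : nil_mx c (dual_module M) = (A *m nil_mx c M)^T.
  by rewrite /nil_mx /= mulNmx mulmxBr KV mulmx1 opprB raddfB /= trmx1.
have trX m (X : 'M[F]_m) k : X^T ^+ k = (X ^+ k)^T.
  elim: k => [|k IHk]; first by rewrite !expr0 trmx1.
  by rewrite exprS IHk exprSr; apply/esym/trmx_mul.
have cA : GRing.comm A (nil_mx c M).
  by rewrite /GRing.comm /nil_mx /A mulrBr mulrBl !mulNr mulrN mulr1 mul1r -!mulmxE KV VK.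
have Aiu : A ^+ i \in unitmx.
  by elim: i => [|k IHk]; rewrite ?expr0 ?unitmx1 // exprS -mulmxE unitmx_mul Au.
rewrite trX mxrank_tr -[A *m _]/(A * _) exprMn_comm // -mulmxE.
by rewrite eqmxMfull ?row_full_unit.
Qed.

Section HookFamily.

Variables (F : closedFieldType) (p a : nat).
Hypothesis charFp : p \in [pchar F].
Hypothesis a_prim : p.-1.-primitive_root (a%:R : F).
Local Notation c := (Sp_cycle p).
Local Notation h := (Sp_scale charFp a_prim).

Lemma hook_D_not_cfree (j : 'I_p.-1) : ~~ cfree p (nil_mx c (hook_D F p j)).
Proof.
have p_pr := pcharf_prime charFp; have p_gt0 := prime_gt0 p_pr.
have [_ dimD] := hook_D_simple charFp (ltn_ord j).
apply/negP=> freeD; have /negP[] : (rdegree (hook_D F p j))%:R != 0 :> F.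
  rewrite dimD mulf_neq0 ?signr_eq0 // -(dvdn_pcharf charFp) gtnNdvd //.
  by rewrite -ltn_predRL.
rewrite -(rk0 (nil_mx c (hook_D F p j))).
rewrite (cfree_rk p_gt0 (nil_mxp charFp (in_setT c) (Sp_cycle_order charFp) _) freeD) // subn0.
by rewrite natrM (pcharf0 charFp) mul0r.
Qed.

Lemma hook_D_blk (j : 'I_p.-1) : blk p (nil_mx c (hook_D F p j)) = 1%N.
Proof.
have [Dsimple dimD] := hook_D_simple charFp (ltn_ord j).
apply: (endo_scalar_blk1 charFp (in_setT c) (Sp_cycle_order charFp)
  (Sp_cycle_index charFp) (in_setT h) (Sp_scale_cycle charFp a_prim 1)
  (Sp_scale_order charFp a_prim) a_prim (Sp_normaliser charFp a_prim)).
  by move=> e; apply: simple_endo_scalar.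
exact: hook_D_not_cfree.
Qed.

Lemma hook_D_gen (j : 'I_p.-1) : exists k x,
  generates (nil_mx c (hook_D F p j)) k x /\ (k = j.+1 \/ k = p - j.+1)%N.
Proof.
have p_pr := pcharf_prime charFp; have p_gt0 := prime_gt0 p_pr.
have [_ dimD] := hook_D_simple charFp (ltn_ord j).
have [k [x [kP Dx]]] := not_cfree_generates p_gt0 (hook_D_not_cfree j).
exists k, x; split=> //.
have := blk1_rk p_gt0 (nil_mxp charFp (in_setT c) (Sp_cycle_order charFp) _)
  kP Dx (hook_D_blk j) (leq0n p).
rewrite rk0 !subn0 => /(congr1 (fun m => m%:R : F)).
(* In F the free part drops out of the dimension, leaving k = (-1)^j (j + 1). *)
rewrite dimD natrD natrM (pcharf0 charFp) mul0r add0r -signr_odd.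
have lt_j : (j.+1 < p)%N by rewrite -ltn_predRL.
case/andP: kP => k_gt0 lt_k; case: (odd j); rewrite ?expr1 ?expr0 ?mulN1r ?mul1r => E.
  right; have : k%:R = (p - j.+1)%:R :> F.
    by rewrite natrB 1?ltnW // (pcharf0 charFp) sub0r E.
  by move/(natr_inj_char charFp); rewrite !modn_small // ltn_subrL p_gt0.
by left; move/(natr_inj_char charFp): E; rewrite !modn_small.
Qed.

End HookFamily.

Theorem theorem6p4 (R : realType) (F : closedFieldType) (p : nat)
    (charFp : p \in [pchar F]) :
  let module := representation F [set: 'S_p]%G in
  let gamma : module -> R := @bs_gamma F _ [set: 'S_p]%G R in
  let value (j : nat) : R := sin (j.+1%:R * pi / p%:R) / sin (pi / p%:R) in
  [/\ forall (i : int) (j : 'I_p.-1), gamma (heller i (hook_D F p j)) = value j,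
      [/\ forall M N : module, gamma (dadd_grepr M N) = gamma M + gamma N,
          forall M N : module, gamma (tensor M N) = gamma M * gamma N &
          forall M : module,
            exists (P : module) (s : seq (int * 'I_p.-1)),
              [/\ projective P,
                  mx_rsim M (dadd_grepr P
                    (\big[@dadd_grepr _ _ _/grepr0]_(x <- s)
                       heller x.1 (hook_D F p x.2))) &
                  gamma M = \sum_(x <- s) value x.2]] &
      forall M : module, gamma (tensor M (dual_module M)) = gamma M ^+ 2].
Proof.
move=> module gamma value.
have p_pr := pcharf_prime charFp; have p_gt1 := prime_gt1 p_pr.
have [a a_prim] := primitive_nat charFp.
pose c := Sp_cycle p; have Gc : c \in [set: 'S_p]%G := in_setT c.
have oc := Sp_cycle_order charFp.
pose f : module -> R := phi p c R.
have f_hook i (j : 'I_p.-1) : f (heller i (hook_D F p j)) = value j.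
  rewrite /f (phi_heller charFp Gc oc) /value -mulrA.
  exact: (phi_D charFp Gc oc (Sp_cycle_index charFp) (in_setT _) a_prim
    (Sp_normaliser charFp a_prim) (hook_D_blk charFp a_prim) (hook_D_gen charFp a_prim)).
have f_rsim (M N : module) : mx_rsim M N -> f M = f N by apply: phi_rsim.
have f_dadd M N : f (dadd_grepr M N) = f M + f N by apply: phi_dadd.
have f_proj (P : module) : projective P -> f P = 0 by apply: phi_projective.
have f_tensor M N : f (tensor M N) = f M * f N by apply: phi_tensor.
have decomposition (M : module) : exists (P : module) (s : seq (nat * 'I_p.-1)),
    [/\ projective P, all (fun x => x.1 < (p.-1).*2)%N s &
     mx_rsim M (dadd_grepr P (\big[@dadd_grepr _ _ _/grepr0]_(x <- s)
       heller x.1.+1 (hook_D F p x.2)))].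
  exact: (Heller_decomposition charFp Gc oc (Sp_cycle_index charFp) (in_setT _)
    (Sp_scale_cycle charFp a_prim 1) (Sp_scale_order charFp a_prim) a_prim
    (Sp_normaliser charFp a_prim) (hook_D_blk charFp a_prim) (hook_D_gen charFp a_prim)).
(* The bound on the number of translates makes the family finite, which is what the constants in
   [core_bounds] rest on. *)
pose I : finType := ('I_(p.-1).*2 * 'I_p.-1)%type.
pose X (i : I) : module := heller (i.1 : nat).+1 (hook_D F p i.2).
have gammaE M : gamma M = f M.
  apply: (bs_gamma_phi (X := X)) => // [i|{}M].
    rewrite f_hook /value -mulrA; apply: qdim_ge1 => //=.
    by rewrite -ltn_predRL.
  have [P [s [projP lt_s M_s]]] := decomposition M.
  suff [s' ss'] : exists s' : seq I, \big[@dadd_grepr _ _ _/grepr0]_(x <- s)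
      heller x.1.+1 (hook_D F p x.2) = \big[@dadd_grepr _ _ _/grepr0]_(i <- s') X i.
    by exists P, s'; split=> //; rewrite -ss'.
  elim: s lt_s {M_s} => [_|x s IHs /= /andP[lt_x /IHs[s' ss']]].
    by exists [::]; rewrite !big_nil.
  by exists ((Ordinal lt_x, x.2) :: s'); rewrite !big_cons ss'.
split=> [i j | | M].
- by rewrite gammaE f_hook.
- split=> [M N|M N|M]; rewrite ?gammaE //.
  have [P [s [projP _ M_s]]] := decomposition M.
  exists P, [seq (x.1.+1 : int, x.2) | x <- s]; split=> //.
    by rewrite big_map.
  rewrite (f_rsim _ _ M_s) f_dadd f_proj // add0r big_map {M_s}.
  elim: s => [|x s IHs]; last by rewrite !big_cons f_dadd IHs f_hook.
  (* By additivity the zero module has value 0. *)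
  rewrite !big_nil; apply: (@addIr _ (f grepr0)); rewrite -f_dadd add0r.
  by apply: f_rsim; apply: rsim_dadd0.
by rewrite !gammaE f_tensor [X in _ * X](phi_dual R M Gc p_gt1) expr2.
Qed.
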